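(* Let $g:[0,1]\times E\to\mathbb R$ be bounded and measurable and assume: (i) there is $L>0$ such that $\sup_{x\in E}\|\delta_xQ_u-\delta_xQ_v\|_{\mathrm{TV}}\le L|u-v|$ for all $u,v\in[0,1]$; (ii) there are an integer $m\ge 1$ and $r\in(0,1)$ such that $\sup_{u\in[0,1]}\sup_{x,y\in E}\|\delta_xQ_u^m-\delta_yQ_u^m\|_{\mathrm{TV}}\le r$; (iii) there is $K<\infty$ such that $\sup_{u\in[0,1]}\|g(u,\cdot)\|_\infty\le K$; (iv) there is $C_g\ge 0$ such that $|g(u,x)-g(v,x)|\le C_g|u-v|$ for all $u,v\in[0,1]$, $x\in E$. Suppose also that $a>0$. Then there exist $\epsilon_0>0$ and a positive convex function $c:(0,\epsilon_0)\to\mathbb R$ such that for all $0<\epsilon<\epsilon_0$, $$\lim_{n\to\infty}\frac1n\ln\mathbb P(S_n-bn\ge\epsilon n)=-c(\epsilon).$$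
   Context: $(E,d)$ is a metric space with Borel $\sigma$-algebra $\mathcal B(E)$ and $\{Q_u:u\in[0,1]\}$ is a family of Markov transition kernels on $(E,\mathcal B(E))$. For probability measures, $\|\mu-\nu\|_{\mathrm{TV}}=\sup_{\|f\|_\infty\le1}|\int f\,d\mu-\int f\,d\nu|=2\sup_{A\in\mathcal B(E)}|\mu(A)-\nu(A)|$; $\delta_x$ is the Dirac mass at $x$. Under (i)-(ii) each $Q_u$ has a unique invariant probability measure, denoted $\pi_u$. For each $n\ge1$, $X_{n,0},X_{n,1},\dots,X_{n,n}$ is an inhomogeneous Markov chain on $E$ with $X_{n,0}\sim\pi_0$ (the measure $\pi_u$ at $u=0$) and $\mathbb P(X_{n,k}\in A\mid X_{n,k-1}=x)=Q_{k/n}(x,A)$ for $1\le k\le n$. Set $S_n=\sum_{k=1}^n g(k/n,X_{n,k})$. Constants: $b=\int_0^1\int_E g(u,x)\,d\pi_u(x)\,du$; $a\ge0$ is given by $a^2=\int_0^1a_u^2\,du$, where $a_u^2=\lim_{n\to\infty}\frac1n\operatorname{Var}(\sum_{j=1}^ng(u,Y_{j,u}))$ and $(Y_{j,u})_{j\ge0}$ is the stationary Markov chain with transition operator $Q_u$ (initial law $\pi_u$). *)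

(* Defs.v *)
From HB Require Import structures.
From mathcomp Require Import all_boot all_order all_algebra.
From mathcomp Require Import all_classical all_reals all_analysis.

Set Implicit Arguments.
Unset Strict Implicit.
Unset Printing Implicit Defensive.
Import Order.TTheory GRing.Theory Num.Theory.
Import numFieldNormedType.Exports.

Local Open Scope classical_set_scope.
Local Open Scope ring_scope.

(* The library's measurable types are pointed, so the state space is a nonempty
   metric space; a space carrying a probability measure is nonempty anyway. *)
#[short(type="pmetricType")]
HB.structure Definition PointedMetric (R : numDomainType) :=
  {T of Pointed T & Metric R T}.

Definition borel {R : realType} (E : pmetricType R) :=
  g_sigma_algebraType (@open E).

Definition supnorm {R : realType} {T : Type} (f : T -> R) : \bar R :=
  ereal_sup (range (fun x => `|f x|%:E)).

(* Total variation with the normalisation whose maximal value between two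
   probability measures is 2. *)
Definition tv {d} {T : measurableType d} {R : realType}
    (mu nu : {measure set T -> \bar R}) : \bar R :=
  ereal_sup [set `| \int[mu]_x (f x)%:E - \int[nu]_x (f x)%:E |%E
    | f in [set f : T -> R | measurable_fun setT f /\ (supnorm f <= 1)%E]].

(* Typed as subprobability kernels because that is the class in which the
   library's composition [mkcomp_noparam] lives. *)
Fixpoint kiter {d} {T : measurableType d} {R : realType}
    (Q : R.-pker T ~> T) (m : nat) : R.-spker T ~> T :=
  if m is p.+1 then mkcomp_noparam Q (kiter Q p)
  else kdirac (@measurable_id _ T setT).

Definition invariant_measure {d} {T : measurableType d} {R : realType}
    (Q : R.-pker T ~> T) (mu : probability T R) : Prop :=
  forall A, measurable A -> (\int[mu]_x Q x A)%E = mu A.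

Section markov_chains.
Context {R : realType} {dO} {Omega : measurableType dO}
  {P : probability Omega R} {d} {T : measurableType d}.
Variable X : nat -> {RV P >-> T}.

(* sigma(X_0, ..., X_k) *)
Definition past (k : nat) : set (set Omega) :=
  <<s [set C | exists i B, [/\ (i <= k)%N, measurable B & C = X i @^-1` B] ] >>.

(* X_0, ..., X_N is a Markov chain with initial law mu whose k-th step follows
   kappa k: by definition of conditional probability, the second clause is
   P(X_{k+1} \in A | X_0, ..., X_k) = kappa (k+1) X_k A almost surely.
   The variables X_k with k > N are unconstrained. *)
Definition markov_chain (N : nat) (mu : probability T R)
    (kappa : nat -> R.-pker T ~> T) : Prop :=
  (forall A, measurable A -> P (X 0%N @^-1` A) = mu A) /\
  (forall k, (k < N)%N -> forall C A, past k C -> measurable A ->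
    P (C `&` X k.+1 @^-1` A) = (\int[P]_(w in C) kappa k.+1 (X k w) A)%E).

End markov_chains.

(* S_n for the row X_{n,0}, ..., X_{n,n}. *)
Definition rowsum {R : realType} {Omega T : Type} (g : R -> T -> R) (n : nat)
    (X : nat -> Omega -> T) (w : Omega) : R :=
  \sum_(1 <= k < n.+1) g (k%:R / n%:R) (X k w).

Definition mean_drift {R : realType} {d} {T : measurableType d}
    (g : R -> T -> R) (pi : R -> probability T R) : R :=
  \int[lebesgue_measure]_(u in `[0%R, 1%R]) (\int[pi u]_x g u x).

(* lim_n (1/n) Var(h(Y_1) + ... + h(Y_n)) *)
Definition asymptotic_variance {R : realType} {dO} {Omega : measurableType dO}
    (P : probability Omega R) {T : Type} (h : T -> R)
    (Y : nat -> Omega -> T) : R :=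
  limn (fun n : nat =>
    n%:R^-1 * fine ('V_P[fun w => (\sum_(1 <= j < n.+1) h (Y j w))%R])).

(* Main.v *)
(* Let lam u t be the logarithmic spectral radius of f |-> Q_u (e^(t g_u) f).
   For small |t| these operators preserve a cone of positive functions whose
   oscillation, measured in a seminorm contracted by Q_u, is small compared with
   their minimum. This bounds lam u (t+s) + lam u (t-s) - 2 lam u t by a multiple
   of s^2 and gives lam u t = pi_u(g_u) t + sigma_u^2 t^2 / 2 + O(t^3), both
   uniformly in u, and provides positive approximate eigenfunctions that vary
   continuously with u. Chaining these along the inhomogeneous Markov chain yields
   (1/n) ln E e^(t (S_n - b n)) -> Lam t = \int_0^1 lam u t du - b t.
   The rate c is the Legendre transform of Lam on a small interval [0, t1]. It is
   positive near 0 because Lam = O(t^2), and its maximiser is interior because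
   a > 0 makes Lam t1 positive. In the Gaertner-Ellis lower bound the
   second-difference estimate replaces differentiability of Lam. *)

Require Import Defs.
From HB Require Import structures.
From mathcomp Require Import all_boot all_order all_algebra.
From mathcomp Require Import all_classical all_reals all_analysis.
From mathcomp Require Import measurable_realfun.
From mathcomp Require Import ring lra.

Set Implicit Arguments.
Unset Strict Implicit.
Unset Printing Implicit Defensive.
Import Order.TTheory GRing.Theory Num.Theory.
Import numFieldNormedType.Exports.

Local Open Scope classical_set_scope.
Local Open Scope ring_scope.

(** * Markov operators on bounded measurable functions *)

(** No spectral theory enters: eigenvalues are replaced by growth rates of iterates, and most
    comparisons of pressures come from a pointwise inequality between positive functions, iterated n
    times, whose multiplicative constants disappear in the rate. The cone supplies such constants
    uniformly in n and u. A first obstacle is that (ii) contracts only after m steps; plain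
    oscillation need not decrease in one step, but a weighted sum of the oscillations of the Q^i f
    does. The second-difference bound follows the iterates of 1 at t + s relative to those at t by
    means of a first-order corrector; multiplying the estimates for s and -s cancels the first-order
    terms. Integrability in u of pi_u(g_u) and of the variance has to be derived: both are Taylor
    coefficients at 0 of the pressure, which is continuous in u. The lower tail bound works without
    a change of measure: e^(tW) is dominated by a term containing the tail probability plus two
    terms with exponents t + s and t - s, and at an interior maximiser t these two are exponentially
    smaller than the expectation of e^(tW). *)

Definition bmf {d} {T : measurableType d} {R : realType} (f : T -> R) : Prop :=
  measurable_fun setT f /\ exists M, forall x, `|f x| <= M.

Section bmf_theory.
Context {d} {T : measurableType d} {R : realType}.
Implicit Types f g : T -> R.

Lemma bmf_cst (c : R) : bmf (fun _ : T => c).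
Proof. by split; [exact: measurable_cst | exists `|c|]. Qed.

Lemma bmfD f g : bmf f -> bmf g -> bmf (fun x => f x + g x).
Proof.
move=> [mf [M hM]] [mg [M' hM']]; split; first exact: measurable_funD.
by exists (M + M') => x; rewrite (le_trans (ler_normD _ _))// lerD.
Qed.

Lemma bmfM f g : bmf f -> bmf g -> bmf (fun x => f x * g x).
Proof.
move=> [mf [M hM]] [mg [M' hM']]; split; first exact: measurable_funM.
by exists (M * M') => x; rewrite normrM ler_pM.
Qed.

Lemma bmfZ c f : bmf f -> bmf (fun x => c * f x).
Proof. by move=> hf; apply: bmfM => //; exact: bmf_cst. Qed.

Lemma bmfN f : bmf f -> bmf (fun x => - f x).
Proof.
move=> [mf [M hM]]; split; first exact: measurableT_comp.
by exists M => x; rewrite normrN.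
Qed.

Lemma bmfB f g : bmf f -> bmf g -> bmf (fun x => f x - g x).
Proof. by move=> hf hg; apply: bmfD => //; exact: bmfN. Qed.

Lemma bmf_expR f : bmf f -> bmf (fun x => expR (f x)).
Proof.
move=> [mf [M hM]]; split; first exact: measurableT_comp.
exists (expR M) => x; rewrite ger0_norm ?expR_ge0// ler_expR.
exact: le_trans (ler_norm _) (hM x).
Qed.

Lemma bmfV f (l : R) : 0 < l -> (forall x, l <= f x) -> bmf f ->
  bmf (fun x => (f x)^-1).
Proof.
move=> l0 hl [mf _]; split.
  (* Measurability comes from writing the inverse as exp(-ln f), legitimate because f is
     positive. *)
  rewrite (_ : (fun x => _) = (fun x => expR (- ln (f x)))); last first.
    by apply/funext => x; rewrite expRN lnK// posrE (lt_le_trans l0).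
  by apply: measurableT_comp => //; apply: measurableT_comp => //; exact: measurableT_comp.
exists l^-1 => x; rewrite ger0_norm ?invr_ge0 ?(le_trans (ltW l0))//.
by rewrite lef_pV2// posrE// (lt_le_trans l0).
Qed.

Lemma bmf_sum n (F : nat -> T -> R) : (forall i, bmf (F i)) ->
  bmf (fun x => \sum_(0 <= i < n) F i x).
Proof.
move=> hF; elim: n => [|n ih].
  rewrite (_ : (fun x => _) = (fun=> 0)); first exact: bmf_cst.
  by apply/funext => x; rewrite big_nil.
rewrite (_ : (fun x => _) = (fun x => \sum_(0 <= i < n) F i x + F n x)).
  exact: bmfD.
by apply/funext => x; rewrite big_nat_recr.
Qed.

End bmf_theory.

(** One interface for three kinds of operators: integration against a kernel, its tilted versions,
    and an expectation [Pi], seen as an operator whose output is constant in x. *)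
Record markov_op {d} {T : measurableType d} {R : realType}
    (Q : (T -> R) -> T -> R) : Prop := MarkovOp {
  mop_bmf : forall f, bmf f -> bmf (Q f) ;
  mop_lin : forall a f g x, bmf f -> bmf g ->
    Q (fun y => a * f y + g y) x = a * Q f x + Q g x ;
  mop_ge0 : forall f x, bmf f -> (forall y, 0 <= f y) -> 0 <= Q f x ;
  mop_cst : forall c x, Q (fun=> c) x = c }.

Section markov_op_theory.
Context {d} {T : measurableType d} {R : realType}.
Variables (Q : (T -> R) -> T -> R) (hQ : markov_op Q).
Implicit Types f g : T -> R.

Lemma mopZ c f x : bmf f -> Q (fun y => c * f y) x = c * Q f x.
Proof.
move=> hf; have := mop_lin hQ c x hf (bmf_cst 0).
rewrite (mop_cst hQ) addr0 => <-; congr (Q _ x).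
by apply/funext => y; rewrite addr0.
Qed.

Lemma mopD f g x : bmf f -> bmf g -> Q (fun y => f y + g y) x = Q f x + Q g x.
Proof.
move=> hf hg; have := mop_lin hQ 1 x hf hg.
rewrite mul1r => <-; congr (Q _ x).
by apply/funext => y; rewrite mul1r.
Qed.

Lemma mopB f g x : bmf f -> bmf g -> Q (fun y => f y - g y) x = Q f x - Q g x.
Proof.
move=> hf hg; have := mop_lin hQ (-1) x hg hf.
rewrite mulN1r [RHS]addrC => <-; congr (Q _ x).
by apply/funext => y; rewrite mulN1r addrC.
Qed.

Lemma mop_le f g x : bmf f -> bmf g -> (forall y, f y <= g y) -> Q f x <= Q g x.
Proof.
move=> hf hg fg; rewrite -subr_ge0 -mopB//; apply: (mop_ge0 hQ) => [|y].
  exact: bmfB.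
by rewrite subr_ge0.
Qed.

Lemma mop_leC f c x : bmf f -> (forall y, f y <= c) -> Q f x <= c.
Proof.
move=> hf fc; rewrite -[leRHS](mop_cst hQ c x); apply: mop_le => //.
exact: bmf_cst.
Qed.

Lemma mop_geC f c x : bmf f -> (forall y, c <= f y) -> c <= Q f x.
Proof.
move=> hf fc; rewrite -[leLHS](mop_cst hQ c x); apply: mop_le => //.
exact: bmf_cst.
Qed.

Lemma mop_bound f c x : bmf f -> (forall y, `|f y| <= c) -> `|Q f x| <= c.
Proof.
move=> hf fc; rewrite ler_norml mop_leC ?mop_geC// => y;
by have := fc y; rewrite ler_norml => /andP[].
Qed.

Lemma mop_dist f g c x : bmf f -> bmf g -> (forall y, `|f y - g y| <= c) ->
  `|Q f x - Q g x| <= c.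
Proof. by move=> hf hg fg; rewrite -mopB//; apply: mop_bound => //; exact: bmfB. Qed.

End markov_op_theory.

(** [N] stands for a seminorm equivalent to oscillation and contracted by a single step of [Q].
    Since the constant [c] in [csn_le] is free, [N] vanishes on constants. *)
Record contraction_seminorm {d} {T : measurableType d} {R : realType}
    (Q : (T -> R) -> T -> R) (N : (T -> R) -> R) (C th : R) : Prop :=
  ContractionSeminorm {
  csn_osc : forall f x y, bmf f -> f x - f y <= N f ;
  csnD : forall f g, bmf f -> bmf g -> N (fun x => f x + g x) <= N f + N g ;
  csn_le : forall f c D, bmf f -> (forall x, `|f x - c| <= D) -> N f <= C * D ;
  csn_contr : forall f, bmf f -> N (Q f) <= th * N f }.

(** * Invariant cones and tilted operators *)

Section cone.
Context {d} {T : measurableType d} {R : realType}.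
Variables (Q : (T -> R) -> T -> R) (hQ : markov_op Q).
Variables (N : (T -> R) -> R) (C th : R).
Hypothesis hN : contraction_seminorm Q N C th.
Hypotheses (hC : 1 <= C) (hth0 : 0 <= th) (hth1 : th < 1).
Implicit Types f g h w : T -> R.

Lemma csn_ge0 f : bmf f -> 0 <= N f.
Proof.
by move=> hf; have := csn_osc hN point point hf; rewrite subrr.
Qed.

Lemma csn_pert f g D : bmf f -> bmf g -> (forall x, `|f x - g x| <= D) ->
  N f <= N g + C * D.
Proof.
move=> hf hg fg.
have hfg : bmf (fun x => f x - g x) by exact: bmfB.
have -> : f = (fun x => g x + (f x - g x)).
  by apply/funext => x; rewrite addrC subrK.
apply: le_trans (csnD hN hg hfg) _; rewrite lerD2l.
by apply: (csn_le hN (c := 0)) => // x; rewrite subr0.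
Qed.

Lemma csn_addC f c : bmf f -> N (fun x => f x + c) <= N f.
Proof.
move=> hf; apply: le_trans (csnD hN hf (bmf_cst c)) _.
rewrite gerDl -(mulr0 C); apply: (csn_le hN (c := c)); first exact: bmf_cst.
by move=> x; rewrite subrr normr0.
Qed.

(** A cone of aperture k around the positive constants: the oscillation of h is small relative to
    its infimum, which yields a Harnack inequality with factor 1 + k. *)
Definition cone (k : R) h : Prop :=
  [/\ bmf h, forall x, 0 < h x & forall x, N h <= k * h x].

Lemma cone_cst (k c : R) : 0 <= k -> 0 < c -> cone k (fun=> c).
Proof.
move=> k0 c0; split => [|//|x]; first exact: bmf_cst.
apply: (@le_trans _ _ (C * 0)); last by rewrite mulr0 mulr_ge0// ltW.
by apply: (csn_le hN (c := c)) => [|y]; [exact: bmf_cst | rewrite subrr normr0].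
Qed.

Lemma cone_ratio (k : R) h x y : cone k h -> h x <= (1 + k) * h y.
Proof.
move=> [hh _ hk]; have := csn_osc hN x y hh; have := hk y; lra.
Qed.

Lemma cone_op_ge k h x y : cone k h -> h y <= (1 + k) * Q h x.
Proof.
move=> ch; have [hh _ _] := ch; rewrite -mopZ//.
by apply: mop_geC => // [|z]; [exact: bmfZ | exact: cone_ratio].
Qed.

Lemma cone_op_le k h x y : cone k h -> Q h x <= (1 + k) * h y.
Proof.
by move=> ch; have [hh _ _] := ch; apply: mop_leC => // z; exact: cone_ratio.
Qed.

Lemma weight_op_bounds k h w dl x : cone k h -> bmf w ->
  (forall y, `|w y - 1| <= dl) ->
  (1 - dl) * Q h x <= Q (fun y => w y * h y) x <= (1 + dl) * Q h x.
Proof.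
move=> [hh h0 _] hw hdl; have hwh : bmf (fun y => w y * h y) by exact: bmfM.
rewrite -!mopZ//; apply/andP; split; apply: mop_le => //; try exact: bmfZ.
- move=> y; rewrite ler_pM2r//.
  by have := hdl y; rewrite ler_norml => /andP[]; lra.
- move=> y; rewrite ler_pM2r//.
  by have := hdl y; rewrite ler_norml => /andP[]; lra.
Qed.

Lemma cone_op_gt0 (k : R) h x : 0 <= k -> cone k h -> 0 < Q h x.
Proof.
move=> k0 ch; have := cone_op_ge x point ch; have [_ h0 _] := ch.
by have := h0 point; nra.
Qed.

(** Contraction of [N] by [th] leaves a slack (1 - th) k. The weight uses at most 2 C dl of it
    through the perturbation of [Q h], since 1 + k is at most 2, and at most C dl through the
    decrease of the infimum; hence the factor 3 C. *)
Lemma cone_step k h w dl : cone k h -> bmf w ->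
  (forall y, `|w y - 1| <= dl) -> 0 < k -> k <= 1 -> dl < 1 ->
  dl * (3 * C) <= (1 - th) * k ->
  cone k (Q (fun y => w y * h y)).
Proof.
move=> ch hw hdl k0 k1 dl1 hd; have hC1 := hC.
have [hh h0 hk] := ch; have hwh : bmf (fun y => w y * h y) by exact: bmfM.
have dl0 : 0 <= dl by exact: le_trans (hdl point).
split; first exact: mop_bmf.
- move=> x; have /andP[+ _] := weight_op_bounds x ch hw hdl.
  have := cone_op_gt0 x (ltW k0) ch; nra.
move=> x; have /andP[hlo _] := weight_op_bounds x ch hw hdl.
have q0 := cone_op_gt0 x (ltW k0) ch.
have hNq : N h <= k * Q h x by rewrite -mopZ//; apply: mop_geC => //; exact: bmfZ.
have hp : N (Q (fun y => w y * h y)) <= N (Q h) + C * (dl * ((1 + k) * Q h x)).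
  apply: csn_pert; try exact: mop_bmf.
  move=> z; apply: mop_dist => // y.
  rewrite (_ : _ - _ = (w y - 1) * h y); last by ring.
  by rewrite normrM (gtr0_norm (h0 y)) ler_pM// ?(ltW (h0 y))//; exact: cone_op_ge ch.
apply: (le_trans hp).
have hc := csn_contr hN hh.
apply: (@le_trans _ _ (th * (k * Q h x) + C * (dl * ((1 + k) * Q h x)))).
  rewrite lerD2r; apply: (le_trans hc); exact: ler_wpM2l.
apply: (@le_trans _ _ (k * ((1 - dl) * Q h x))); last by rewrite ler_pM2l.
have -> : th * (k * Q h x) + C * (dl * ((1 + k) * Q h x))
  = (th * k + C * dl * (1 + k)) * Q h x by ring.
rewrite mulrA ler_pM2r//.
have h1 : C * dl * (1 + k) <= C * dl * 2.
  by apply: ler_wpM2l; [rewrite mulr_ge0//; lra | lra].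
have h2 : k * dl <= C * dl by apply: ler_wpM2r => //; lra.
lra.
Qed.

(** Doob transform: the weighted operator f -> Q (w f) is conjugated by h and normalised to fix
    constants. *)
Definition tilt w h f x : R :=
  Q (fun y => w y * h y * f y) x / Q (fun y => w y * h y) x.

Section tilt_theory.
Variables (k : R) (h w : T -> R) (dl : R).
Hypotheses (ch : cone k h) (hw : bmf w) (hdl : forall y, `|w y - 1| <= dl).
Hypotheses (k0 : 0 < k) (k8 : 8 * k <= 1) (dlk : dl <= k).

Let dl0 : 0 <= dl. Proof. exact: le_trans (hdl point). Qed.
Let hh : bmf h. Proof. by case: ch. Qed.
Let h0 y : 0 < h y. Proof. by case: ch. Qed.
Let hwh : bmf (fun y => w y * h y). Proof. exact: bmfM. Qed.
Let q0 x : 0 < Q h x. Proof. by apply: cone_op_gt0 ch; exact: ltW. Qed.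

Lemma tilt_den_gt0 x : 0 < Q (fun y => w y * h y) x.
Proof.
have k0' := k0; have k8' := k8; have dlk' := dlk.
have /andP[+ _] := weight_op_bounds x ch hw hdl.
by apply: lt_le_trans; rewrite mulr_gt0//; lra.
Qed.

(** The density of the tilted kernel with respect to Q is close to 1: w is within k of 1, while h y
    and Q h x agree up to a factor 1 + k. The bound 8 k <= 1 absorbs the higher powers of k. *)
Lemma tilt_weight x y :
  `|w y * h y / Q (fun y => w y * h y) x - 1| <= 4 * k.
Proof.
have k0' := k0; have k8' := k8; have dlk' := dlk.
have /andP[m1 m2] := weight_op_bounds x ch hw hdl.
have m0 := tilt_den_gt0 x; set m := Q _ x in m0 m1 m2 *.
have := cone_op_ge x y ch; have := cone_op_le x y ch.
have := hdl y; rewrite ler_norml => /andP[w1 w2] c1 c2.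
have q := q0 x; have hy := h0 y.
rewrite ler_norml lerBrDr lerBlDr ler_pdivlMr// ler_pdivrMr//; apply/andP; split.
- have e1 : (1 - k) * h y <= w y * h y by rewrite ler_pM2r//; lra.
  have e2 : m <= (1 + k) * ((1 + k) * h y).
    apply: (le_trans m2); apply: (@le_trans _ _ ((1 + k) * Q h x)).
      by rewrite ler_pM2r//; lra.
    by rewrite ler_pM2l//; lra.
  apply: le_trans e1; apply: (@le_trans _ _ ((1 - 4 * k) * ((1 + k) * ((1 + k) * h y)))).
    by rewrite addrC ler_pM2l//; lra.
  rewrite !mulrA ler_pM2r//; nra.
- have e1 : w y * h y <= (1 + k) * h y by rewrite ler_pM2r//; lra.
  apply: (le_trans e1); apply: (@le_trans _ _ ((1 + k) * ((1 + k) * Q h x))).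
    by rewrite ler_pM2l//; lra.
  apply: (@le_trans _ _ ((4 * k + 1) * ((1 - k) * Q h x))).
    rewrite !mulrA ler_pM2r//; nra.
  rewrite ler_pM2l; last by lra.
  by apply: le_trans m1; rewrite ler_pM2r//; lra.
Qed.

Lemma tilt_markov : markov_op (tilt w h).
Proof.
have k0' := k0; have k8' := k8; have dlk' := dlk.
split.
- move=> f hf; apply: bmfM; first by apply: mop_bmf => //; exact: bmfM.
  (* The quotient is bounded because the Harnack inequality bounds the denominator below, uniformly
     in x, by a multiple of h at one point. *)
  have [M hM] : exists2 M, 0 < M & forall x, M <= Q (fun y => w y * h y) x.
    exists ((1 - k) * (h point / (1 + k))).
      by rewrite mulr_gt0 ?divr_gt0//; lra.
    move=> x; have /andP[+ _] := weight_op_bounds x ch hw hdl.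
    apply: le_trans; apply: ler_pM; try lra.
      by rewrite divr_ge0//; [exact: ltW | lra].
    by rewrite ler_pdivrMr; [rewrite mulrC; exact: cone_op_ge | lra].
  by move=> hM'; apply: (bmfV hM hM'); exact: mop_bmf.
- move=> a f g x hf hg; rewrite /tilt.
  rewrite (_ : (fun y => _ * (a * f y + g y)) =
    (fun y => a * (w y * h y * f y) + w y * h y * g y)); last first.
    by apply/funext => y; ring.
  by rewrite (mop_lin hQ) ?mulrDl ?mulrA//; exact: bmfM.
- move=> f x hf f0; rewrite divr_ge0// ?(ltW (tilt_den_gt0 _))//.
  apply: (mop_ge0 hQ); first exact: bmfM.
  move=> y; rewrite mulr_ge0//; rewrite mulr_ge0 ?(ltW (h0 _))//.
  by have := hdl y; rewrite ler_norml => /andP[]; lra.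
- move=> c x; rewrite /tilt.
  rewrite (_ : (fun y => _ * c) = (fun y => c * (w y * h y))); last first.
    by apply/funext => y; ring.
  by rewrite mopZ// mulfK// gt_eqF// tilt_den_gt0.
Qed.

Lemma tilt_close f D x : bmf f -> (forall y, `|f y| <= D) ->
  `|tilt w h f x - Q f x| <= 4 * k * D.
Proof.
move=> hf hD; rewrite /tilt; set m := Q (fun y => w y * h y) x.
have -> : Q (fun y => w y * h y * f y) x / m =
    Q (fun y => w y * h y / m * f y) x.
  rewrite mulrC -mopZ//; last exact: bmfM.
  by congr (Q _ x); apply/funext => y; ring.
apply: mop_dist => //.
  by apply: bmfM => //; apply: bmfM => //; exact: bmf_cst.
move=> y; rewrite (_ : _ - _ = (w y * h y / m - 1) * f y); last by ring.
by rewrite normrM ler_pM// tilt_weight.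
Qed.

(** On f - f(point), whose sup norm is at most N f, the tilted operator and Q differ by at most 4 k
    N f; since both fix constants, this is a perturbation of the contraction of Q. *)
Lemma tilt_contr f : bmf f -> N (tilt w h f) <= (th + 4 * k * C) * N f.
Proof.
move=> hf; have hm := tilt_markov.
have e : forall x, `|tilt w h f x - Q f x| <= 4 * k * N f.
  move=> x; have hfc : bmf (fun y => f y - f point).
    by apply: bmfB => //; exact: bmf_cst.
  have := tilt_close (D := N f) x hfc; rewrite !mopB//; try exact: bmf_cst.
  rewrite !(mop_cst hm) !(mop_cst hQ) opprD addrACA subrr addr0; apply.
  move=> y; rewrite ler_norml (csn_osc hN)// andbT lerNl opprB.
  exact: (csn_osc hN).
apply: le_trans (csn_pert (mop_bmf hm hf) (mop_bmf hQ hf) e) _.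
have := csn_contr hN hf; lra.
Qed.

End tilt_theory.
End cone.

(** * Exponential inequalities and almost additive sequences *)

Section real_lemmas.
Context {R : realType}.
Implicit Types (a c x y t : R).

Lemma expR_le_inv y : y < 1 -> expR y <= (1 - y)^-1.
Proof.
move=> y1; rewrite -[expR y]invrK -expRN lef_pV2 ?posrE ?expR_gt0//; last by lra.
exact: expR_ge1Dx.
Qed.

Lemma expR_le_quad y : `|y| <= 1 / 2 -> expR y <= 1 + y + 2 * y ^+ 2.
Proof.
rewrite ler_norml => /andP[y1 y2]; have y3 : 0 < 1 - y by lra.
apply: (le_trans (expR_le_inv _)); first by lra.
rewrite -[leLHS]mul1r ler_pdivrMr// expr2; nra.
Qed.

Lemma expR_dist1 y : `|y| <= 1 / 2 -> `|expR y - 1| <= 2 * `|y|.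
Proof.
move=> hy; have e1 := expR_le_quad hy; have e2 := expR_ge1Dx y.
have y2 : y ^+ 2 <= `|y| / 2.
  rewrite -real_normK ?num_real// expr2 ler_wpM2l//; lra.
have := ler_norm y; have := ler_norm (- y); rewrite normrN ler_norml => h1 h2.
by apply/andP; split; lra.
Qed.

(** Mean value theorem for the Taylor remainder, whose derivative e^z - 1 - z lies between 0 and 2
    z^2. *)
Lemma expR_cubic y : `|y| <= 1 / 2 ->
  `|expR y - (1 + y + y ^+ 2 / 2)| <= 2 * `|y| ^+ 3.
Proof.
move=> hy; pose f z := expR z - (1 + z + z ^+ 2 / 2) : R.
pose df z := expR z - 1 - z : R.
have hf (x : R) : is_derive x 1 f (df x).
  rewrite (_ : f = expR - (cst 1 + id + 2^-1 *: (id ^+ 2))); last first.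
    by apply/funext => z; rewrite /f /=; rewrite !fctE/= /GRing.scale/= [2^-1 * _]mulrC.
  have d2 := is_deriveZ 2^-1 (is_deriveX 2 (is_derive_id x 1)).
  have d1 := is_deriveD (is_derive_cst (1 : R) x 1) (is_derive_id x 1).
  apply: (is_derive_eq (is_deriveB (is_derive_expR x) (is_deriveD d1 d2))).
  by rewrite /df /GRing.scale /=; field.
have cf (A : set R) : {within A, continuous f}.
  apply: continuous_subspaceT => x.
  by apply: differentiable_continuous; apply/derivable1_diffP; by have [] := hf x.
have f0 : f 0 = 0 by rewrite /f expR0; lra.
have hdf z : `|z| <= `|y| -> `|df z| <= 2 * `|y| ^+ 2.
  move=> zy; have e1 : expR z <= 1 + z + 2 * z ^+ 2 by apply: expR_le_quad; lra.
  have e2 := expR_ge1Dx z.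
  have : z ^+ 2 <= `|y| ^+ 2 by rewrite -real_normK ?num_real// lerXn2r.
  by rewrite /df ler_norml => e3; apply/andP; split; nra.
suff h : `|f y| <= 2 * `|y| ^+ 2 * `|y| by rewrite (exprSr _ 2) mulrA.
have [y0|y0|->] := ltgtP y 0; last by rewrite f0 normr0 mulr_ge0// mulr_ge0// exprn_ge0.
- have [c cy] := MVT y0 (fun x _ => hf x) (cf _).
  rewrite f0 sub0r => /(congr1 (fun x => `|x|)); rewrite normrN => ->.
  rewrite sub0r normrM normrN ler_wpM2r//; apply: hdf.
  by move: cy; rewrite in_itv/= => /andP[c1 c2]; rewrite !ltr0_norm//; lra.
- have [c cy] := MVT y0 (fun x _ => hf x) (cf _).
  rewrite f0 !subr0 => ->; rewrite normrM ler_wpM2r//; apply: hdf.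
  by move: cy; rewrite in_itv/= => /andP[c1 c2]; rewrite !gtr0_norm//; lra.
Qed.

Lemma natr_ge_ex x : exists2 n : nat, (0 < n)%N & x <= n%:R.
Proof.
exists (Num.bound `|x|).+1 => //; have := archi_boundP (normr_ge0 x).
by rewrite -natr1; have := ler_norm x; lra.
Qed.

(** This is how multiplicative constants are removed from comparisons of exponential rates. *)
Lemma exp_growth_le0 (a A : R) : (forall n : nat, expR (n%:R * a) <= A) -> a <= 0.
Proof.
move=> h; rewrite leNgt; apply/negP => a0.
have [n] : exists n : nat, A < n%:R * a.
  have [n _ hn] := natr_ge_ex (A / a + 1); exists n.
  by rewrite -ltr_pdivrMr//; lra.
by apply/negP; rewrite -leNgt (le_trans _ (h n))// (le_trans _ (expR_ge1Dx _))// lerDr.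
Qed.

(** A two-sided form of Fekete's lemma: bounded defect gives not only a limit of u n / n but an
    error bounded uniformly in n. *)
Lemma almost_additive (u : nat -> R) c :
  (forall n k, `|u (n + k)%N - u n - u k| <= c) ->
  forall n, `|u n - n%:R * inf [set (u m.+1 + c) / m.+1%:R | m in setT]| <= c.
Proof.
move=> hu.
have c0 : 0 <= c by exact: le_trans (hu 0%N 0%N).
have hi k n : `|u (k.+1 * n)%N - k.+1%:R * u n| <= k%:R * c.
  elim: k => [|k ih]; first by rewrite mul1n mul1r subrr normr0 mul0r.
  rewrite mulSn -[k.+2%:R]natr1 -[X in _ <= X * _]natr1.
  rewrite (_ : _ - _ = (u (n + k.+1 * n)%N - u n - u (k.+1 * n)%N) +
    (u (k.+1 * n)%N - k.+1%:R * u n)); last by ring.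
  by rewrite (le_trans (ler_normD _ _))// mulrDl mul1r addrC lerD.
(* Evaluating u at the product of the two lengths in two ways puts every lower quotient below every
   upper one. *)
have hnm n m : (u n.+1 - c) / n.+1%:R <= (u m.+1 + c) / m.+1%:R.
  rewrite ler_pdivrMr// mulrAC ler_pdivlMr//.
  have := hi n m.+1; have := hi m n.+1.
  rewrite mulnC !ler_norml => /andP[h1 h2] /andP[h3 h4].
  have : (m%:R : R) = m.+1%:R - 1 by rewrite -natr1 addrK.
  have : (n%:R : R) = n.+1%:R - 1 by rewrite -natr1 addrK.
  move=> en em; rewrite en em in h1 h2 h3 h4 *; lra.
set S := [set _ | _ in _].
have hS : has_inf S.
  split; first by exists ((u 1%N + c) / 1); exists 0%N.
  by exists ((u 1%N - c) / 1) => _ [m _ <-]; exact: hnm.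
case=> [|n].
  by rewrite mul0r subr0; have := hu 0%N 0%N; rewrite addn0 subrr sub0r normrN.
rewrite ler_norml; apply/andP; split.
- rewrite lerBrDl -lerBrDr opprK mulrC -ler_pdivlMr//.
  by apply: ge_inf; [case: hS | exists n].
- rewrite lerBlDr -lerBlDl mulrC -ler_pdivrMr//.
  by apply: lb_le_inf; [case: hS | move=> _ [m _ <-]].
Qed.

End real_lemmas.

(** * Logarithmic spectral radius *)

Section laplace.
Context {d} {T : measurableType d} {R : realType}.

Definition laplace (Q : (T -> R) -> T -> R) (g : T -> R) (t : R) (f : T -> R) :
  T -> R := Q (fun y => expR (t * g y) * f y).

(** At x, the moment generating function of g(X_1) + ... + g(X_n) for the chain started at x. *)
Definition laplaceZ Q g t n : T -> R := iter n (laplace Q g t) (fun=> 1).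

(* The logarithm of the spectral radius of [laplace Q g t]. It is locked
   because unifying two of its values would otherwise unfold [inf] and [ln]. *)
Definition pressure := locked (fun Q g t =>
  inf [set (ln (laplaceZ Q g t m.+1 point) + ln 2) / m.+1%:R | m in setT] : R).

End laplace.

Section laplace_theory.
Context {d} {T : measurableType d} {R : realType}.
Variables (Q : (T -> R) -> T -> R) (hQ : markov_op Q) (g : T -> R).
Hypothesis hg : bmf g.
Implicit Types (t s : R) (f : T -> R).

Let bmfw t : bmf (fun y => expR (t * g y)).
Proof. by apply: bmf_expR; exact: bmfZ. Qed.

Lemma laplace_bmf t f : bmf f -> bmf (laplace Q g t f).
Proof. by move=> hf; apply: (mop_bmf hQ); exact: bmfM. Qed.

Lemma laplace_le t f f' x : bmf f -> bmf f' -> (forall y, f y <= f' y) ->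
  laplace Q g t f x <= laplace Q g t f' x.
Proof.
move=> hf hf' ff'; apply: (mop_le hQ); [exact: bmfM | exact: bmfM |].
move=> y; by rewrite ler_pM2l// expR_gt0.
Qed.

Lemma laplace_scale t c f x : bmf f ->
  laplace Q g t (fun y => c * f y) x = c * laplace Q g t f x.
Proof.
move=> hf; rewrite /laplace -mopZ//; last exact: bmfM.
by congr (Q _ x); apply/funext => y; ring.
Qed.

Lemma laplace_iter_bmf t n f : bmf f -> bmf (iter n (laplace Q g t) f).
Proof. by move=> hf; elim: n => //= n; exact: laplace_bmf. Qed.

Lemma laplace_iter_le t n f f' x : bmf f -> bmf f' -> (forall y, f y <= f' y) ->
  iter n (laplace Q g t) f x <= iter n (laplace Q g t) f' x.
Proof.
move=> hf hf' ff'; elim: n x => //= n ih x.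
by apply: laplace_le => //; exact: laplace_iter_bmf.
Qed.

Lemma laplace_iter_scale t n c f x : bmf f ->
  iter n (laplace Q g t) (fun y => c * f y) x = c * iter n (laplace Q g t) f x.
Proof.
move=> hf; elim: n x => //= n ih x; rewrite -laplace_scale//; last first.
  exact: laplace_iter_bmf.
by congr (laplace Q g t _ x); apply/funext.
Qed.

Lemma laplaceZ_bmf t n : bmf (laplaceZ Q g t n).
Proof. by apply: laplace_iter_bmf; exact: bmf_cst. Qed.

Lemma laplace_iter_ge t n (c : R) f : bmf f -> (forall x, c * f x <= laplace Q g t f x) ->
  0 <= c -> forall x, c ^+ n * f x <= iter n (laplace Q g t) f x.
Proof.
move=> hf h c0; elim: n => [|n ih] x /=; first by rewrite mul1r.
rewrite exprSr -mulrA (le_trans (ler_wpM2l _ (h x))) ?exprn_ge0// -laplace_scale//.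
by apply: laplace_le => //; [exact: bmfZ | exact: laplace_iter_bmf].
Qed.

Lemma laplace_iter_sub t n (c : R) f : bmf f -> (forall x, laplace Q g t f x <= c * f x) ->
  0 <= c -> forall x, iter n (laplace Q g t) f x <= c ^+ n * f x.
Proof.
move=> hf h c0; elim: n => [|n ih] x /=; first by rewrite mul1r.
rewrite exprSr -mulrA (le_trans _ (ler_wpM2l _ (h x))) ?exprn_ge0// -laplace_scale//.
by apply: laplace_le => //; [exact: laplace_iter_bmf | exact: bmfZ].
Qed.

Variables (N : (T -> R) -> R) (C th K : R).
Hypothesis hN : contraction_seminorm Q N C th.
Hypotheses (hC : 1 <= C) (hth0 : 0 <= th) (hth1 : th < 1).
Hypotheses (hK0 : 0 <= K) (hK : forall x, `|g x| <= K).

(** Chosen so that 4 k C = (1 - th) / 2; the tilted operators then contract at rate (1 + th) / 2. *)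
Definition cone_aperture : R := (1 - th) / (8 * C).
(** The largest deviation of the weight from 1 that [cone_step] allows at this aperture. *)
Definition weight_radius : R := (1 - th) * cone_aperture / (3 * C).

Local Notation kap := cone_aperture.
Local Notation dl := weight_radius.

Lemma cone_aperture_gt0 : 0 < kap.
Proof. by have h1 := hth1; have h2 := hC; rewrite divr_gt0//; lra. Qed.

Lemma cone_aperture_le : 8 * kap * C = 1 - th.
Proof. by have h2 := hC; rewrite /kap; field; rewrite gt_eqF//; lra. Qed.

Lemma cone_aperture_le1 : 8 * kap <= 1.
Proof.
have h1 := hth0; have h2 := hC; have h3 := cone_aperture_le.
have h4 := cone_aperture_gt0; nra.
Qed.

Lemma weight_radiusE : dl * (3 * C) = (1 - th) * kap.
Proof. by have h2 := hC; rewrite /dl mulfVK// gt_eqF//; lra. Qed.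

Lemma weight_radius_gt0 : 0 < dl.
Proof.
have h1 := hth1; have h2 := hC; have h3 := cone_aperture_gt0.
by apply: divr_gt0; [apply: mulr_gt0 => //; lra | lra].
Qed.

Lemma weight_radius_le : dl <= kap.
Proof.
have h1 := hth0; have h2 := hC; have h3 := weight_radiusE.
have h4 := weight_radius_gt0; have h5 := cone_aperture_gt0; nra.
Qed.

Definition small_tilt t : Prop := 2 * (`|t| * K) <= dl.

Lemma small_tilt_weight t x : small_tilt t -> `|expR (t * g x) - 1| <= dl.
Proof.
move=> ht; have h0 : `|t * g x| <= `|t| * K by rewrite normrM ler_wpM2l.
have h1 := weight_radius_le; have h2 := cone_aperture_le1.
apply: (le_trans (expR_dist1 _)); rewrite /small_tilt in ht; lra.
Qed.

Lemma laplaceZ_cone t n : small_tilt t -> cone N kap (laplaceZ Q g t n).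
Proof.
have h0 := cone_aperture_gt0; have h1 := cone_aperture_le1.
have h2 := weight_radius_le.
move=> ht; elim: n => [|n ih] /=.
  by apply: (cone_cst hN) => //; exact: ltW.
rewrite /laplace; apply: (cone_step hQ hN hC hth0 ih (bmfw t) (dl := dl)) => //; try lra.
- by move=> y; exact: small_tilt_weight.
- by rewrite weight_radiusE.
Qed.

Lemma laplaceZ_gt0 t n x : small_tilt t -> 0 < laplaceZ Q g t n x.
Proof. by move=> ht; case: (laplaceZ_cone n ht). Qed.

Lemma laplaceZ_ratio t n x y : small_tilt t ->
  laplaceZ Q g t n x <= 2 * laplaceZ Q g t n y.
Proof.
move=> ht; have := cone_ratio hN x y (laplaceZ_cone n ht).
have := laplaceZ_gt0 n y ht; have := cone_aperture_le1; nra.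
Qed.

(** By the Harnack inequality the inner k iterates are constant up to a factor 2, so they can be
    replaced by their value at [point] and pulled out. *)
Lemma laplaceZD t n k x : small_tilt t ->
  laplaceZ Q g t n x * laplaceZ Q g t k point / 2 <= laplaceZ Q g t (n + k) x
  <= 2 * (laplaceZ Q g t n x * laplaceZ Q g t k point).
Proof.
move=> ht.
have -> : laplaceZ Q g t (n + k) x = iter n (laplace Q g t) (laplaceZ Q g t k) x.
  by rewrite /laplaceZ iterD.
have e c : c * laplaceZ Q g t n x = iter n (laplace Q g t) (fun=> c * 1) x.
  by rewrite -laplace_iter_scale//; exact: bmf_cst.
apply/andP; split.
- rewrite -mulrA mulrC e; apply: laplace_iter_le => //.
  + exact: bmf_cst.
  + exact: laplaceZ_bmf.
  + by move=> y; rewrite mulr1 ler_pdivrMr// mulrC; exact: laplaceZ_ratio.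
- have -> : 2 * (laplaceZ Q g t n x * laplaceZ Q g t k point) =
      2 * laplaceZ Q g t k point * laplaceZ Q g t n x by ring.
  rewrite e; apply: laplace_iter_le => //.
  + exact: laplaceZ_bmf.
  + exact: bmf_cst.
  + by move=> y; rewrite mulr1; exact: laplaceZ_ratio.
Qed.

Lemma pressure_ln t n : small_tilt t ->
  `|ln (laplaceZ Q g t n point) - n%:R * pressure Q g t| <= ln 2.
Proof.
move=> ht; rewrite /pressure -lock.
apply: (almost_additive (u := fun n => ln (laplaceZ Q g t n point))).
move=> {}n k; have /andP[h1 h2] := laplaceZD n k point ht.
have zn := laplaceZ_gt0 n point ht; have zk := laplaceZ_gt0 k point ht.
have znk := laplaceZ_gt0 (n + k) point ht.
move: h1 h2; rewrite -ler_ln ?posrE ?divr_gt0 ?mulr_gt0//.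
rewrite ln_div ?posrE ?mulr_gt0// lnM ?posrE// => h1.
rewrite -ler_ln ?posrE ?mulr_gt0// lnM ?posrE ?mulr_gt0// lnM ?posrE// => h2.
by rewrite ler_norml; apply/andP; split; lra.
Qed.

(** One factor 2 comes from the almost additivity of ln Z at [point], the other from moving to an
    arbitrary x. *)
Lemma pressure_bounds t n x : small_tilt t ->
  expR (n%:R * pressure Q g t) <= 4 * laplaceZ Q g t n x /\
  laplaceZ Q g t n x <= 4 * expR (n%:R * pressure Q g t).
Proof.
move=> ht; have := pressure_ln n ht; rewrite ler_norml => /andP[h1 h2].
have zp := laplaceZ_gt0 n point ht.
have r1 := laplaceZ_ratio n x point ht; have r2 := laplaceZ_ratio n point x ht.
have h3 : n%:R * pressure Q g t <= ln (laplaceZ Q g t n point) + ln 2 by lra.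
have h4 : ln (laplaceZ Q g t n point) <= n%:R * pressure Q g t + ln 2 by lra.
move: h3 h4; rewrite -ler_expR expRD !lnK ?posrE// => h3.
by rewrite -ler_expR expRD !lnK ?posrE// => h4; split; lra.
Qed.

Lemma pressure_le t (c A : R) : small_tilt t ->
  (forall n, laplaceZ Q g t n point <= A * expR (n%:R * c)) ->
  pressure Q g t <= c.
Proof.
move=> ht h; rewrite -subr_le0; apply: (@exp_growth_le0 R _ (4 * A)) => n.
have [h1 _] := pressure_bounds n point ht.
rewrite mulrBr expRD expRN ler_pdivrMr ?expR_gt0//.
by have := h n; lra.
Qed.

Lemma pressure_ge t (c A : R) : small_tilt t ->
  (forall n, expR (n%:R * c) <= A * laplaceZ Q g t n point) ->
  c <= pressure Q g t.
Proof.
move=> ht h; rewrite -subr_le0; apply: (@exp_growth_le0 R _ (4 * A)) => n.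
have [_ h1] := pressure_bounds n point ht.
rewrite mulrBr expRD expRN ler_pdivrMr ?expR_gt0//.
have A0 : 0 <= A.
  have := h n; have := expR_gt0 (n%:R * c); have := laplaceZ_gt0 n point ht; nra.
by have := h n; have := ler_wpM2l A0 h1; lra.
Qed.

(** Collatz-Wielandt principle: the inequality for f is iterated, and f is compared with the
    constant 1. It reduces upper bounds on the pressure to finding a positive trial function;
    [pressure_sup] does the same for lower bounds. *)
Lemma pressure_sub t (c l : R) f : small_tilt t -> bmf f -> 0 < l ->
  (forall x, l <= f x) -> (forall x, laplace Q g t f x <= expR c * f x) ->
  pressure Q g t <= c.
Proof.
move=> ht hf l0 lf h; apply: (@pressure_le _ _ (f point / l)) => // n.
have := laplace_iter_sub n hf h (expR_ge0 c) point.
rewrite -expRM_natl mulrC => h1.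
rewrite mulrAC ler_pdivlMr// mulrC; apply: le_trans h1.
rewrite -laplace_iter_scale; last exact: bmf_cst.
apply: laplace_iter_le => //; first exact: bmf_cst.
by move=> y; rewrite mulr1.
Qed.

Lemma pressure_sup t (c U : R) f : small_tilt t -> bmf f ->
  (forall x, 0 < f x) -> (forall x, f x <= U) ->
  (forall x, expR c * f x <= laplace Q g t f x) ->
  c <= pressure Q g t.
Proof.
move=> ht hf f0 fU h; apply: (@pressure_ge _ _ (U / f point)) => // n.
have := laplace_iter_ge n hf h (expR_ge0 c) point.
rewrite -expRM_natl => h1.
rewrite mulrAC ler_pdivlMr//; apply: (le_trans h1).
rewrite -laplace_iter_scale; last exact: bmf_cst.
apply: laplace_iter_le => //; first exact: bmf_cst.
by move=> y; rewrite mulr1.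
Qed.

(** Changing t to s multiplies the weight of each step by at most e^(|s - t| K). *)
Lemma pressure_lip_le t s : small_tilt t -> small_tilt s ->
  pressure Q g s <= pressure Q g t + `|s - t| * K.
Proof.
move=> ht hs; apply: (@pressure_le _ _ 4) => // n.
have h : forall x, laplaceZ Q g s n x <= expR (n%:R * (`|s - t| * K)) * laplaceZ Q g t n x.
  elim: n => [|n ih] x; first by rewrite mul0r expR0 mulr1.
  rewrite /laplaceZ !iterS -/(laplaceZ Q g s n) -/(laplaceZ Q g t n).
  rewrite -laplace_scale; last exact: laplaceZ_bmf.
  rewrite /laplace; apply: mop_le => //.
  - by apply: bmfM => //; exact: laplaceZ_bmf.
  - by apply: bmfM => //; apply: bmfZ; exact: laplaceZ_bmf.
  move=> y; apply: (@le_trans _ _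
    (expR (s * g y) * (expR (n%:R * (`|s - t| * K)) * laplaceZ Q g t n y))).
    by rewrite ler_pM2l ?expR_gt0.
  rewrite !mulrA ler_pM2r ?laplaceZ_gt0// -!expRD ler_expR.
  rewrite -[n.+1%:R]natr1.
  have : (s - t) * g y <= `|s - t| * K.
    by rewrite (le_trans (ler_norm _))// normrM ler_wpM2l.
  lra.
rewrite (le_trans (h point))// mulrDr expRD.
have [_ h2] := pressure_bounds n point ht.
by have := ler_wpM2l (expR_ge0 (n%:R * (`|s - t| * K))) h2; lra.
Qed.

Lemma pressure_lip t s : small_tilt t -> small_tilt s ->
  `|pressure Q g s - pressure Q g t| <= K * `|s - t|.
Proof.
move=> ht hs; rewrite ler_norml; have h1 := pressure_lip_le ht hs.
have h2 := pressure_lip_le hs ht; rewrite distrC in h2.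
by apply/andP; split; lra.
Qed.

Lemma pressure0 : small_tilt 0 -> pressure Q g 0 = 0.
Proof.
move=> h0; apply/eqP; rewrite eq_le; apply/andP; split.
- apply: (@pressure_sub _ 0 1 (fun=> 1)) => //; first exact: bmf_cst.
  move=> x; rewrite /laplace expR0 mulr1 mop_leC// => [|y].
    by apply: bmfM; [exact: bmfw | exact: bmf_cst].
  by rewrite mul0r expR0 mulr1.
- apply: (@pressure_sup _ 0 1 (fun=> 1)) => //; first exact: bmf_cst.
  move=> x; rewrite /laplace expR0 mulr1 mop_geC// => [|y].
    by apply: bmfM; [exact: bmfw | exact: bmf_cst].
  by rewrite mul0r expR0 mulr1.
Qed.

End laplace_theory.

(** * Second differences of the pressure *)

Section second_difference.
Context {d} {T : measurableType d} {R : realType}.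
Variables (Q : (T -> R) -> T -> R) (hQ : markov_op Q) (g : T -> R).
Hypothesis hg : bmf g.
Variables (N : (T -> R) -> R) (C th K : R).
Hypothesis hN : contraction_seminorm Q N C th.
Hypotheses (hC : 1 <= C) (hth0 : 0 <= th) (hth1 : th < 1).
Hypotheses (hK0 : 0 <= K) (hK : forall x, `|g x| <= K).
Implicit Types (t s : R) (f : T -> R).

(** Chosen so that (1 + th) / 2 times C K + B is at most B: the ball of correctors is then preserved
    by adding g and applying a tilted operator. *)
Definition corrector_bound : R := 2 * C * K / (1 - th).

Local Notation B := corrector_bound.

(** The first two terms are the quadratic error of [exp_affine_le], the third bounds the product of
    the corrector with its removed mean; the factor 2 compensates for 1 + s phi being only at least
    1/2. *)
Definition second_difference_bound : R :=
  2 * (K * B + 3 * K ^+ 2 + B * (K + B)).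

Local Notation A := second_difference_bound.

Lemma corrector_bound_ge0 : 0 <= B.
Proof.
have h1 := hC; have h2 := hth1; have h3 := hK0.
by rewrite /B divr_ge0 ?mulr_ge0//; lra.
Qed.

Lemma exp_affine_le (s p f b : R) : `|p| <= K -> `|f| <= b -> `|s| * b <= 1 / 2 ->
  `|s| * K <= 1 / 2 ->
  expR (s * p) * (1 + s * f) <= 1 + s * (p + f) + s ^+ 2 * (K * b + 3 * K ^+ 2).
Proof.
move=> hp hf sb sK.
have sp : `|s * p| <= 1 / 2 by rewrite normrM (le_trans _ sK)// ler_wpM2l.
have : `|s * f| <= 1 / 2 by rewrite normrM (le_trans _ sb)// ler_wpM2l.
rewrite ler_norml => /andP[f1 f2].
have f3 : 0 <= 1 + s * f by lra.
apply: (le_trans (ler_wpM2r f3 (expR_le_quad sp))).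
have p2 : p ^+ 2 <= K ^+ 2.
  by rewrite -real_normK ?num_real// lerXn2r// nnegrE (le_trans _ hp).
have pf : p * f <= K * b by rewrite (le_trans (ler_norm _))// normrM ler_pM.
have e1 : (s * p) ^+ 2 * (1 + s * f) <= s ^+ 2 * K ^+ 2 * (3 / 2).
  rewrite exprMn; apply: ler_pM => //; last by lra.
  - by rewrite mulr_ge0// sqr_ge0.
  - by rewrite ler_wpM2l// sqr_ge0.
have e2 : s ^+ 2 * (p * f) <= s ^+ 2 * (K * b) by rewrite ler_wpM2l// sqr_ge0.
have -> : (1 + s * p + 2 * (s * p) ^+ 2) * (1 + s * f) =
  1 + s * (p + f) + s ^+ 2 * (p * f) + 2 * ((s * p) ^+ 2 * (1 + s * f)) by ring.
lra.
Qed.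

(* [phi] is an approximate first-order corrector of the perturbed iterates:
   it solves the Poisson equation of the chain tilted by [laplaceZ Q g t n]. *)
Lemma laplaceZ_perturb t n : small_tilt C th K t ->
  exists (phi : T -> R) (sg : R), [/\ bmf phi, N phi <= B,
    forall x, `|phi x| <= B &
    forall s x, `|s| * B <= 1 / 2 ->
      laplaceZ Q g (t + s) n x <=
      laplaceZ Q g t n x * (1 + s * phi x) * expR (s * sg + n%:R * (A * s ^+ 2))].
Proof.
have B0 := corrector_bound_ge0; have hC1 := hC; have ht1 := hth1; have hK0' := hK0.
have hth0' := hth0.
have KB : K <= B.
  by rewrite /B ler_pdivlMr; [nra | lra].
have BE : B * (1 - th) = 2 * C * K by rewrite /B divfK// gt_eqF//; lra.
move=> ht; elim: n => [|n [phi [sg [hphi Nphi phiB ih]]]].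
  exists (fun=> 0), 0; split => [||x|s x sB].
  - exact: bmf_cst.
  - rewrite (le_trans (csn_le hN (c := 0) (D := 0) (bmf_cst 0) _)) ?mulr0//.
    by move=> x; rewrite subrr normr0.
  - by rewrite normr0.
  - by rewrite /laplaceZ /= !mulr0 mul0r !addr0 expR0 !mulr1.
set h := laplaceZ Q g t n; set w := fun y => expR (t * g y).
have ch : cone N (cone_aperture C th) h by exact: (laplaceZ_cone hQ hg hN).
have hw : bmf w by apply: bmf_expR; exact: bmfZ.
have hd y : `|w y - 1| <= weight_radius C th.
  exact: (small_tilt_weight hC hth0 hth1 hK).
have k0 := cone_aperture_gt0 hC hth1.
have k8 := cone_aperture_le1 hC hth0 hth1.
have kd := weight_radius_le hC hth0 hth1.
have hm := tilt_markov hQ hN ch hw hd k0 k8 kd.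
have hc f := tilt_contr hQ hN ch hw hd k0 k8 kd (f := f).
have hgp : bmf (fun y => g y + phi y) by exact: bmfD.
set q := tilt Q w h (fun y => g y + phi y); set c := q point.
have hq : bmf q by exact: mop_bmf.
have Nq : N q <= B.
  apply: (le_trans (hc _ hgp)).
  have kC := cone_aperture_le th hC.
  have -> : th + 4 * cone_aperture C th * C = (1 + th) / 2 by lra.
  apply: (@le_trans _ _ ((1 + th) / 2 * (C * K + B))).
    apply: ler_wpM2l; first by lra.
    apply: (le_trans (csnD hN hg hphi)); rewrite lerD//.
    by apply: (csn_le hN (c := 0)) => // x; rewrite subr0.
  have -> : C * K = B * (1 - th) / 2 by lra.
  have := mulr_ge0 B0 (sqr_ge0 (1 - th)); lra.
have cB : `|c| <= K + B.
  by apply: (mop_bound hm) => // y; rewrite (le_trans (ler_normD _ _))// lerD.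
(* Centring at [point] makes the new corrector bounded by its seminorm; the removed constant is
   accumulated in the first-order coefficient. *)
exists (fun y => q y - c), (sg + c).
have phiB' x : `|q x - c| <= B.
  rewrite ler_norml lerNl opprB; apply/andP; split.
    by apply: le_trans Nq; exact: (csn_osc hN).
  by apply: le_trans Nq; exact: (csn_osc hN).
split => //.
- by apply: bmfB => //; exact: bmf_cst.
- by apply: le_trans Nq; exact: (csn_addC hN).
move=> s x sB.
have sK : `|s| * K <= 1 / 2 by apply: le_trans sB; exact: ler_wpM2l.
set e := expR (s * sg + n%:R * (A * s ^+ 2)).
have hh : bmf h by exact: laplaceZ_bmf.
have hs : bmf (fun y => 1 + s * phi y) by apply: bmfD; [exact: bmf_cst | exact: bmfZ].
pose v y := expR (s * g y) * (1 + s * phi y).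
have hv : bmf v by apply: bmfM => //; apply: bmf_expR; exact: bmfZ.
have den0 : 0 < laplaceZ Q g t n.+1 x.
  exact: (laplaceZ_gt0 hQ hg hN hC hth0 hth1 hK).
have step1 : laplaceZ Q g (t + s) n.+1 x <= e * Q (fun y => w y * h y * v y) x.
  rewrite -mopZ//; last by apply: bmfM => //; exact: bmfM.
  rewrite /laplaceZ iterS /laplace; apply: (mop_le hQ).
  - by apply: bmfM; [apply: bmf_expR; exact: bmfZ | exact: laplaceZ_bmf].
  - by apply: bmfZ; apply: bmfM => //; exact: bmfM.
  move=> y; have := ih s y sB; rewrite -/e -/h => hy.
  rewrite mulrDl expRD /v -/(w y).
  have -> : e * (w y * h y * (expR (s * g y) * (1 + s * phi y))) =
    w y * expR (s * g y) * (h y * (1 + s * phi y) * e) by ring.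
  by rewrite ler_wpM2l// mulr_ge0// expR_ge0.
(* The denominator of the tilt by h = Z_n is Z_(n+1), so dividing by it compares the two perturbed
   iterates at consecutive times. *)
have tiltv : Q (fun y => w y * h y * v y) x = laplaceZ Q g t n.+1 x * tilt Q w h v x.
  by rewrite /tilt mulrC mulfVK// gt_eqF.
apply: (le_trans step1); rewrite tiltv.
have vle : tilt Q w h v x <= 1 + s * q x + s ^+ 2 * (K * B + 3 * K ^+ 2).
  set c0 := s ^+ 2 * _.
  have : tilt Q w h v x <= tilt Q w h (fun y => (1 + c0) + s * (g y + phi y)) x.
    apply: (mop_le hm) => //.
      by apply: bmfD; [exact: bmf_cst | exact: bmfZ].
    move=> y; have := exp_affine_le (hK y) (phiB y) sB sK.
    by rewrite /v /c0; lra.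
  rewrite (mopD hm) ?(mopZ hm) ?(mop_cst hm)//; [|exact: bmf_cst|exact: bmfZ].
  by rewrite -/q; lra.
have A0 : 0 <= A.
  have := sqr_ge0 K; have := mulr_ge0 hK0' B0; have := mulr_ge0 B0 B0.
  by rewrite /A; lra.
(* Factoring out e^(s c + A s^2) creates the cross term s^2 (q - c) c, which is absorbed by the term
   A s^2. *)
have fin : tilt Q w h v x <= (1 + s * (q x - c)) * expR (s * c + A * s ^+ 2).
  apply: (le_trans vle).
  have sphi : `|s * (q x - c)| <= 1 / 2.
    by rewrite normrM (le_trans _ sB)// ler_wpM2l.
  move: (sphi); rewrite ler_norml => /andP[s1 s2].
  have pc : - (B * (K + B)) <= (q x - c) * c.
    by rewrite lerNl -mulNr (le_trans (ler_norm _))// normrM normrN ler_pM.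
  have e0 : 1 + (s * c + A * s ^+ 2) <= expR (s * c + A * s ^+ 2) by exact: expR_ge1Dx.
  have e1 : 0 <= 1 + s * (q x - c) by lra.
  apply: le_trans (ler_wpM2l e1 e0).
  have s20 : 0 <= s ^+ 2 by exact: sqr_ge0.
  have e2 : s ^+ 2 * - (B * (K + B)) <= s ^+ 2 * ((q x - c) * c) by exact: ler_wpM2l.
  have As : 0 <= A * s ^+ 2 by exact: mulr_ge0.
  have e3 : A * s ^+ 2 * (1 / 2) <= A * s ^+ 2 * (1 + s * (q x - c)).
    by apply: ler_wpM2l => //; lra.
  have -> : (1 + s * (q x - c)) * (1 + (s * c + A * s ^+ 2)) =
    1 + s * q x + s ^+ 2 * ((q x - c) * c) + A * s ^+ 2 * (1 + s * (q x - c)) by ring.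
  apply: (@le_trans _ _ (1 + s * q x + s ^+ 2 * - (B * (K + B)) + A * s ^+ 2 * (1 / 2))).
    by rewrite /A; lra.
  lra.
rewrite -[n.+1%:R]natr1.
have -> : s * (sg + c) + (n%:R + 1) * (A * s ^+ 2) =
  (s * sg + n%:R * (A * s ^+ 2)) + (s * c + A * s ^+ 2) by ring.
rewrite expRD -/e.
have -> : laplaceZ Q g t n.+1 x * (1 + s * (q x - c)) * (e * expR (s * c + A * s ^+ 2)) =
  e * (laplaceZ Q g t n.+1 x * ((1 + s * (q x - c)) * expR (s * c + A * s ^+ 2))) by ring.
by rewrite ler_wpM2l ?expR_ge0// ler_wpM2l// ltW.
Qed.

(** The estimates of [laplaceZ_perturb] at s and -s are multiplied: the coefficients of s cancel in
    the exponent, and (1 + s phi)(1 - s phi) <= 1. The four passages between Z_n and the pressure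
    cost 4 each, hence 16 times 16. *)
Lemma pressure_second_difference t s : small_tilt C th K t ->
  small_tilt C th K (t + s) -> small_tilt C th K (t - s) -> `|s| * B <= 1 / 2 ->
  pressure Q g (t + s) + pressure Q g (t - s) - 2 * pressure Q g t <= 2 * (A * s ^+ 2).
Proof.
move=> ht h1 h2 sB; rewrite -subr_le0; apply: (@exp_growth_le0 R _ (16 * 16)) => n.
have [phi [sg [hphi _ phiB hn]]] := laplaceZ_perturb n ht.
have p1 := hn s point sB; have p2 := hn (- s) point; rewrite normrN sqrrN in p2.
have {}p2 := p2 sB.
have [q1 _] := pressure_bounds hQ hg hN hC hth0 hth1 hK n point h1.
have [q2 _] := pressure_bounds hQ hg hN hC hth0 hth1 hK n point h2.
have [_ q3] := pressure_bounds hQ hg hN hC hth0 hth1 hK n point ht.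
have z0 := laplaceZ_gt0 hQ hg hN hC hth0 hth1 hK n point ht.
have z10 := laplaceZ_gt0 hQ hg hN hC hth0 hth1 hK n point h1.
have z20 := laplaceZ_gt0 hQ hg hN hC hth0 hth1 hK n point h2.
set z := laplaceZ Q g t n point in p1 p2 q3 z0.
set z1 := laplaceZ Q g (t + s) n point in p1 q1 z10.
set z2 := laplaceZ Q g (t - s) n point in p2 q2 z20.
set l1 := pressure Q g (t + s) in q1 *; set l2 := pressure Q g (t - s) in q2 *.
set l := pressure Q g t in q3 *.
have [A' hA] : exists A', A = A' by exists A.
rewrite hA in p1 p2 *; set a := n%:R * (A' * s ^+ 2) in p1 p2.
clearbody z z1 z2 l1 l2 l.
have hp : `|s * phi point| <= 1 / 2 by rewrite normrM (le_trans _ sB)// ler_wpM2l.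
move: (hp); rewrite ler_norml => /andP[hp1 hp2].
have -> : n%:R * (l1 + l2 - 2 * l - 2 * (A' * s ^+ 2)) =
  n%:R * l1 + n%:R * l2 - (n%:R * l + n%:R * l + (a + a)).
  by rewrite /a; ring.
rewrite expRD expRN ler_pdivrMr ?expR_gt0// !expRD.
have E1 := expR_gt0 (n%:R * l1); have E2 := expR_gt0 (n%:R * l2).
apply: (le_trans (ler_pM (ltW E1) (ltW E2) q1 q2)).
have := ler_pM (ltW z10) (ltW z20) p1 p2.
have -> : z * (1 + s * phi point) * expR (s * sg + a) *
    (z * (1 + - s * phi point) * expR (- s * sg + a)) =
   (1 - (s * phi point) ^+ 2) * (z * z * (expR (s * sg + a) * expR (- s * sg + a))).
  by ring.
rewrite -expRD mulNr (_ : s * sg + a + (- (s * sg) + a) = a + a); last by ring.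
rewrite expRD => h3.
have h4 : (1 - (s * phi point) ^+ 2) * (z * z * (expR a * expR a)) <= z * z * (expR a * expR a).
  rewrite -[leRHS]mul1r ler_wpM2r ?mulr_ge0 ?expR_ge0 ?(ltW z0)//.
  by rewrite lerBlDr lerDl sqr_ge0.
have h5 : z * z <= 4 * expR (n%:R * l) * (4 * expR (n%:R * l)).
  by apply: ler_pM => //; exact: ltW.
have h6 := ler_wpM2r (mulr_ge0 (expR_ge0 a) (expR_ge0 a)) h5.
by lra.
Qed.

End second_difference.

(** * Second-order expansion at zero *)

Section poisson.
Context {d} {T : measurableType d} {R : realType}.
Variables (Q : (T -> R) -> T -> R) (hQ : markov_op Q).
Variables (N : (T -> R) -> R) (C th : R).
Hypothesis hN : contraction_seminorm Q N C th.
Hypotheses (hth0 : 0 <= th) (hth1 : th < 1).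
Variables (Pi : (T -> R) -> R) (hPi : markov_op (fun f (_ : T) => Pi f)).
Hypothesis hPiQ : forall f, bmf f -> Pi (Q f) = Pi f.
Implicit Types f : T -> R.

Lemma mop_iter_bmf k f : bmf f -> bmf (iter k Q f).
Proof. by move=> hf; elim: k => //= k; exact: mop_bmf. Qed.

Lemma mop_iterB k f c x : bmf f -> iter k Q (fun y => f y - c) x = iter k Q f x - c.
Proof.
move=> hf; elim: k x => //= k ih x.
rewrite (_ : iter k Q _ = fun y => iter k Q f y - c); last exact/funext.
by rewrite mopB ?(mop_cst hQ)//; [exact: mop_iter_bmf | exact: bmf_cst].
Qed.

Lemma invariant_iter k f : bmf f -> Pi (iter k Q f) = Pi f.
Proof.
by move=> hf; elim: k => //= k <-; apply: hPiQ; exact: mop_iter_bmf.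
Qed.

Lemma invariant_dist f x : bmf f -> `|f x - Pi f| <= N f.
Proof.
move=> hf; rewrite ler_norml; apply/andP; split.
- suff : Pi f <= f x + N f by lra.
  by apply: (mop_leC hPi point hf) => y; have := csn_osc hN y x hf; lra.
- suff : f x - N f <= Pi f by lra.
  by apply: (mop_geC hPi point hf) => y; have := csn_osc hN x y hf; lra.
Qed.

Lemma csn_iter k f : bmf f -> N (iter k Q f) <= th ^+ k * N f.
Proof.
move=> hf; elim: k => [|k ih] /=; first by rewrite mul1r.
apply: (le_trans (csn_contr hN (mop_iter_bmf k hf))).
by rewrite exprS -mulrA ler_wpM2l.
Qed.

Lemma mop_iter_conv k f x : bmf f -> `|iter k Q f x - Pi f| <= th ^+ k * N f.
Proof.
move=> hf; rewrite -(invariant_iter k hf).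
by apply: le_trans (csn_iter k hf); exact/invariant_dist/mop_iter_bmf.
Qed.

(** A truncated solution of the Poisson equation. The sum starts at Q f rather than f, so that Q (f
    + [poisson]) equals Pi f + [poisson] up to a single tail term. *)
Definition poisson n f x : R := \sum_(0 <= k < n) (iter k.+1 Q f x - Pi f).

Lemma poisson_bmf n f : bmf f -> bmf (poisson n f).
Proof.
move=> hf; apply: (bmf_sum n (F := fun k x => iter k.+1 Q f x - Pi f)) => k.
by apply: bmfB; [exact: mop_iter_bmf | exact: bmf_cst].
Qed.

Lemma poisson_op n f x : bmf f ->
  Q (poisson n f) x = poisson n f x - (Q f x - Pi f) + (iter n.+1 Q f x - Pi f).
Proof.
move=> hf; elim: n => [|n ih].
  rewrite (_ : poisson 0 f = fun=> 0); last by apply/funext => y; rewrite /poisson big_nil.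
  by rewrite (mop_cst hQ) sub0r addNr.
have e : poisson n.+1 f = fun y => poisson n f y + (iter n.+1 Q f y - Pi f).
  by apply/funext => y; rewrite /poisson big_nat_recr.
have h1 : bmf (iter n.+1 Q f) by exact: mop_iter_bmf.
have h2 : bmf (fun y => iter n.+1 Q f y - Pi f).
  by apply: bmfB => //; exact: bmf_cst.
rewrite e mopD//; last exact: poisson_bmf.
rewrite ih mopB// ?(mop_cst hQ)//; last exact: bmf_cst.
have -> : iter n.+2 Q f x = Q (iter n.+1 Q f) x by [].
lra.
Qed.

Lemma poisson_approx n f x : bmf f ->
  `|Q (fun y => f y + poisson n f y) x - Pi f - poisson n f x| <= th ^+ n * N f.
Proof.
move=> hf; rewrite mopD//; last exact: poisson_bmf.
rewrite poisson_op// (_ : _ - _ = iter n.+1 Q f x - Pi f); last by ring.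
apply: (le_trans (mop_iter_conv n.+1 x hf)); rewrite exprS -mulrA.
have : 0 <= N f by have := csn_osc hN point point hf; rewrite subrr.
move=> Nf; rewrite ler_piMl//; last by have h := hth1; lra.
by rewrite mulr_ge0// exprn_ge0.
Qed.

Lemma poisson_bound n f x : bmf f -> `|poisson n f x| <= N f / (1 - th).
Proof.
move=> hf; have h1 := hth1; have h0 := hth0.
have Nf : 0 <= N f by have := csn_osc hN point point hf; rewrite subrr.
suff : `|poisson n f x| <= N f * (1 - th ^+ n) / (1 - th).
  move=> /le_trans; apply; rewrite ler_pM2r ?invr_gt0; last by lra.
  by rewrite ler_piMr// gerBl exprn_ge0.
elim: n => [|n ih]; first by rewrite /poisson big_nil normr0 subrr mulr0 mul0r.
rewrite /poisson big_nat_recr//= (le_trans (ler_normD _ _))//.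
have := mop_iter_conv n.+1 x hf => /= h.
apply: (le_trans (lerD ih h)); rewrite ler_pdivlMr; last by lra.
rewrite mulrDl divfK; last by rewrite gt_eqF//; lra.
rewrite exprS.
have p0 : 0 <= th ^+ n by exact: exprn_ge0.
have := mulr_ge0 (mulr_ge0 Nf p0) (sqr_ge0 (1 - th)).
lra.
Qed.

End poisson.

Section expansion_real.
Context {R : realType}.

Lemma exp_expand (t p f q G : R) : 1 <= G -> `|p| <= G -> `|f| <= G -> `|q| <= G ->
  `|t| * G <= 1 / 4 ->
  `|expR (t * p) * (1 + t * f + t ^+ 2 * q)
    - (1 + t * (p + f) + t ^+ 2 * (p ^+ 2 / 2 + p * f + q))| <= 9 * G ^+ 3 * `|t| ^+ 3.
Proof.
move=> G1 hp hf hq tG; set a := `|t| in tG *.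
have a0 : 0 <= a by exact: normr_ge0.
have a1 : a <= 1 / 4 by nra.
have tp : `|t * p| <= a * G by rewrite normrM ler_wpM2l.
have tf : `|t * f| <= a * G by rewrite normrM ler_wpM2l.
have tq : `|t ^+ 2 * q| <= a * G.
  rewrite normrM normrX -/a; apply: ler_pM => //; first by rewrite sqr_ge0.
  by rewrite expr2; nra.
have e : `|expR (t * p) - (1 + t * p + (t * p) ^+ 2 / 2)| <= 2 * (a * G) ^+ 3.
  apply: (le_trans (expR_cubic _)); first by lra.
  by rewrite ler_pM2l// lerXn2r// nnegrE ?mulr_ge0//; lra.
set r := expR _ - _ in e.
have hb : `|1 + t * f + t ^+ 2 * q| <= 3 / 2.
  rewrite (le_trans (ler_normD _ _))// (le_trans (lerD (ler_normD _ _) (lexx _)))//.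
  by rewrite normr1; lra.
rewrite (_ : _ - _ = r * (1 + t * f + t ^+ 2 * q) + t ^+ 3 * (p * q + p ^+ 2 * f / 2)
  + t ^+ 3 * (t * p ^+ 2 * q / 2)); last by rewrite /r; field.
have pq : `|p * q| <= G ^+ 3.
  rewrite normrM; apply: (@le_trans _ _ (G * G)); first exact: ler_pM.
  by rewrite exprS ler_pM2l ?expr2; nra.
have p2 : `|p| ^+ 2 <= G ^+ 2 by rewrite lerXn2r// nnegrE; lra.
have p2f : `|p ^+ 2 * f / 2| <= G ^+ 3.
  rewrite normrM [`|p ^+ 2 * f|]normrM normrX [X in _ * X]ger0_norm ?invr_ge0//.
  have := ler_pM (sqr_ge0 _) (normr_ge0 f) p2 hf; rewrite -exprSr => h.
  have : 0 <= `|p| ^+ 2 * `|f| by rewrite mulr_ge0// sqr_ge0.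
  lra.
have p2q : `|t * p ^+ 2 * q / 2| <= G ^+ 3.
  rewrite normrM [`|t * _ * q|]normrM [`|t * _|]normrM normrX.
  rewrite [X in _ * X]ger0_norm ?invr_ge0// -/a.
  have := ler_pM (sqr_ge0 _) (normr_ge0 q) p2 hq; rewrite -exprSr => h.
  have h0 : 0 <= `|p| ^+ 2 * `|q| by rewrite mulr_ge0// sqr_ge0.
  have : a * (`|p| ^+ 2 * `|q|) <= 1 / 4 * (`|p| ^+ 2 * `|q|) by rewrite ler_wpM2r.
  lra.
have t3 : `|t ^+ 3| = a ^+ 3 by rewrite normrX.
have a3 : 0 <= a ^+ 3 by exact: exprn_ge0.
rewrite (le_trans (ler_normD _ _))//.
apply: (@le_trans _ _ (2 * (a * G) ^+ 3 * (3 / 2) + a ^+ 3 * (G ^+ 3 + G ^+ 3) + a ^+ 3 * G ^+ 3)).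
  apply: lerD.
    apply: (le_trans (ler_normD _ _)); apply: lerD.
      by rewrite normrM ler_pM.
    rewrite normrM t3 ler_wpM2l//.
    by rewrite (le_trans (ler_normD _ _))// lerD.
  by rewrite normrM t3 ler_wpM2l.
rewrite exprMn.
have : 0 <= a ^+ 3 * G ^+ 3 by rewrite mulr_ge0// exprn_ge0//; lra.
lra.
Qed.

(* Turns an additive approximate eigenvalue equation into multiplicative bounds. *)
Lemma approx_eigen (t h m l G e dl : R) : 1 <= G -> `|l| <= G -> 0 <= e ->
  `|h - 1| <= 2 * (`|t| * G) -> `|m - (h + l * t ^+ 2)| <= e ->
  `|t| * G <= 1 / 32 -> e <= 1 / 8 ->
  12 * (G ^+ 2 * `|t| ^+ 3) + 8 * e <= dl ->
  m <= h * expR (l * t ^+ 2 + dl) /\ h * expR (l * t ^+ 2 - dl) <= m.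
Proof.
move=> G1 hl e0 hh hm tG e8 hdl; set a := `|t| in hh tG hdl.
have a0 : 0 <= a by exact: normr_ge0.
have a1 : a <= 1 / 32 by nra.
have t2 : t ^+ 2 = a ^+ 2 by rewrite /a real_normK ?num_real.
have tl : `|l * t ^+ 2| <= a * G.
  rewrite normrM mulrC ger0_norm ?sqr_ge0// t2; apply: ler_pM => //; first exact: sqr_ge0.
  by rewrite expr2; nra.
have Ga3 : 0 <= G ^+ 2 * a ^+ 3 by rewrite mulr_ge0// exprn_ge0//; lra.
have hl3 : `|(h - 1) * (l * t ^+ 2)| <= 2 * (G ^+ 2 * a ^+ 3).
  rewrite normrM; apply: (@le_trans _ _ (2 * (a * G) * (G * a ^+ 2))).
    apply: ler_pM => //; rewrite normrM [`|t ^+ 2|]ger0_norm ?sqr_ge0// t2.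
    by rewrite ler_wpM2r ?sqr_ge0.
  by rewrite [leRHS](_ : _ = 2 * (a * G) * (G * a ^+ 2)) //; ring.
have l2 : (l * t ^+ 2) ^+ 2 <= G ^+ 2 * a ^+ 3.
  rewrite exprMn t2 -exprM mulnS [a ^+ (2 + 2)]exprSr.
  have : l ^+ 2 <= G ^+ 2 by rewrite -real_normK ?num_real// lerXn2r// nnegrE; lra.
  have : a ^+ 3 * a <= a ^+ 3 by rewrite ler_piMr ?exprn_ge0//; lra.
  by move=> h1 h2; apply: ler_pM => //; rewrite ?sqr_ge0// mulr_ge0// exprn_ge0.
move: hh hm tl hl3; set y := l * t ^+ 2 in l2 *.
rewrite !ler_norml => /andP[h1 h2] /andP[m1 m2] /andP[y1 y2] /andP[d1 d2].
have h0 : 1 / 2 <= h by lra.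
have dl0 : 0 <= dl by lra.
split.
- apply: (le_trans _ (ler_wpM2l _ (expR_ge1Dx _))); last by lra.
  have : 1 / 2 * dl <= h * dl by rewrite ler_wpM2r.
  lra.
(* For the lower bound the exponential is estimated by 1 / (1 - (y - dl)), which leaves a polynomial
   inequality after clearing the denominator. *)
have yd : y - dl < 1 by lra.
apply: (le_trans (ler_wpM2l _ (expR_le_inv yd))); first by lra.
rewrite ler_pdivrMr; last by lra.
have m4 : 1 / 4 <= m by lra.
have : 1 / 4 * dl <= m * dl by rewrite ler_wpM2r.
have mr : `|m - (h + y)| <= e by rewrite ler_norml; apply/andP; split.
have : `|(m - (h + y)) * y| <= e.
  rewrite normrM; apply: (@le_trans _ _ (e * 1)); last by rewrite mulr1.
  by apply: ler_pM => //; rewrite ler_norml; apply/andP; split; lra.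
rewrite ler_norml => /andP[q1 q2].
rewrite (_ : m * (1 - (y - dl)) = m - (m - (h + y)) * y - (h - 1) * y - y - y ^+ 2 + m * dl); last by ring.
lra.
Qed.

End expansion_real.

Section expansion.
Context {d} {T : measurableType d} {R : realType}.
Variables (Q : (T -> R) -> T -> R) (hQ : markov_op Q) (g : T -> R).
Hypothesis hg : bmf g.
Variables (N : (T -> R) -> R) (C th K : R).
Hypothesis hN : contraction_seminorm Q N C th.
Hypotheses (hC : 1 <= C) (hth0 : 0 <= th) (hth1 : th < 1).
Hypotheses (hK0 : 0 <= K) (hK : forall x, `|g x| <= K).
Variables (Pi : (T -> R) -> R) (hPi : markov_op (fun f (_ : T) => Pi f)).
Hypothesis hPiQ : forall f, bmf f -> Pi (Q f) = Pi f.

(* Half the truncated Green-Kubo sum of the autocovariances of [g]. *)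
Definition half_variance n : R :=
  Pi (fun x => (g x - Pi g) ^+ 2 / 2 + (g x - Pi g) * poisson Q Pi n g x).

(** A common bound for the centred g, its corrector, the second-order source term F, the corrector
    of F, and the seminorms of g and F. The summand 1 allows lower powers of G to be replaced by
    G^3. *)
Definition expansion_scale : R :=
  let B := C * K / (1 - th) in
  let D := 2 * K ^+ 2 + 2 * K * B in
  1 + 2 * K + C * K + B + D + C * D + C * D / (1 - th).

Local Notation G := expansion_scale.

Lemma expansion_scale_ge1 : 1 <= G.
Proof.
have h1 := hC; have h2 := hth1; have h3 := hK0.
rewrite /G /=; set B := C * K / (1 - th).
have B0 : 0 <= B by rewrite divr_ge0 ?mulr_ge0//; lra.
have KB := mulr_ge0 h3 B0; have K2 := sqr_ge0 K.
set D := 2 * K ^+ 2 + 2 * K * B.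
have D0 : 0 <= D by rewrite /D; lra.
have CD : 0 <= C * D by rewrite mulr_ge0//; lra.
have CK : 0 <= C * K by rewrite mulr_ge0//; lra.
have CDt : 0 <= C * D / (1 - th) by rewrite divr_ge0//; lra.
lra.
Qed.

(** The trial function is h = 1 + t f + t^2 q, with f the corrector of g and q the corrector of the
    second-order term F = p^2 / 2 + p f, where p is the centred g. It is an approximate
    eigenfunction with eigenvalue exp(t Pi g + t^2 Pi F), and the Collatz-Wielandt bounds conclude.
    The term in th^n is the cost of truncating the correctors. *)
Lemma pressure_expansion t n : small_tilt C th K t -> `|t| * (32 * (32 * G ^+ 3)) <= 1 ->
  `|pressure Q g t - (Pi g * t + half_variance n * t ^+ 2)|
    <= 84 * G ^+ 3 * (`|t| ^+ 3 + `|t| * th ^+ n).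
Proof.
move=> ht tsmall.
have C1 := hC; have t1 := hth1; have K0 := hK0; have t0 := hth0.
have G1 := expansion_scale_ge1.
set B := C * K / (1 - th).
set D := 2 * K ^+ 2 + 2 * K * B.
have B0 : 0 <= B by rewrite divr_ge0 ?mulr_ge0//; lra.
have KB := mulr_ge0 K0 B0; have K2 := sqr_ge0 K.
have D0 : 0 <= D by rewrite /D; lra.
have CD : 0 <= C * D by rewrite mulr_ge0//; lra.
have CK : 0 <= C * K by rewrite mulr_ge0//; lra.
have CDt : 0 <= C * D / (1 - th) by rewrite divr_ge0//; lra.
have GE : G = 1 + 2 * K + C * K + B + D + C * D + C * D / (1 - th) by [].
set b := Pi g; set p := fun x => g x - b; set f := poisson Q Pi n g.
set F := fun x => p x ^+ 2 / 2 + p x * f x; set q := poisson Q Pi n F.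
have hp : bmf p by apply: bmfB => //; exact: bmf_cst.
have hf : bmf f by exact: poisson_bmf.
have hp2 : bmf (fun x => p x ^+ 2 / 2).
  by apply: bmfM; [exact: bmfM | exact: bmf_cst].
have hF : bmf F by apply: bmfD => //; exact: bmfM.
have hq : bmf q by exact: poisson_bmf.
have Ng : N g <= C * K by apply: (csn_le hN (c := 0)) => // x; rewrite subr0.
have bK : `|b| <= K by exact: (mop_bound hPi point hg).
have pK x : `|p x| <= 2 * K.
  by rewrite /p (le_trans (ler_normB _ _))//; have := hK x; lra.
have fB x : `|f x| <= B.
  apply: (le_trans (poisson_bound hQ hN hth0 hth1 hPi hPiQ n x hg)).
  by rewrite ler_pM2r// invr_gt0; lra.
have FD x : `|F x| <= D.
  rewrite /F (le_trans (ler_normD _ _))// normrM normrX [X in _ * X]ger0_norm ?invr_ge0//.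
  rewrite normrM /D; apply: lerD; last exact: ler_pM.
  have : `|p x| ^+ 2 <= (2 * K) ^+ 2 by rewrite lerXn2r// nnegrE; lra.
  rewrite exprMn; lra.
have NF : N F <= C * D by apply: (csn_le hN (c := 0)) => // x; rewrite subr0.
have qD x : `|q x| <= C * D / (1 - th).
  apply: (le_trans (poisson_bound hQ hN hth0 hth1 hPi hPiQ n x hF)).
  by rewrite ler_pM2r// invr_gt0; lra.
have PiF : `|half_variance n| <= D by exact: (mop_bound hPi point hF).
have pG x : `|p x| <= G by rewrite (le_trans (pK x))// GE; lra.
have fG x : `|f x| <= G by rewrite (le_trans (fB x))// GE; lra.
have qG x : `|q x| <= G by rewrite (le_trans (qD x))// GE; lra.
have lG : `|half_variance n| <= G by rewrite (le_trans PiF)// GE; lra.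
have NgG : N g <= G by rewrite (le_trans Ng)// GE; lra.
have NFG : N F <= G by rewrite (le_trans NF)// GE; lra.
clear CD CK CDt KB K2 D0 GE pK fB FD Ng NF qD PiF bK D B0 B.
set l := half_variance n in lG *.
set h := fun x => 1 + t * f x + t ^+ 2 * q x.
set G' := G in G1 pG fG qG lG NgG NFG tsmall *.
have hh : bmf h by apply: bmfD; [apply: bmfD; [exact: bmf_cst | exact: bmfZ] | exact: bmfZ].
set a := `|t| in tsmall *.
have a0 : 0 <= a by exact: normr_ge0.
have G3 : G' <= G' ^+ 3.
  rewrite exprS ler_peMr//; first by lra.
  by rewrite expr2; nra.
have aG : a * G' <= 1 / 1024.
  by have : a * G' <= a * G' ^+ 3 by [rewrite ler_wpM2l|]; lra.
have a1 : a <= 1 / 1024.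
  by have : a * 1 <= a * G' by [rewrite ler_wpM2l|]; lra.
have thn0 : 0 <= th ^+ n by exact: exprn_ge0.
have thn1 : th ^+ n <= 1 by rewrite exprn_ile1//; lra.
pose e : R := 2 * G' * (a * th ^+ n) + 9 * G' ^+ 3 * a ^+ 3.
have a3 : a ^+ 3 <= a by rewrite exprSr ler_piMl// exprn_ile1//; lra.
have a30 : 0 <= a ^+ 3 by exact: exprn_ge0.
have G0 : 0 <= G' by exact: le_trans G1.
have e0 : 0 <= e.
  apply: addr_ge0; apply: mulr_ge0 => //; apply: mulr_ge0 => //.
  exact: exprn_ge0.
have ee : e <= 1 / 8.
  have : G' ^+ 3 * a ^+ 3 <= G' ^+ 3 * a by rewrite ler_wpM2l// exprn_ge0//; lra.
  have : G' * (a * th ^+ n) <= G' * (a * 1).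
    by apply: ler_wpM2l => //; apply: ler_wpM2l.
  by rewrite /e; lra.
have M0 x : laplace Q g t h x = expR (b * t) * Q (fun y => expR (t * p y) * h y) x.
  rewrite -mopZ//; last by apply: bmfM => //; apply: bmf_expR; exact: bmfZ.
  congr (Q _ x); apply/funext => y; rewrite mulrA -expRD; congr (expR _ * _).
  by rewrite /p; ring.
(* Order by order: Q (p + f) is close to f, and Q (F + q) is close to l + q. *)
have main x : `|Q (fun y => expR (t * p y) * h y) x - (h x + l * t ^+ 2)| <= e.
  pose v y := 1 + t * (p y + f y) + t ^+ 2 * (F y + q y).
  have hv : bmf v.
    apply: bmfD; first (apply: bmfD; [exact: bmf_cst |]); apply: bmfZ; exact: bmfD.
  have hE : bmf (fun y => expR (t * p y) * h y).
    by apply: bmfM => //; apply: bmf_expR; exact: bmfZ.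
  have d1 : `|Q (fun y => expR (t * p y) * h y) x - Q v x| <= 9 * G' ^+ 3 * a ^+ 3.
    apply: mop_dist => // y; rewrite /v /h /F.
    apply: exp_expand => //; rewrite -/a; lra.
  have Qv : Q v x = 1 + t * Q (fun y => p y + f y) x + t ^+ 2 * Q (fun y => F y + q y) x.
    have b1 : bmf (fun y => p y + f y) by exact: bmfD.
    have b2 : bmf (fun y => F y + q y) by exact: bmfD.
    have b3 : bmf (fun y => t * (p y + f y)) by exact: bmfZ.
    have b4 : bmf (fun y => t ^+ 2 * (F y + q y)) by exact: bmfZ.
    have b5 : bmf (fun y => 1 + t * (p y + f y)) by apply: bmfD => //; exact: bmf_cst.
    rewrite /v (mopD hQ x b5 b4) (mopD hQ x (bmf_cst 1) b3).
    by rewrite (mop_cst hQ) !mopZ.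
  have P1 := poisson_approx hQ hN hth0 hth1 hPi hPiQ n x hg.
  have P2 := poisson_approx hQ hN hth0 hth1 hPi hPiQ n x hF.
  rewrite -/f -/b in P1; rewrite -/q in P2.
  have Pp : Q (fun y => p y + f y) x = Q (fun y => g y + f y) x - b.
    rewrite (_ : (fun y => _) = fun y => (g y + f y) - b); last first.
      by apply/funext => y; rewrite /p; ring.
    by rewrite mopB ?(mop_cst hQ)//; [exact: bmfD | exact: bmf_cst].
  rewrite -Pp in P1.
  have d2 : `|Q v x - (h x + l * t ^+ 2)| <= 2 * G' * (a * th ^+ n).
    rewrite Qv (_ : _ - _ = t * (Q (fun y => p y + f y) x - f x) +
      t ^+ 2 * (Q (fun y => F y + q y) x - l - q x)); last by rewrite /h; ring.
    rewrite (le_trans (ler_normD _ _))// normrM [`|t ^+ 2 * _|]normrM normrX -/a.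
    have thG : th ^+ n * N g <= th ^+ n * G' by rewrite ler_wpM2l.
    have thF : th ^+ n * N F <= th ^+ n * G' by rewrite ler_wpM2l.
    have s1 := ler_wpM2l a0 (le_trans P1 thG).
    have aa : a ^+ 2 <= a by rewrite expr2 ler_piMl//; lra.
    by have s2 := ler_pM (sqr_ge0 a) (normr_ge0 _) aa (le_trans P2 thF); lra.
  have := ler_normD (Q (fun y => expR (t * p y) * h y) x - Q v x) (Q v x - (h x + l * t ^+ 2)).
  rewrite addrA subrK /e; lra.
have h1 x : `|h x - 1| <= 2 * (a * G').
  rewrite (_ : h x - 1 = t * f x + t ^+ 2 * q x); last by rewrite /h; ring.
  rewrite (le_trans (ler_normD _ _))// normrM [`|t ^+ 2 * _|]normrM normrX -/a.
  have s1 := ler_wpM2l a0 (fG x).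
  have aa : a ^+ 2 <= a by rewrite expr2 ler_piMl//; lra.
  have s2 := ler_pM (sqr_ge0 a) (normr_ge0 _) aa (qG x).
  lra.
(* 84 = 12 + 8 times 9, from the hypothesis of [approx_eigen] and the cubic part of e. *)
set dl := 84 * G' ^+ 3 * (a ^+ 3 + a * th ^+ n).
have G23 : G' ^+ 2 <= G' ^+ 3.
  by rewrite (exprS _ 2) ler_peMl// sqr_ge0.
have hdl : 12 * (G' ^+ 2 * a ^+ 3) + 8 * e <= dl.
  have s1 : G' ^+ 2 * a ^+ 3 <= G' ^+ 3 * a ^+ 3 by rewrite ler_wpM2r.
  have at0 : 0 <= a * th ^+ n by rewrite mulr_ge0.
  have s2 : G' * (a * th ^+ n) <= G' ^+ 3 * (a * th ^+ n) by rewrite ler_wpM2r.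
  have s3 : 0 <= G' ^+ 3 * (a * th ^+ n) by rewrite mulr_ge0// exprn_ge0//; lra.
  by rewrite /dl /e; lra.
have aG' : a * G' <= 1 / 32 by lra.
have eig x := approx_eigen G1 lG e0 (h1 x) (main x) aG' ee hdl.
have h12 x : 1 / 2 <= h x by have := h1 x; rewrite ler_norml => /andP[]; lra.
rewrite ler_norml; apply/andP; split.
- rewrite lerBrDl; apply: (pressure_sup hQ hg hN hC hth0 hth1 hK (U := 2) ht hh).
  + by move=> x; have := h12 x; lra.
  + by move=> x; have := h1 x; rewrite ler_norml => /andP[]; lra.
  move=> x; rewrite M0 -addrA expRD -mulrA ler_pM2l ?expR_gt0//.
  by have [_] := eig x; rewrite mulrC.
- rewrite lerBlDr; apply: (pressure_sub hQ hg hN hC hth0 hth1 hK (l := 1 / 2) ht hh) => //.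
  move=> x; rewrite M0 addrC -addrA expRD -mulrA ler_pM2l ?expR_gt0//.
  by have [] := eig x; rewrite mulrC.
Qed.

End expansion.

(** * Dobrushin contraction *)

Section oscillation.
Context {T : pointedType} {R : realType}.
Implicit Types f g : T -> R.

Definition osc f : R := sup (range (fun z : T * T => f z.1 - f z.2)).

Lemma osc_le f D : (forall x y, f x - f y <= D) -> osc f <= D.
Proof.
move=> h; apply: ge_sup; first by exists (f point - f point); exists (point, point).
by move=> _ [z _ <-]; exact: h.
Qed.

Lemma osc_ge f M x y : (forall z, `|f z| <= M) -> f x - f y <= osc f.
Proof.
move=> hM; apply: ub_le_sup; last by exists (x, y).
exists (M + M) => _ [z _ <-].
have := hM z.1; have := hM z.2; rewrite !ler_norml => /andP[? ?] /andP[? ?]; lra.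
Qed.

End oscillation.

Section dobrushin.
Context {d} {T : measurableType d} {R : realType}.
Variables (Q : (T -> R) -> T -> R) (hQ : markov_op Q).
Variables (m : nat) (r : R).
Hypotheses (hm : (1 <= m)%N) (hr0 : 0 < r) (hr1 : r < 1).
Hypothesis hD : forall (f : T -> R) (D : R) x y, bmf f -> (forall z, `|f z| <= D) ->
  iter m Q f x - iter m Q f y <= r * D.

(** The m-th root of r. *)
Definition dobrushin_rate : R := expR (m%:R^-1 * ln r).

Local Notation th := dobrushin_rate.

(* The weights turn the contraction of [Q ^ m] into a contraction of [Q]. *)
Definition dobrushin_seminorm (f : T -> R) : R :=
  \sum_(0 <= i < m) th ^- i * osc (iter i Q f).

(** The factor 2 appears because staying within D of a constant, a property inherited by all Q^i f,
    gives oscillation at most 2 D. *)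
Definition dobrushin_const : R := 2 * \sum_(0 <= i < m) th ^- i.

Lemma dobrushin_rate_gt0 : 0 < th. Proof. exact: expR_gt0. Qed.

Lemma dobrushin_rateX : th ^+ m = r.
Proof.
rewrite /th -expRM_natl mulrA mulfV ?mul1r ?lnK ?posrE//.
by rewrite pnatr_eq0 -lt0n.
Qed.

Lemma dobrushin_rate_lt1 : th < 1.
Proof.
rewrite -expR0 ltr_expR pmulr_rlt0 ?invr_gt0 ?ltr0n//.
by rewrite ln_lt0// hr0.
Qed.

Let thV i : 0 <= th ^- i.
Proof. by rewrite invr_ge0 exprn_ge0// ltW// dobrushin_rate_gt0. Qed.

Lemma dobrushin_const_ge1 : 1 <= dobrushin_const.
Proof.
rewrite /dobrushin_const big_ltn// expr0 invr1.
have : 0 <= \sum_(1 <= i < m) th ^- i by apply: sumr_ge0.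
lra.
Qed.

Lemma bmf_osc_ge (f : T -> R) x y : bmf f -> f x - f y <= osc f.
Proof. by move=> [_ [M hM]]; exact: osc_ge hM. Qed.

Lemma osc_ge0 (f : T -> R) : bmf f -> 0 <= osc f.
Proof. by move=> hf; have := bmf_osc_ge point point hf; rewrite subrr. Qed.

Lemma mop_iterD i f g x : bmf f -> bmf g ->
  iter i Q (fun y => f y + g y) x = iter i Q f x + iter i Q g x.
Proof.
move=> hf hg; elim: i x => //= i ih x.
rewrite (_ : iter i Q _ = fun y => iter i Q f y + iter i Q g y); last exact/funext.
by rewrite mopD//; exact: mop_iter_bmf.
Qed.

Lemma mop_iter_dist i f (c D : R) x : bmf f -> (forall y, `|f y - c| <= D) ->
  `|iter i Q f x - c| <= D.
Proof.
move=> hf h; elim: i x => //= i ih x.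
rewrite -[c in X in `|X|](mop_cst hQ c x); apply: mop_dist => //.
  exact: mop_iter_bmf.
exact: bmf_cst.
Qed.

(** Replacing f by Q f shifts the sum by one index and pulls out [th]. The term gained at the end is
    th^-m osc (Q^m f), at most the term osc f lost at the beginning, because th^m = r. *)
Lemma dobrushin_contraction :
  contraction_seminorm Q dobrushin_seminorm dobrushin_const th.
Proof.
have h0 i f : bmf f -> 0 <= osc (iter i Q f).
  by move=> hf; apply: osc_ge0; exact: mop_iter_bmf.
split.
- move=> f x y hf; apply: (le_trans (bmf_osc_ge x y hf)).
  rewrite /dobrushin_seminorm big_ltn// expr0 invr1 mul1r lerDl.
  by apply: sumr_ge0 => i _; rewrite mulr_ge0// h0.
- move=> f g hf hg; rewrite /dobrushin_seminorm -big_split/=.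
  apply: ler_sum => i _; rewrite -mulrDr ler_wpM2l//.
  apply: osc_le => x y; rewrite !mop_iterD//.
  have := bmf_osc_ge x y (mop_iter_bmf hQ i hf).
  have := bmf_osc_ge x y (mop_iter_bmf hQ i hg); lra.
- move=> f c D hf hfc; rewrite /dobrushin_seminorm /dobrushin_const.
  rewrite (_ : 2 * _ * D = \sum_(0 <= i < m) th ^- i * (2 * D)); last first.
    by rewrite -big_distrl/=; ring.
  apply: ler_sum => i _; rewrite ler_wpM2l//.
  apply: osc_le => x y; have := mop_iter_dist i x hf hfc.
  have := mop_iter_dist i y hf hfc.
  rewrite !ler_norml => /andP[? ?] /andP[? ?]; lra.
move=> f hf; rewrite /dobrushin_seminorm.
have th0 := dobrushin_rate_gt0.
have -> : \sum_(0 <= i < m) th ^- i * osc (iter i Q (Q f)) =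
    th * \sum_(0 <= i < m) th ^- i.+1 * osc (iter i.+1 Q f).
  rewrite big_distrr/=; apply: eq_bigr => i _.
  by rewrite mulrA exprS invfM mulrA mulfV ?gt_eqF// mul1r -iterSr.
rewrite ler_pM2l//.
case: m hm hD dobrushin_rateX => // k _ hk thk.
rewrite [leRHS]big_nat_recl// big_nat_recr//= addrC lerD2r.
rewrite expr0 invr1 mul1r thk ler_pdivrMl//.
apply: osc_le => x y.
(* Centring at [point] bounds the sup norm by the oscillation, so [hD] turns into a contraction of
   oscillations. *)
have hc : bmf (fun z => f z - f point) by apply: bmfB => //; exact: bmf_cst.
have hb z : `|f z - f point| <= osc f.
  by rewrite ler_norml lerNl opprB !bmf_osc_ge.
have := hk _ _ x y hc hb; rewrite !mop_iterB//=; lra.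
Qed.

End dobrushin.

(** * Inhomogeneous products of operators *)

Lemma natr_div_unit {R : realType} k n : (k <= n)%N -> (0 < n)%N ->
  0 <= (k%:R / n%:R : R) <= 1.
Proof.
by move=> kn n0; rewrite divr_ge0//= ler_pdivrMr ?ltr0n// mul1r ler_nat.
Qed.

(** * Riemann sums of a uniformly continuous function *)

Section riemann.
Context {R : realType}.
Variable f : R -> R.
Hypothesis hf : forall e : R, 0 < e -> exists2 dl, 0 < dl & forall u v : R,
  0 <= u <= 1 -> 0 <= v <= 1 -> `|u - v| <= dl -> `|f u - f v| <= e.

Local Notation mu := (@lebesgue_measure R).

Lemma modulus_continuous : {within `[0, 1], continuous f}.
Proof.
apply/subspace_continuousP => x /= xI; apply/cvgrPdist_le => e e0.
have [dl dl0 h] := hf e0; apply/nbhs_ballP; exists dl => //= y xy yI.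
apply: h; last by rewrite /ball/= in xy; exact: ltW.
- by move: xI; rewrite in_itv.
- by move: yI; rewrite in_itv.
Qed.

Lemma modulus_integrable : mu.-integrable `[0, 1] (EFin \o f).
Proof.
by apply: continuous_compact_integrable; [exact: segment_compact | exact: modulus_continuous].
Qed.

(** Right endpoints match the parameters k/n of the array; the sum is left unnormalised because it
    appears in an exponent. *)
Lemma riemann_sum e : 0 < e -> exists2 n0 : nat, (0 < n0)%N & forall n, (n0 <= n)%N ->
  `|\sum_(0 <= i < n) f (i.+1%:R / n%:R) - n%:R * \int[mu]_(u in `[0, 1]) f u| <= n%:R * e.
Proof.
move=> e0; have [dl dl0 h] := hf e0.
have [n0 n00 hn0] := natr_ge_ex dl^-1; exists n0 => // n n0n.
have n1 : (0 < n)%N by exact: leq_trans n0n.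
have n1R : 0 < n%:R :> R by rewrite ltr0n.
have ndl : n%:R^-1 <= dl.
  by rewrite -[dl]invrK lef_pV2 ?posrE ?invr_gt0// (le_trans hn0)// ler_nat.
pose F k := \int[mu]_(u in `[0, k%:R / n%:R]) f u.
have kn k (h1 : (k <= n)%N) := natr_div_unit h1 n1 : 0 <= (k%:R / n%:R : R) <= 1.
have int k (b : bool) : (k <= n)%N ->
    mu.-integrable [set` Interval (BSide b 0) (BRight (k%:R / n%:R))] (EFin \o f).
  move=> /kn /andP[k1 k2]; apply: integrableS modulus_integrable => //.
  by apply: subset_itv; rewrite bnd_simp//; case: b.
have step k : (k < n)%N -> `|F k.+1 - F k - f (k.+1%:R / n%:R) / n%:R| <= e / n%:R.
  move=> kltn; have /andP[a0 a1] := kn k (ltnW kltn); have /andP[b0 b1] := kn k.+1 kltn.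
  have ab : k%:R / n%:R <= k.+1%:R / n%:R :> R by rewrite ler_pM2r ?invr_gt0// ler_nat.
  have dab : k.+1%:R / n%:R - k%:R / n%:R = n%:R^-1 :> R.
    by rewrite -mulrBl -natr1 addrAC subrr add0r mul1r.
  rewrite /F Rintegral_itvB; last 3 first.
  - exact: (int k.+1 true).
  - by rewrite bnd_simp.
  - by rewrite bnd_simp.
  set a := k%:R / n%:R in a0 a1 ab dab *; set b := k.+1%:R / n%:R in b0 b1 ab dab *.
  have iab : mu.-integrable `]a, b] (EFin \o f).
    apply: integrableS modulus_integrable => //.
    by apply: subset_itv; rewrite bnd_simp.
  have icst c : mu.-integrable `]a, b] (EFin \o (fun=> c)).
    apply: (@integrableS _ _ _ mu `[0, 1]) => //; first by apply: subset_itv; rewrite bnd_simp.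
    apply: continuous_compact_integrable; first exact: segment_compact.
    by apply: continuous_subspaceT => x; exact: cvg_cst.
  have muab : fine (mu `]a, b]) = n%:R^-1.
    rewrite lebesgue_measure_itv/= lte_fin; case: ltP => [_|ba]; first by rewrite -EFinB/= dab.
    by have := dab; rewrite (le_anti (_ : a <= b <= a)) ?ab// subrr => <-.
  have bd u : a < u <= b -> f b - e <= f u <= f b + e.
    move=> /andP[au ub].
    have := h u b; rewrite b0 b1/= => /(_ _ _ _).
    have -> : 0 <= u <= 1 by apply/andP; split; lra.
    have -> : `|u - b| <= dl by rewrite distrC ger0_norm; lra.
    by move=> /(_ isT isT isT); rewrite ler_norml => /andP[? ?]; apply/andP; split; lra.
  have l1 : \int[mu]_(u in `]a, b]) (f b - e) <= \int[mu]_(u in `]a, b]) f u.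
    by apply: le_Rintegral => // u; rewrite /= in_itv/= => /bd /andP[].
  have l2 : \int[mu]_(u in `]a, b]) f u <= \int[mu]_(u in `]a, b]) (f b + e).
    by apply: le_Rintegral => // u; rewrite /= in_itv/= => /bd /andP[].
  rewrite !Rintegral_cst// muab in l1 l2.
  move: l1 l2; move: (Rintegral _ _ _) (f b) (n%:R^-1) => I J c l1 l2.
  clear -l1 l2; by rewrite ler_norml; apply/andP; split; lra.
have main k : (k <= n)%N ->
    `|F k - n%:R^-1 * \sum_(0 <= i < k) f (i.+1%:R / n%:R)| <= k%:R * (e / n%:R).
  elim: k => [_|k ih kltn].
    by rewrite /F mul0r set_itv1 Rintegral_set1 big_nil mulr0 subrr normr0 mul0r.
  have -> : k.+1%:R * (e / n%:R) = k%:R * (e / n%:R) + e / n%:R.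
    by rewrite -natr1; ring.
  rewrite big_nat_recr//= mulrDr.
  have -> : F k.+1 - (n%:R^-1 * \sum_(0 <= i < k) f (i.+1%:R / n%:R)
      + n%:R^-1 * f (k.+1%:R / n%:R)) =
    (F k - n%:R^-1 * \sum_(0 <= i < k) f (i.+1%:R / n%:R)) +
    (F k.+1 - F k - f (k.+1%:R / n%:R) / n%:R) by ring.
  by apply: le_trans (ler_normD _ _) _; apply: lerD; [exact/ih/ltnW | exact: step].
have := main n (leqnn n); rewrite /F divff ?gt_eqF// mulrCA divff ?gt_eqF// mulr1.
set I := \int[mu]_(u in _) _; set S := \sum_(_ <= _ < _) _ => hI.
have -> : S - n%:R * I = - n%:R * (I - n%:R^-1 * S).
  by rewrite mulrBr !mulNr [n%:R * (_ * S)]mulrA mulfV ?gt_eqF//; ring.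
by rewrite normrM normrN [`|n%:R|]ger0_norm// ler_pM2l.
Qed.

End riemann.

Section chainop.
Context {X : Type} {R : realType}.

(** The product M_(k+1) ... M_(k+j) applied to 1, with the earliest step outermost: the conditional
    expectation at time k of the next j weights. *)
Fixpoint chainop (M : nat -> (X -> R) -> X -> R) (k j : nat) : X -> R :=
  if j is j'.+1 then M k.+1 (chainop M k.+1 j') else fun=> 1.

End chainop.

(** * Dependence on the parameter, approximate eigenfunctions and their chaining *)

Section family.
Context {d} {T : measurableType d} {R : realType}.
Variables (Q : R -> (T -> R) -> T -> R) (g : R -> T -> R).
Variables (N : R -> (T -> R) -> R) (C th K L Cg : R).
Hypothesis hQ : forall u : R, 0 <= u <= 1 -> markov_op (Q u).
Hypothesis hg : forall u : R, 0 <= u <= 1 -> bmf (g u).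
Hypothesis hN : forall u : R, 0 <= u <= 1 -> contraction_seminorm (Q u) (N u) C th.
Hypotheses (hC : 1 <= C) (hth0 : 0 <= th) (hth1 : th < 1).
Hypothesis hK : forall (u : R) x, 0 <= u <= 1 -> `|g u x| <= K.
Hypotheses (hL0 : 0 <= L) (hCg0 : 0 <= Cg).
Hypothesis hL : forall (u v : R) f (D : R) x, 0 <= u <= 1 -> 0 <= v <= 1 -> bmf f ->
  (forall y, `|f y| <= D) -> `|Q u f x - Q v f x| <= L * `|u - v| * D.
Hypothesis hCg : forall (u v : R) x, 0 <= u <= 1 -> 0 <= v <= 1 ->
  `|g u x - g v x| <= Cg * `|u - v|.
Variables (t : R) (ht : small_tilt C th K t).
Implicit Types (u v e : R) (f : T -> R).

Local Notation M u := (laplace (Q u) (g u) t).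
Local Notation Z u n := (laplaceZ (Q u) (g u) t n).
Local Notation lam u := (pressure (Q u) (g u) t).

Lemma family_weight u x : 0 <= u <= 1 -> 1 / 2 <= expR (t * g u x) <= 2.
Proof.
move=> hu; have := small_tilt_weight hC hth0 hth1 (fun x => hK x hu) x ht.
have := weight_radius_le hC hth0 hth1; have := cone_aperture_le1 hC hth0 hth1.
by rewrite ler_norml => h1 h2 /andP[h3 h4]; apply/andP; split; lra.
Qed.

Lemma family_tK : `|t| * K <= 1 / 16.
Proof.
have h := ht; rewrite /small_tilt in h.
have := weight_radius_le hC hth0 hth1; have := cone_aperture_le1 hC hth0 hth1; lra.
Qed.

Lemma laplace_family_bound u f (D : R) x : 0 <= u <= 1 -> bmf f ->
  (forall y, `|f y| <= D) -> `|M u f x| <= 2 * D.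
Proof.
move=> hu hf hD; apply: (mop_bound (hQ hu)).
  by apply: bmfM => //; apply: bmf_expR; apply: bmfZ; exact: hg.
move=> y; rewrite normrM ler_pM// ger0_norm ?expR_ge0//.
by have /andP[] := family_weight y hu.
Qed.

(** The kernel is changed first, at cost 2 L, then the weight, at cost 4 |t| Cg; the numerical
    factors bound the weight and linearise the exponential. *)
Lemma laplace_family_lip u v f (D : R) x : 0 <= u <= 1 -> 0 <= v <= 1 -> bmf f ->
  (forall y, `|f y| <= D) ->
  `|M u f x - M v f x| <= (2 * L + 4 * `|t| * Cg) * `|u - v| * D.
Proof.
move=> hu hv hf hD.
have bw w : 0 <= w <= 1 -> bmf (fun y => expR (t * g w y) * f y).
  by move=> hw; apply: bmfM => //; apply: bmf_expR; apply: bmfZ; exact: hg.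
have h1 : `|Q u (fun y => expR (t * g u y) * f y) x -
    Q v (fun y => expR (t * g u y) * f y) x| <= L * `|u - v| * (2 * D).
  apply: hL => //; first exact: bw.
  move=> y; rewrite normrM ler_pM// ger0_norm ?expR_ge0//.
  by have /andP[] := family_weight y hu.
have h2 : `|Q v (fun y => expR (t * g u y) * f y) x -
    Q v (fun y => expR (t * g v y) * f y) x| <= 2 * (2 * (`|t| * (Cg * `|u - v|))) * D.
  apply: (mop_dist (hQ hv)) => [||y]; try exact: bw.
  rewrite -mulrBl normrM ler_pM//.
  have -> : expR (t * g u y) - expR (t * g v y) =
      expR (t * g v y) * (expR (t * (g u y - g v y)) - 1).
    by rewrite mulrBr mulr1 -expRD; congr (expR _ - _); ring.
  have htg : `|t * (g u y - g v y)| <= `|t| * (Cg * `|u - v|).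
    by rewrite normrM ler_wpM2l// hCg.
  rewrite normrM ler_pM//.
    rewrite ger0_norm ?expR_ge0//; by have /andP[] := family_weight y hv.
  apply: (le_trans (expR_dist1 _)); last by rewrite ler_pM2l.
  rewrite normrM; have tK := family_tK.
  have : `|g u y - g v y| <= K + K by rewrite (le_trans (ler_normB _ _))// lerD// hK.
  by move=> /(ler_wpM2l (normr_ge0 t)); lra.
have := ler_normD (Q u (fun y => expR (t * g u y) * f y) x -
    Q v (fun y => expR (t * g u y) * f y) x) (Q v (fun y => expR (t * g u y) * f y) x -
    Q v (fun y => expR (t * g v y) * f y) x).
rewrite addrA subrK /laplace; lra.
Qed.

Lemma laplaceZ_family_bounds u n x : 0 <= u <= 1 ->
  (1 / 2) ^+ n <= Z u n x <= 2 ^+ n.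
Proof.
move=> hu; have h1 := laplace_iter_ge (hQ hu) (hg hu) (t := t) n (c := 1 / 2) (bmf_cst 1).
have h2 := laplace_iter_sub (hQ hu) (hg hu) (t := t) n (c := 2) (bmf_cst 1).
have bw : bmf (fun y => expR (t * g u y) * 1).
  by apply: bmfM; [apply: bmf_expR; apply: bmfZ; exact: hg | exact: bmf_cst].
apply/andP; split.
- rewrite -[leLHS]mulr1; apply: h1; last by lra.
  move=> y; rewrite mulr1; apply: (mop_geC (hQ hu)) => // z; rewrite mulr1.
  by have /andP[] := family_weight z hu.
- rewrite -[leRHS]mulr1; apply: h2 => //.
  move=> y; rewrite mulr1; apply: (mop_leC (hQ hu)) => // z; rewrite mulr1.
  by have /andP[] := family_weight z hu.
Qed.

(** The constant may grow with n: it is only applied to finitely many n, fixed before the distance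
    of u and v. *)
Lemma laplaceZ_family_lip n : exists2 c, 0 <= c & forall (u v : R) x,
  0 <= u <= 1 -> 0 <= v <= 1 -> `|Z u n x - Z v n x| <= c * `|u - v|.
Proof.
elim: n => [|n [c c0 ih]].
  by exists 0 => // u v x _ _; rewrite /laplaceZ /= subrr normr0 mul0r.
exists ((2 * L + 4 * `|t| * Cg) * 2 ^+ n + 2 * c).
  by rewrite addr_ge0// mulr_ge0// ?exprn_ge0// addr_ge0// ?mulr_ge0.
move=> u v x hu hv.
have bu := laplaceZ_bmf (hQ hu) (hg hu) t n.
have bv := laplaceZ_bmf (hQ hv) (hg hv) t n.
have Zn y : `|Z u n y| <= 2 ^+ n.
  have /andP[z1 z2] := laplaceZ_family_bounds n y hu.
  by rewrite ger0_norm// (le_trans _ z1)// exprn_ge0.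
have h1 := laplace_family_lip x hu hv bu Zn.
have h2 : `|M v (Z u n) x - M v (Z v n) x| <= 2 * (c * `|u - v|).
  have <- : M v (fun y => Z u n y - Z v n y) x = M v (Z u n) x - M v (Z v n) x.
    rewrite /laplace -(mopB (hQ hv)); last 2 first.
    - by apply: bmfM => //; apply: bmf_expR; apply: bmfZ; exact: hg.
    - by apply: bmfM => //; apply: bmf_expR; apply: bmfZ; exact: hg.
    by congr (Q v _ x); apply/funext => y; rewrite mulrBr.
  by apply: laplace_family_bound => //; [exact: bmfB | move=> y; exact: ih].
have := ler_normD (M u (Z u n) x - M v (Z u n) x) (M v (Z u n) x - M v (Z v n) x).
rewrite addrA subrK /laplaceZ !iterS -/(Z u n) -/(Z v n); lra.
Qed.

(** Additive closeness becomes multiplicative because Z_j is at least 2^-j. *)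
Lemma laplaceZ_family_ratio n e : 0 < e -> exists2 dl, 0 < dl & forall j (u v : R) x,
  (j <= n)%N -> 0 <= u <= 1 -> 0 <= v <= 1 -> `|u - v| <= dl ->
  Z v j x <= expR e * Z u j x.
Proof.
move=> e0.
have one j : exists2 dl, 0 < dl & forall (u v : R) x,
    0 <= u <= 1 -> 0 <= v <= 1 -> `|u - v| <= dl -> Z v j x <= expR e * Z u j x.
  have [c c0 hc] := laplaceZ_family_lip j.
  exists (e / ((c + 1) * 2 ^+ j)).
    by rewrite divr_gt0// mulr_gt0 ?exprn_gt0//; lra.
  move=> u v x hu hv uv; have /andP[z1 _] := laplaceZ_family_bounds j x hu.
  have p0 : 0 < (2 : R) ^+ j by rewrite exprn_gt0.
  have h1 : `|Z v j x - Z u j x| <= e * (1 / 2) ^+ j.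
    rewrite distrC (le_trans (hc u v x hu hv))//.
    apply: (le_trans (ler_wpM2l c0 uv)).
    rewrite div1r exprVn invfM.
    have -> : c * (e * ((c + 1)^-1 * (2 ^+ j)^-1)) = c / (c + 1) * (e * (2 ^+ j)^-1) by ring.
    rewrite ler_piMl//; last by rewrite ler_pdivrMr; lra.
    by rewrite mulr_ge0 ?invr_ge0// ltW.
  have h2 : e * (1 / 2) ^+ j <= e * Z u j x by rewrite ler_pM2l.
  have z0 : 0 <= Z u j x by rewrite (le_trans _ z1)// exprn_ge0.
  have := ler_wpM2r z0 (expR_ge1Dx e); move: h1; rewrite ler_norml => /andP[]; lra.
elim: n => [|n [dl dl0 ih]].
  have [dl dl0 h] := one 0%N; exists dl => // j u v x; rewrite leqn0 => /eqP ->.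
  exact: h.
have [dl' dl'0 h] := one n.+1; exists (Num.min dl dl').
  by rewrite lt_min dl0.
move=> j u v x; rewrite leq_eqVlt => /orP[/eqP -> hu hv|jn hu hv]; rewrite le_min => /andP[h1 h2].
  exact: h.
exact: ih.
Qed.

(** The pressure is (ln Z_n) / n up to ln 2 / n, uniformly in u. Once n is large enough for (2 ln 2
    + 1) / n <= e, it suffices that ln Z_n varies by at most 1. *)
Lemma pressure_family_modulus e : 0 < e -> exists2 dl, 0 < dl & forall u v : R,
  0 <= u <= 1 -> 0 <= v <= 1 -> `|u - v| <= dl -> `|lam u - lam v| <= e.
Proof.
move=> e0; have ln20 : 0 <= ln 2 :> R by rewrite ln_ge0//; lra.
have [n n1 hk] := natr_ge_ex ((2 * ln 2 + 1) / e).
have hn : 2 * ln 2 + 1 <= e * n%:R by rewrite ler_pdivrMr// in hk; lra.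
have [dl dl0 h] := laplaceZ_family_ratio n (ltr01 : 0 < 1 :> R).
exists dl => //.
suff main u v : 0 <= u <= 1 -> 0 <= v <= 1 -> `|u - v| <= dl -> lam v - lam u <= e.
  move=> u v hu hv uv; have := main u v hu hv uv; have := main v u hv hu.
  rewrite distrC => /(_ uv) h1 h2.
  by rewrite ler_norml; apply/andP; split; lra.
move=> hu hv uv; have := h n u v point (leqnn _) hu hv uv.
have zu := laplaceZ_gt0 (hQ hu) (hg hu) (hN hu) hC hth0 hth1 (fun x => hK x hu) n point ht.
have zv := laplaceZ_gt0 (hQ hv) (hg hv) (hN hv) hC hth0 hth1 (fun x => hK x hv) n point ht.
rewrite -ler_ln ?posrE ?mulr_gt0 ?expR_gt0// lnM ?posrE ?expR_gt0// expRK.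
have := pressure_ln (hQ hu) (hg hu) (hN hu) hC hth0 hth1 (fun x => hK x hu) n ht.
have := pressure_ln (hQ hv) (hg hv) (hN hv) hC hth0 hth1 (fun x => hK x hv) n ht.
rewrite !ler_norml => /andP[a1 a2] /andP[b1 b2] h1.
have n0 : 0 < n%:R :> R by rewrite ltr0n.
rewrite -(ler_pM2l n0); lra.
Qed.

Definition cesaro_eigenfunction n u x : R :=
  \sum_(0 <= j < n) expR (- (j%:R * lam u)) * Z u j x.

Local Notation H := cesaro_eigenfunction.

Lemma cesaro_bmf n u : 0 <= u <= 1 -> bmf (H n u).
Proof.
move=> hu.
apply: (bmf_sum n (F := fun j x => expR (- (j%:R * lam u)) * Z u j x)) => j.
by apply: bmfZ; apply: (laplaceZ_bmf (hQ hu) (hg hu)).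
Qed.

Lemma normalizedZ_bounds u n x : 0 <= u <= 1 ->
  1 / 4 <= expR (- (n%:R * lam u)) * Z u n x <= 4.
Proof.
move=> hu; have [h1 h2] := pressure_bounds (hQ hu) (hg hu) (hN hu) hC hth0 hth1
  (fun x => hK x hu) n x ht.
rewrite expRN ler_pdivrMl ?expR_gt0// ler_pdivlMl ?expR_gt0//.
by apply/andP; split; lra.
Qed.

Lemma cesaro_bounds n u x : 0 <= u <= 1 -> n%:R / 4 <= H n u x <= 4 * n%:R.
Proof.
move=> hu; elim: n => [|n /andP[h1 h2]]; first by rewrite /H big_nil mul0r mulr0 lexx.
rewrite /H big_nat_recr//= -/(H n u x) -natr1.
by have /andP[h3 h4] := normalizedZ_bounds n x hu; apply/andP; split; lra.
Qed.

(** Applying the operator shifts the summation index, so after division by e^lam only the two end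
    terms differ. *)
Lemma cesaro_op n u x : 0 <= u <= 1 ->
  M u (H n u) x = expR (lam u) * (H n u x - 1 + expR (- (n%:R * lam u)) * Z u n x).
Proof.
move=> hu; elim: n => [|n ih].
  rewrite (_ : H 0 u = fun=> 0); last by apply/funext => y; rewrite /H big_nil.
  rewrite mul0r oppr0 expR0 /laplaceZ/= mulr1 sub0r addNr mulr0 /laplace.
  rewrite (_ : (fun _ => _) = fun=> 0) ?(mop_cst (hQ hu))//.
  by apply/funext => y; rewrite mulr0.
have -> : H n.+1 u = fun y => H n u y + expR (- (n%:R * lam u)) * Z u n y.
  by apply/funext => y; rewrite /H big_nat_recr.
have bZ : bmf (Z u n) by exact: (laplaceZ_bmf (hQ hu) (hg hu)).
have -> : M u (fun y => H n u y + expR (- (n%:R * lam u)) * Z u n y) x =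
    M u (H n u) x + expR (- (n%:R * lam u)) * M u (Z u n) x.
  rewrite -laplace_scale//; [|exact: hQ|exact: hg].
  rewrite /laplace -(mopD (hQ hu)); last 2 first.
  - apply: bmfM; [by apply: bmf_expR; apply: bmfZ; exact: hg | exact: cesaro_bmf].
  - apply: bmfM; [by apply: bmf_expR; apply: bmfZ; exact: hg | exact: bmfZ].
  by congr (Q u _ x); apply/funext => y; rewrite mulrDr.
rewrite ih; set z := Z u n x; have -> : M u (Z u n) x = Z u n.+1 x by [].
have -> : expR (- (n%:R * lam u)) * Z u n.+1 x =
    expR (lam u) * (expR (- (n.+1%:R * lam u)) * Z u n.+1 x).
  by rewrite mulrA -expRD -natr1; congr (expR _ * _); ring.
ring.
Qed.

(* The Cesaro sums are almost eigenfunctions because consecutive ones differ by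
   a bounded amount while they grow linearly. *)
Lemma approx_eigenfunction e : 0 < e -> exists (h : R -> T -> R) (l U dl : R),
  [/\ 0 < l, 0 < U, 0 < dl &
  (forall u : R, 0 <= u <= 1 -> [/\ bmf (h u), forall x, l <= h u x <= U &
     forall x, expR (lam u - e) * h u x <= M u (h u) x <= expR (lam u + e) * h u x]) /\
  (forall (u v : R) x, 0 <= u <= 1 -> 0 <= v <= 1 -> `|u - v| <= dl ->
     h v x <= expR e * h u x)].
Proof.
move=> e0; have [n n1 hn] := natr_ge_ex (16 / e + 8).
have n0 : 0 < n%:R :> R by rewrite ltr0n.
have ee : 0 <= 16 / e by rewrite divr_ge0// ltW.
have n8 : 8 <= n%:R :> R by lra.
pose y : R := 4 / n%:R.
have yn : y * n%:R = 4 by rewrite /y divfK// gt_eqF.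
have y0 : 0 <= y by rewrite /y divr_ge0// ltW.
have y8 : y <= 1 / 2 by rewrite /y ler_pdivrMr//; lra.
have y4 : 4 * y <= e.
  rewrite -(ler_pM2r n0) -mulrA yn; have : 16 / e <= n%:R by lra.
  by rewrite ler_pdivrMr//; lra.
clearbody y; clear hn ee.
have [d1 d10 h1] := laplaceZ_family_ratio n (divr_gt0 e0 (ltr0n _ 2)).
have [d2 d20 h2] := pressure_family_modulus (divr_gt0 e0 (mulr_gt0 (ltr0n _ 2) n0)).
exists (H n), (n%:R / 4), (4 * n%:R), (Num.min d1 d2).
split; [by rewrite divr_gt0|by rewrite mulr_gt0|by rewrite lt_min d10|split].
- move=> u hu; split => [|x|x]; [exact: cesaro_bmf | exact: cesaro_bounds |].
  rewrite cesaro_op//; have /andP[q1 q2] := normalizedZ_bounds n x hu.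
  have /andP[s1 s2] := cesaro_bounds n x hu.
  set z := _ * Z u n x in q1 q2 *; set w := H n u x in s1 s2 *.
  rewrite !expRD -!mulrA !ler_pM2l ?expR_gt0//; apply/andP; split.
  + have w0 : 0 <= w by lra.
    have : expR (- e) <= 1 - y.
      have -> : - e = - (2 * y) + (2 * y - e) by ring.
      rewrite expRD.
      have y3 : - (2 * y) < 1 by lra.
      have z2 : expR (2 * y - e) <= 1 by rewrite -[leRHS]expR0 ler_expR; lra.
      have z3 : (1 - - (2 * y))^-1 <= 1 - y.
        rewrite -[leLHS]mul1r ler_pdivrMr; last by lra.
        nra.
      apply: le_trans z3; apply: le_trans (expR_le_inv y3).
      by rewrite ler_piMr// expR_ge0.
    move=> /(ler_wpM2r w0) /le_trans; apply.
    have : y * (n%:R / 4) <= y * w by rewrite ler_wpM2l.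
    by rewrite mulrA yn; lra.
  + have w0 : 0 <= w by lra.
    have : 1 + 4 * y <= expR e by apply: le_trans (expR_ge1Dx _); rewrite lerD2l.
    move=> /(ler_wpM2r w0); apply: le_trans.
    have : y * (n%:R / 4) <= y * w by rewrite ler_wpM2l.
    by rewrite mulrA yn; lra.
- move=> u v x hu hv; rewrite le_min => /andP[uv1 uv2].
  rewrite /H big_distrr/= big_nat_cond [leRHS]big_nat_cond.
  apply: ler_sum => j; rewrite andbT => /andP[_ jn].
  have z1 := h1 j u v x (ltnW jn) hu hv uv1.
  have z2 := h2 u v hu hv uv2.
  have hz := laplaceZ_gt0 (hQ hu) (hg hu) (hN hu) hC hth0 hth1 (fun x => hK x hu) j x ht.
  apply: (le_trans (ler_wpM2l (expR_ge0 _) z1)).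
  rewrite !mulrA ler_pM2r// -!expRD ler_expR.
  have jn' : j%:R <= n%:R :> R by rewrite ler_nat ltnW.
  have z3 : j%:R * (lam u - lam v) <= n%:R * (e / (2 * n%:R)).
    apply: (@le_trans _ _ (j%:R * (e / (2 * n%:R)))).
      by rewrite ler_wpM2l// (le_trans (ler_norm _)).
    by rewrite ler_wpM2r// divr_ge0 ?mulr_ge0// ltW.
  have z4 : n%:R * (e / (2 * n%:R)) = e / 2 by field; rewrite gt_eqF.
  lra.
Qed.

Local Notation op n := (fun k : nat => M (k%:R / n%:R)).

Lemma chainop_bmf n k j : (0 < n)%N -> (k + j)%N = n -> bmf (chainop (op n) k j).
Proof.
move=> n0; elim: j k => [|j ih] k /= kj; first exact: bmf_cst.
have kn : (k < n)%N by rewrite -kj addnS ltnS leq_addr.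
have hk := natr_div_unit kn n0 : 0 <= (k.+1%:R / n%:R : R) <= 1.
by apply: (laplace_bmf (hQ hk) (hg hk)); apply: ih; rewrite -kj addSnnS.
Qed.

(** Backward induction comparing the product with a multiple of h at k/n. Each step costs e/2 in the
    approximate eigenvalue equation and e/2 in passing from h at (k+1)/n to h at k/n; the bounds l
    and U on h enter only once at each end. *)
Lemma chainop_bounds e : 0 < e -> exists (A : R) (n0 : nat), 0 < A /\ (0 < n0)%N /\
  forall n x, (n0 <= n)%N ->
  A^-1 * expR (\sum_(0 <= i < n) lam (i.+1%:R / n%:R) - n%:R * e) <=
    chainop (op n) 0 n x <=
  A * expR (\sum_(0 <= i < n) lam (i.+1%:R / n%:R) + n%:R * e).
Proof.
move=> e0; have e20 : 0 < e / 2 by lra.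
have [h [l [U [dl [l0 U0 dl0 [hh hd]]]]]] := approx_eigenfunction e20.
have [n0 n00 hn0] := natr_ge_ex dl^-1.
exists (U / l), n0; split; [by rewrite divr_gt0 | split => // n x n0n].
have n1 : (0 < n)%N by exact: leq_trans n0n.
have n1R : 0 < n%:R :> R by rewrite ltr0n.
have ndl : n%:R^-1 <= dl.
  by rewrite -[dl]invrK lef_pV2 ?posrE ?invr_gt0// (le_trans hn0)// ler_nat.
have hs k : (k < n)%N -> `|k%:R / n%:R - k.+1%:R / n%:R| <= dl.
  move=> kn; rewrite -mulrBl -natr1 opprD addrA subrr sub0r mulN1r normrN.
  by rewrite ger0_norm// invr_ge0 ltW.
have upper j k y : (k + j)%N = n -> chainop (op n) k j y <=
    l^-1 * expR (\sum_(k <= i < n) lam (i.+1%:R / n%:R) + j%:R * e) * h (k%:R / n%:R) y.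
  elim: j k y => [|j ih] k y kj.
    have nk : n = k by rewrite -kj addn0.
    have [_ hb _] := hh (k%:R / n%:R) (natr_div_unit (eq_leq (esym nk)) n1).
    rewrite mul0r addr0 big_geq; last by rewrite nk.
    by rewrite expR0 mulr1 ler_pdivlMl// mulr1; have /andP[] := hb y.
  have kn : (k < n)%N by rewrite -kj addnS ltnS leq_addr.
  have kj' : (k.+1 + j)%N = n by rewrite -kj addSnnS.
  have u0 := natr_div_unit (R := R) (ltnW kn) n1.
  have u1 := natr_div_unit (R := R) kn n1.
  have [b1 _ e1] := hh _ u1.
  rewrite /= big_ltn//; set v := k.+1%:R / n%:R in u1 b1 e1 *.
  set c := l^-1 * expR (\sum_(k.+1 <= i < n) lam (i.+1%:R / n%:R) + j%:R * e).
  apply: (@le_trans _ _ (M v (fun z => c * h v z) y)).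
    apply: (laplace_le (hQ u1) (hg u1)) => [||z]; [|exact: bmfZ|].
      exact: chainop_bmf.
    exact: ih.
  rewrite (laplace_scale (hQ u1) (hg u1))//.
  have c0 : 0 < c by rewrite mulr_gt0 ?invr_gt0 ?expR_gt0.
  have /andP[_ e2] := e1 y.
  apply: (le_trans (ler_wpM2l (ltW c0) e2)).
  have e3 := hd _ _ y u0 u1 (hs k kn).
  apply: (le_trans (ler_wpM2l (ltW c0) (ler_wpM2l (expR_ge0 _) e3))).
  rewrite /c -!mulrA ler_pM2l ?invr_gt0// !mulrA -!expRD.
  rewrite (_ : _ + (lam v + e / 2) + e / 2 = lam v + \sum_(k.+1 <= i < n) lam (i.+1%:R / n%:R) +
    j.+1%:R * e)//.
  by rewrite -natr1; field.
have lower j k y : (k + j)%N = n ->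
    U^-1 * expR (\sum_(k <= i < n) lam (i.+1%:R / n%:R) - j%:R * e) * h (k%:R / n%:R) y
    <= chainop (op n) k j y.
  elim: j k y => [|j ih] k y kj.
    have nk : n = k by rewrite -kj addn0.
    have [_ hb _] := hh (k%:R / n%:R) (natr_div_unit (eq_leq (esym nk)) n1).
    rewrite mul0r subr0 big_geq; last by rewrite nk.
    by rewrite expR0 mulr1 ler_pdivrMl// mulr1; have /andP[] := hb y.
  have kn : (k < n)%N by rewrite -kj addnS ltnS leq_addr.
  have kj' : (k.+1 + j)%N = n by rewrite -kj addSnnS.
  have u0 := natr_div_unit (R := R) (ltnW kn) n1.
  have u1 := natr_div_unit (R := R) kn n1.
  have [b1 _ e1] := hh _ u1.
  rewrite /= big_ltn//; set v := k.+1%:R / n%:R in u1 b1 e1 *.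
  set c := U^-1 * expR (\sum_(k.+1 <= i < n) lam (i.+1%:R / n%:R) - j%:R * e).
  apply: (@le_trans _ _ (M v (fun z => c * h v z) y)); last first.
    apply: (laplace_le (hQ u1) (hg u1)) => [||z]; [exact: bmfZ| |].
      exact: chainop_bmf.
    exact: ih.
  rewrite (laplace_scale (hQ u1) (hg u1))//.
  have c0 : 0 < c by rewrite mulr_gt0 ?invr_gt0 ?expR_gt0.
  have /andP[e2 _] := e1 y.
  apply: le_trans (ler_wpM2l (ltW c0) e2).
  have hs' : `|v - k%:R / n%:R| <= dl by rewrite distrC; exact: hs.
  have e3 := hd _ _ y u1 u0 hs'.
  have e4 : expR (- (e / 2)) * h (k%:R / n%:R) y <= h v y.
    by rewrite expRN ler_pdivrMl ?expR_gt0.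
  apply: le_trans (ler_wpM2l (ltW c0) (ler_wpM2l (expR_ge0 _) e4)).
  rewrite /c -!mulrA ler_pM2l ?invr_gt0// !mulrA -!expRD.
  rewrite (_ : _ + (lam v - e / 2) + - (e / 2) = lam v + \sum_(k.+1 <= i < n) lam (i.+1%:R / n%:R) -
    j.+1%:R * e)//.
  by rewrite -natr1; field.
have z0 : 0 <= (0 : R) <= 1 by lra.
have [_ hb _] := hh _ z0; have /andP[hb1 hb2] := hb x.
have up := upper n 0%N x (add0n n); have lo := lower n 0%N x (add0n n).
rewrite mul0r in up lo; rewrite invf_div; apply/andP; split.
- apply: le_trans lo; rewrite [l / U]mulrC -!mulrA ler_pM2l ?invr_gt0//.
  by rewrite mulrC ler_pM2l// expR_gt0.
- apply: (le_trans up); rewrite [U / l]mulrC -!mulrA ler_pM2l ?invr_gt0//.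
  by rewrite mulrC ler_pM2r// expR_gt0.
Qed.

(** The error is split in three: the chaining, the Riemann sum, and the constant A, which is at most
    e^(n e / 3) for large n. *)
Lemma chainop_limit e : 0 < e -> exists2 n0 : nat, (0 < n0)%N & forall n x, (n0 <= n)%N ->
  let Lam := \int[lebesgue_measure]_(u in `[0, 1]) lam u in
  expR (n%:R * (Lam - e)) <= chainop (op n) 0 n x <= expR (n%:R * (Lam + e)).
Proof.
move=> e0; have e30 : 0 < e / 3 by lra.
have [A [n1 [A0 [n10 h1]]]] := chainop_bounds e30.
have [n2 n20 h2] := riemann_sum pressure_family_modulus e30.
have [n3 n30 h3] := natr_ge_ex (A / (e / 3)).
exists (n1 + n2 + n3)%N; first by rewrite addn_gt0 n30 orbT.
move=> n x hn; cbv zeta; set Lam := Rintegral _ _ _.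
have n3n : (n3 <= n)%N by exact: leq_trans (leq_addl _ _) hn.
have n12n : (n1 + n2 <= n)%N by exact: leq_trans (leq_addr _ _) hn.
have /h2 := leq_trans (leq_addl n1 n2) n12n.
have /(h1 n x) := leq_trans (leq_addr n2 n1) n12n.
set S := \sum_(_ <= _ < _) _ => /andP[c1 c2].
rewrite ler_norml -/Lam => /andP[s1 s2].
have hA : A <= expR (n%:R * (e / 3)).
  apply: (@le_trans _ _ (n%:R * (e / 3))).
    by rewrite -ler_pdivrMr// (le_trans h3)// ler_nat.
  by apply: le_trans (expR_ge1Dx _); rewrite lerDr.
apply/andP; split.
- apply: le_trans c1.
  have : expR (- (n%:R * (e / 3))) <= A^-1.
    by rewrite expRN lef_pV2 ?posrE ?expR_gt0.
  move=> /(ler_wpM2r (expR_ge0 (S - n%:R * (e / 3)))); apply: le_trans.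
  by rewrite -expRD ler_expR; lra.
- apply: (le_trans c2).
  apply: (le_trans (ler_wpM2r (expR_ge0 _) hA)).
  by rewrite -expRD ler_expR; lra.
Qed.

End family.

(** * Integration against kernels *)

Section expectation.
Context {d} {T : measurableType d} {R : realType} 
  (mu : {measure set T -> \bar R}) (mu1 : mu setT = 1%E).
Implicit Types f : T -> R.

Lemma bmf_integrable f : bmf f -> mu.-integrable setT (EFin \o f).
Proof.
move=> [mf [M hM]]; apply: measurable_bounded_integrable => //.
  by rewrite mu1 ltry.
by exists M; split; [exact: num_real | move=> y My x _; exact: le_trans (hM x) (ltW My)].
Qed.

Lemma expectation_markov_op : markov_op (fun f (_ : T) => \int[mu]_x f x).
Proof.
split.
- by move=> f _; exact: bmf_cst.
- move=> a f g _ hf hg.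
  have ha : bmf (fun y => a * f y) by exact: bmfZ.
  rewrite RintegralD//; try exact: bmf_integrable.
  by rewrite RintegralZl//; exact: bmf_integrable.
- by move=> f _ hf f0; apply: Rintegral_ge0.
- move=> c _; rewrite Rintegral_cst// mu1 mulr1//.
Qed.

Lemma bmf_indic (A : set T) : measurable A -> bmf (\1_A : T -> R).
Proof.
move=> mA; split; first exact: measurable_indic.
by exists 1 => x; rewrite indicE; case: (x \in A); rewrite ?normr1 ?normr0.
Qed.

Lemma Rintegral_indic (A : set T) : measurable A -> \int[mu]_x \1_A x = fine (mu A).
Proof. by move=> mA; rewrite /Rintegral integral_indic// setIT. Qed.

End expectation.


(** Normalisation is left out so that weighted expectations f -> E [f(X) G] with G >= 0 are
    included. *)
Record posfun {d} {T : measurableType d} {R : realType} (I : (T -> R) -> R) : Prop :=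
  PosFun {
  pf_lin : forall a f g, bmf f -> bmf g ->
    I (fun y => a * f y + g y) = a * I f + I g ;
  pf_ge0 : forall f, bmf f -> (forall y, 0 <= f y) -> 0 <= I f }.

Section posfun_theory.
Context {d} {T : measurableType d} {R : realType}.
Implicit Types (I J : (T -> R) -> R) (f : T -> R).

Lemma posfun_mop (Q : (T -> R) -> T -> R) x : markov_op Q -> posfun (fun f => Q f x).
Proof.
by move=> hQ; split => [a f g hf hg|f hf f0]; [exact: mop_lin | exact: mop_ge0].
Qed.

Lemma pf0 I : posfun I -> I (fun=> 0) = 0.
Proof.
move=> hI; have := pf_lin hI 1 (bmf_cst 0) (bmf_cst 0).
rewrite (_ : (fun _ => _) = fun=> 0); last by apply/funext => x; rewrite mul1r addr0.
by rewrite mul1r => /eqP; rewrite -subr_eq0 opprD addrA subrr sub0r oppr_eq0 => /eqP.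
Qed.

Lemma pfZ I a f : posfun I -> bmf f -> I (fun y => a * f y) = a * I f.
Proof.
move=> hI hf; have := pf_lin hI a hf (bmf_cst 0); rewrite pf0// addr0 => <-.
by congr I; apply/funext => x; rewrite addr0.
Qed.

Lemma pfD I f g : posfun I -> bmf f -> bmf g -> I (fun y => f y + g y) = I f + I g.
Proof.
move=> hI hf hg; have := pf_lin hI 1 hf hg; rewrite mul1r => <-.
by congr I; apply/funext => x; rewrite mul1r.
Qed.

Lemma pf_le I f g : posfun I -> bmf f -> bmf g -> (forall y, f y <= g y) -> I f <= I g.
Proof.
move=> hI hf hg fg; have h : bmf (fun y => g y + - 1 * f y) by apply: bmfD => //; exact: bmfZ.
have : 0 <= I (fun y => g y + -1 * f y).
  by apply: (pf_ge0 hI) => // y; rewrite mulN1r subr_ge0.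
by rewrite pfD ?pfZ//; [rewrite mulN1r subr_ge0 | exact: bmfZ].
Qed.

Lemma pf_sum I n (F : nat -> T -> R) : posfun I -> (forall i, bmf (F i)) ->
  I (fun y => \sum_(0 <= i < n) F i y) = \sum_(0 <= i < n) I (F i).
Proof.
move=> hI hF; elim: n => [|n ih].
  rewrite big_nil -[RHS](pf0 hI); congr I; apply/funext => y; by rewrite big_nil.
rewrite big_nat_recr//= -ih -pfD//; last exact: bmf_sum.
by congr I; apply/funext => y; rewrite big_nat_recr.
Qed.

(** Discrete layer-cake formula: the sum counts the multiples of dl below v. *)
Lemma staircase (v dl : R) n : 0 <= v -> v <= n%:R * dl -> 0 <= dl ->
  v - dl <= \sum_(0 <= k < n) dl * (k.+1%:R * dl <= v)%R%:R <= v.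
Proof.
move=> v0 vn dl0; pose S m : R := \sum_(0 <= k < m) dl * (k.+1%:R * dl <= v)%R%:R.
have full m : m%:R * dl <= v -> S m = m%:R * dl.
  elim: m => [|m ih] hm; first by rewrite /S big_nil mul0r.
  rewrite /S big_nat_recr//= -/(S m) hm mulr1 ih -?natr1 ?mulrDl ?mul1r//.
  by apply: le_trans hm; rewrite ler_wpM2r// ler_nat.
have main m : S m <= v /\ (v <= m.+1%:R * dl -> v - dl <= S m).
  elim: m => [|m [h1 h2]].
    by rewrite /S big_nil; split => //; rewrite mul1r subr_le0.
  have [hm|hm] := leP (m.+1%:R * dl) v.
    by rewrite full//; split => //; rewrite -[m.+2%:R]natr1; lra.
  have -> : S m.+1 = S m by rewrite /S big_nat_recr//= leNgt hm mulr0 addr0.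
  by split => // _; apply: h2; exact: ltW.
have [h1 h2] := main n; apply/andP; split => //; apply: h2.
by rewrite -natr1 mulrDl mul1r; lra.
Qed.

Lemma bmf_approx f M dl : bmf f -> (forall x, 0 <= f x <= M) -> 0 < dl ->
  exists (n : nat) (A : nat -> set T), (forall k, measurable (A k)) /\
    forall x, f x - dl <= \sum_(0 <= k < n) dl * \1_(A k) x <= f x.
Proof.
move=> [mf _] hM dl0; have [n n0 hn] := natr_ge_ex (M / dl).
exists n, (fun k => [set x | k.+1%:R * dl <= f x]); split => [k|x].
  rewrite (_ : [set x | _] = setT `&` f @^-1` `[k.+1%:R * dl, +oo[); first exact: mf.
  by rewrite setTI; apply/seteqP; split => x /=; rewrite in_itv/= andbT.
have /andP[f0 fM] := hM x.
have := @staircase (f x) dl n f0; rewrite (le_trans fM) -?ler_pdivrMr// => /(_ isT (ltW dl0)).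
have -> : \sum_(0 <= k < n) dl * \1_[set x | k.+1%:R * dl <= f x] x =
    \sum_(0 <= k < n) dl * (k.+1%:R * dl <= f x)%R%:R => //.
apply: eq_bigr => k _; rewrite indicE; congr (_ * (nat_of_bool _)%:R).
by apply/idP/idP; rewrite inE.
Qed.

(* Uniform approximation by simple functions. *)
Lemma posfun_ext I J : posfun I -> posfun J ->
  (forall A, measurable A -> I \1_A = J \1_A) -> forall f, bmf f -> I f = J f.
Proof.
move=> hI hJ hA.
have c1 : I (fun=> 1) = J (fun=> 1).
  by have := hA _ measurableT; rewrite indicT.
suff main f : bmf f -> (forall x, 0 <= f x) -> I f = J f.
  move=> f hf; have [_ [M hM]] := hf.
  have e : f = fun x => (f x + M) + - M * 1.
    by apply/funext => x; rewrite mulr1 addrK.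
  have h1 : bmf (fun x => f x + M) by apply: bmfD => //; exact: bmf_cst.
  have h2 : bmf (fun _ : T => - M * 1) by apply: bmfZ; exact: bmf_cst.
  rewrite e (pfD hI h1 h2) (pfD hJ h1 h2) (pfZ _ hI (bmf_cst 1)) (pfZ _ hJ (bmf_cst 1)) c1.
  rewrite main// => x; have := hM x; rewrite ler_norml => /andP[]; lra.
move=> hf f0; have [_ [M hM]] := hf.
have I1 : 0 <= I (fun=> 1) by apply: (pf_ge0 hI) => //; exact: bmf_cst.
have fM x : 0 <= f x <= M.
  by rewrite f0 (le_trans (ler_norm _) (hM x)).
(* Stated for two arbitrary functionals so that it applies in both orders. The mesh dl is divided by
   the total mass plus 1, as the mass can differ from 1. *)
have key (I1' I2 : (T -> R) -> R) : posfun I1' -> posfun I2 -> I1' (fun=> 1) = I (fun=> 1) ->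
    I2 (fun=> 1) = I (fun=> 1) ->
    (forall A, measurable A -> I1' \1_A = I2 \1_A) -> I1' f <= I2 f.
  move=> h1 h2 e1 e2 hA'; apply/ler_addgt0Pr => e e0.
  pose dl := e / (I (fun=> 1) + 1).
  have dl0 : 0 < dl by rewrite divr_gt0//; lra.
  have [n [A [mA hn]]] := bmf_approx hf fM dl0.
  have bk k : bmf (fun x => dl * \1_(A k) x) by apply: bmfZ; exact: bmf_indic.
  have bs : bmf (fun x => \sum_(0 <= k < n) dl * \1_(A k) x).
    exact: (bmf_sum n (F := fun k x => dl * \1_(A k) x)).
  have s1 : I1' f <= I1' (fun x => \sum_(0 <= k < n) dl * \1_(A k) x + dl * 1).
    apply: pf_le => //; first by apply: bmfD => //; exact: bmf_cst.
    by move=> x; have /andP[] := hn x; lra.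
  have s2 : I2 (fun x => \sum_(0 <= k < n) dl * \1_(A k) x) <= I2 f.
    by apply: pf_le => // x; have /andP[] := hn x.
  have s3 : I1' (fun x => \sum_(0 <= k < n) dl * \1_(A k) x) =
      I2 (fun x => \sum_(0 <= k < n) dl * \1_(A k) x).
    rewrite !(pf_sum n (F := fun k x => dl * \1_(A k) x))//; apply: eq_bigr => k _.
    by rewrite !pfZ ?hA'//; exact: bmf_indic.
  move: s1; rewrite pfD//; last by apply: bmfZ; exact: bmf_cst.
  rewrite pfZ//; last exact: bmf_cst.
  rewrite s3 e1 => s1.
  have : dl * I (fun=> 1) <= e.
    rewrite /dl mulrAC ler_pdivrMr; last by lra.
    by rewrite ler_wpM2l ?ltW//; lra.
  lra.
apply/eqP; rewrite eq_le; apply/andP; split; first exact: key.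
by apply: key => //; rewrite ?c1// => A mA; rewrite hA.
Qed.

End posfun_theory.

(** * Operators of Markov kernels *)

Section kernel_operator.
Context {d} {T : measurableType d} {R : realType}.
Implicit Types (k : R.-pker T ~> T) (f : T -> R).

Definition kop k f (x : T) : R := \int[k x]_y f y.

Lemma pker_setT k x : k x setT = 1%E.
Proof. exact: prob_kernel. Qed.

Lemma kop_markov_op k : markov_op (kop k).
Proof.
have hk (x : T) := expectation_markov_op (pker_setT k x).
split.
- move=> f hf; have [mf [M hM]] := hf; split; last first.
    by exists M => x; exact: (mop_bound (hk x) x hf).
  (* Measurability in x is obtained for the nonnegative integrand f + M, and M is subtracted
     afterwards. *)
  have e : kop k f = fun x => fine (\int[k x]_y (f y + M)%:E)%E - M.
    apply/funext => x; have := mopD (hk x) x hf (bmf_cst M).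
    by rewrite (mop_cst (hk x) M x) /kop /Rintegral => ->; rewrite addrK.
  rewrite e; apply: measurable_funB => //.
  apply: measurableT_comp => //.
  apply: (measurable_fun_integral_kernel (l := k)).
  - by move=> U mU; exact: measurable_kernel.
  - by move=> z; rewrite lee_fin; have := hM z; rewrite ler_norml => /andP[]; lra.
  - by apply/measurable_EFinP; exact: measurable_funD.
- by move=> a f g x hf hg; exact: (mop_lin (hk x)).
- by move=> f x hf f0; exact: (mop_ge0 (hk x)).
- by move=> c x; exact: (mop_cst (hk x)).
Qed.

Lemma kop_indic k (A : set T) x : measurable A -> kop k \1_A x = fine (k x A).
Proof. by move=> mA; rewrite /kop Rintegral_indic. Qed.

Lemma prob_kernel_fin_num k x (A : set T) : measurable A -> k x A \is a fin_num.
Proof.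
move=> mA; rewrite ge0_fin_numE// (@le_lt_trans _ _ (k x setT))//.
  by apply: le_measure; rewrite ?inE.
by rewrite pker_setT ltry.
Qed.

Lemma kiterS k m x (A : set T) : (kiter k m.+1 x A = \int[k x]_y kiter k m y A)%E.
Proof. by []. Qed.

Lemma kiter_kop k m x (A : set T) : measurable A ->
  kiter k m x A = (iter m (kop k) \1_A x)%:E.
Proof.
move=> mA; elim: m x => [|m ih] x; first by rewrite /= /kdirac/= diracE indicE.
rewrite kiterS; under eq_integral do rewrite ih.
rewrite iterS {2}/kop /Rintegral fineK//.
have hb := mop_iter_bmf (kop_markov_op k) m (bmf_indic (R := R) mA).
exact: (integrable_fin_num measurableT (bmf_integrable (pker_setT k x) hb)).
Qed.

Lemma kiter_setT k m x : kiter k m x setT = 1%E.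
Proof.
rewrite kiter_kop// indicT; congr (_%:E).
by elim: m x => //= m ih x; rewrite (_ : iter m _ _ = fun=> 1) ?(mop_cst (kop_markov_op k))//; exact/funext.
Qed.

(** Both sides are positive functionals of f that agree on indicators. *)
Lemma Rintegral_kiter k m x f : bmf f -> \int[kiter k m x]_y f y = iter m (kop k) f x.
Proof.
move=> hf; apply: (posfun_ext (I := fun f => \int[kiter k m x]_y f y)
  (J := fun f => iter m (kop k) f x)) hf.
- exact: (posfun_mop x (expectation_markov_op (kiter_setT k m x))).
- split => [a f' g' hf' hg'|f' hf' f0].
    have hk := kop_markov_op k.
    elim: m x => //= m ih x.
    rewrite (_ : iter m _ _ = fun y => a * iter m (kop k) f' y + iter m (kop k) g' y); last exact/funext.
    by rewrite (mop_lin hk)//; exact: (mop_iter_bmf hk).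
  have hk := kop_markov_op k.
  elim: m x => //= m ih x; apply: (mop_ge0 hk) => //; exact: (mop_iter_bmf hk).
- move=> A mA; rewrite Rintegral_indic//.
  by rewrite kiter_kop.
Qed.

Lemma tv_le (mu nu : {measure set T -> \bar R}) (c D : R) f :
  mu setT = 1%E -> nu setT = 1%E -> (tv mu nu <= c%:E)%E ->
  bmf f -> (forall x, `|f x| <= D) -> 
  `|\int[mu]_x f x - \int[nu]_x f x| <= c * D.
Proof.
move=> mu1 nu1 hc hf hD.
have hm := expectation_markov_op mu1; have hn := expectation_markov_op nu1.
have D0 : 0 <= D by exact: le_trans (hD point).
(* For D = 0 the function vanishes; otherwise f / D is admissible in the supremum defining [tv]. *)
have [De|Dne] := eqVneq D 0.
  have -> : f = fun=> 0.
    by apply/funext => x; have := hD x; rewrite De normr_le0 => /eqP.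
  by rewrite (mop_cst hm 0 point) (mop_cst hn 0 point) subrr normr0 De mulr0.
have Dp : 0 < D by rewrite lt_neqAle eq_sym Dne.
have hf' : bmf (fun x => D^-1 * f x) by exact: bmfZ.
have key : (`|(\int[mu]_x (D^-1 * f x))%:E - (\int[nu]_x (D^-1 * f x))%:E| <= c%:E)%E.
  apply: le_trans hc; apply: ereal_sup_ubound; exists (fun x => D^-1 * f x).
    split; first by case: hf'.
    apply: ge_ereal_sup => _ [x _ <-]; rewrite lee_fin normrM ger0_norm ?invr_ge0//.
    by rewrite ler_pdivrMl// mulr1.
  rewrite /Rintegral !fineK//; apply: integrable_fin_num => //.
    exact: (bmf_integrable nu1).
  exact: (bmf_integrable mu1).
move: key; rewrite -EFinB/= lee_fin (mopZ hm _ point hf) (mopZ hn _ point hf) -mulrBr.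
by rewrite normrM ger0_norm ?invr_ge0// ler_pdivrMl// mulrC.
Qed.

End kernel_operator.

(** * A Gaertner-Ellis theorem *)

Section gartner_ellis.
Local Open Scope convex_scope.
Context {R : realType}.
Variables (dO : nat -> measure_display) (O : forall n, measurableType (dO n)).
Variables (P : forall n, probability (O n) R) (W : forall n, O n -> R).
Arguments W : clear implicits.
Hypothesis hW : forall n, bmf (W n).
Variables (Lam : R -> R) (t1 A s0 K : R).
Hypotheses (t10 : 0 < t1) (A0 : 0 <= A) (s00 : 0 < s0).
Hypothesis hlim : forall t e : R, 0 <= t <= t1 -> 0 < e ->
  exists2 n0 : nat, (0 < n0)%N & forall n, (n0 <= n)%N ->
    expR (n%:R * (Lam t - e)) <= \int[P n]_w expR (t * W n w) <= expR (n%:R * (Lam t + e)).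
Hypothesis hlip : forall s t : R, 0 <= s <= t1 -> 0 <= t <= t1 ->
  `|Lam s - Lam t| <= K * `|s - t|.
Hypothesis hsd : forall t s : R, 0 <= t - s -> t + s <= t1 -> 0 <= s -> s <= s0 ->
  Lam (t + s) + Lam (t - s) - 2 * Lam t <= A * s ^+ 2.
Hypotheses (hL0 : Lam 0 = 0) (hub : forall t : R, 0 <= t <= t1 -> Lam t <= A * t ^+ 2).
Hypothesis hpos : 0 < Lam t1.

(** The supremum is restricted to the interval where the limit of the moment generating functions is
    controlled. *)
Definition legendre (x : R) : R := sup [set t * x - Lam t | t in [set t | 0 <= t <= t1]].

Lemma legendre_max x : exists2 t, 0 <= t <= t1 &
  legendre x = t * x - Lam t /\ forall s : R, 0 <= s <= t1 -> s * x - Lam s <= legendre x.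
Proof.
have K0 : 0 <= K.
  have z0 : 0 <= (0 : R) <= t1 by rewrite lexx ltW.
  have z1 : 0 <= t1 <= t1 by rewrite lexx andbT ltW.
  have := le_trans (normr_ge0 _) (hlip z0 z1).
  by rewrite sub0r normrN gtr0_norm// pmulr_lge0.
have key (u v e : R) : 0 <= u <= t1 -> 0 <= v <= t1 -> `|u - v| * (`|x| + K + 1) <= e ->
    `|(u * x - Lam u) - (v * x - Lam v)| <= e.
  move=> uI vI uv; rewrite (_ : _ - _ = (u - v) * x - (Lam u - Lam v)); last by ring.
  rewrite (le_trans (ler_normB _ _))// normrM.
  by have := hlip uI vI; have := normr_ge0 (u - v); lra.
have cf : {within `[0, t1], continuous (fun t => t * x - Lam t)}.
  apply/subspace_continuousP => u /= uI; apply/cvgrPdist_le => e e0.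
  have M0 : 0 < `|x| + K + 1 by have := normr_ge0 x; have k0 := K0; lra.
  apply/nbhs_ballP; exists (e / (`|x| + K + 1)) => /=; first by rewrite divr_gt0.
  move=> v uv vI; rewrite /ball/= in uv.
  rewrite in_itv/= in uI; rewrite /= in_itv/= in vI.
  by apply: key => //; rewrite -ler_pdivlMr// ltW.
have [t + ht] := EVT_max (ltW t10) cf; rewrite in_itv/= => tI; exists t => //.
have e : legendre x = t * x - Lam t.
  apply/eqP; rewrite eq_le; apply/andP; split.
    apply: ge_sup; first by exists (t * x - Lam t); exists t.
    by move=> _ [s /= sI <-]; apply: ht; rewrite in_itv.
  apply: ub_le_sup; last by exists t.
  by exists (t * x - Lam t) => _ [s /= sI <-]; apply: ht; rewrite in_itv.
by split => // s sI; rewrite e; apply: ht; rewrite in_itv.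
Qed.

(** The quadratic bound on Lam makes the supremum positive. This excludes the endpoint 0, where the
    value is 0, and t1, where it is negative because x < Lam t1 / t1. *)
Lemma legendre_interior x : 0 < x < Lam t1 / t1 -> exists2 t, 0 < t < t1 &
  [/\ 0 < legendre x, legendre x = t * x - Lam t &
   forall s : R, 0 <= s <= t1 -> s * x - Lam s <= legendre x].
Proof.
move=> /andP[x0 xl]; have [t /andP[t0 tt1] [e h]] := legendre_max x.
have t1' := t10; have A0' := A0.
have l0 : 0 < legendre x.
  (* Up to the cut at t1, close to the maximiser of s x - A s^2; replacing A by A + 1 keeps the
     denominator positive. *)
  pose s := Num.min t1 (x / (2 * (A + 1))).
  have q0 : 0 < x / (2 * (A + 1)) by rewrite divr_gt0//; lra.
  have s_gt0 : 0 < s by rewrite lt_min t10.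
  have s_le1 : s <= t1 by rewrite ge_min lexx.
  have s_le2 : s <= x / (2 * (A + 1)) by rewrite ge_min lexx orbT.
  have sI : 0 <= s <= t1 by rewrite ltW.
  apply: lt_le_trans (h s sI); have := hub sI.
  move: s_le2; rewrite ler_pdivlMr; last by lra.
  rewrite expr2; clearbody s; nra.
have xl' : x * t1 < Lam t1 by rewrite -ltr_pdivlMr.
exists t; last by [].
apply/andP; split; rewrite lt_neqAle.
- by rewrite t0 andbT; apply/eqP => z; move: l0; rewrite e -z hL0 mul0r subrr ltxx.
- rewrite tt1 andbT; apply/eqP => z; move: l0; rewrite e z; lra.
Qed.

(** Only slopes up to t1 compete, so the transform grows at rate at most t1. This undoes the shift
    of the threshold in [tail_lower_shift]. *)
Lemma legendre_shift x y : x <= y -> legendre y <= legendre x + t1 * (y - x).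
Proof.
move=> xy; have [t /andP[t0 tt1] [-> _]] := legendre_max y.
have [s _ [_ h]] := legendre_max x.
have := h t; rewrite t0 tt1 => /(_ isT).
have : t * (y - x) <= t1 * (y - x) by rewrite ler_wpM2r// subr_ge0.
lra.
Qed.

Lemma legendre_convex : @convex_function R R^o `]0, (Lam t1 / t1)[ legendre.
Proof.
move=> p x y _ _.
have [t tI [-> _]] := legendre_max (x <| p |> y).
have [_ _ [_ hx]] := legendre_max x; have [_ _ [_ hy]] := legendre_max y.
have e : (conv p x y : R) = p%:num * x + (1 - p%:num) * y by [].
have h1 := hx t tI; have h2 := hy t tI.
have q0 : 0 <= p%:num :> R by [].
have q1 : p%:num <= 1 :> R by [].
have q2 : 0 <= 1 - p%:num :> R by rewrite subr_ge0.
rewrite convRE /unstable.onem e.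
have := ler_wpM2l q2 h2; have := ler_wpM2l q0 h1; lra.
Qed.

Let Ex n (f : O n -> R) : R := \int[P n]_w f w.
Let hE n : markov_op (fun f (_ : O n) => Ex f) := expectation_markov_op (probability_setT (P n)).
Let bexp0 n (a : R) : bmf (fun w => expR (a * W n w)).
Proof. by apply: bmf_expR; exact: bmfZ. Qed.

Lemma measurable_tail n (y : R) : measurable [set w | y <= W n w].
Proof.
have [mw _] := hW n; rewrite (_ : [set w | _] = setT `&` W n @^-1` `[y, +oo[).
  exact: mw.
by rewrite setTI; apply/seteqP; split => w /=; rewrite in_itv/= andbT.
Qed.

Lemma chernoff_upper n (t y : R) : 0 <= t ->
  expR (t * y) * fine (P n [set w | y <= W n w]) <= \int[P n]_w expR (t * W n w).
Proof.
move=> t0; have mA := measurable_tail n y.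
rewrite -Rintegral_indic// -[leLHS](mopZ (hE n) (expR (t * y)) point); last exact: bmf_indic.
apply: (mop_le (hE n) point) => [||w].
- by apply: bmfZ; exact: bmf_indic.
- exact: bexp0.
rewrite indicE; case: (boolP (w \in _)) => [|_]; last by rewrite mulr0 expR_ge0.
by rewrite inE/= mulr1 ler_expR => yw; rewrite ler_wpM2l.
Qed.

(** Each of the three regions W < y, W > z and y <= W <= z is covered by one of the terms, which
    there dominates e^(tW). *)
Lemma chernoff_lower n (t s y z : R) : 0 <= t -> 0 <= s ->
  \int[P n]_w expR (t * W n w) <= expR (t * z) * fine (P n [set w | y <= W n w]) +
    expR (- (s * z)) * \int[P n]_w expR ((t + s) * W n w) +
    expR (s * y) * \int[P n]_w expR ((t - s) * W n w).
Proof.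
move=> t0 s0'; have mA := measurable_tail n y.
have bA := bmf_indic (R := R) mA.
rewrite -Rintegral_indic// -!(mopZ (hE n) _ point)//; try exact: bexp0.
have b1 : bmf (fun w => expR (t * z) * \1_[set w | y <= W n w] w) by exact: bmfZ.
have b2 : bmf (fun w => expR (- (s * z)) * expR ((t + s) * W n w)) by exact: bmfZ.
have b3 : bmf (fun w => expR (s * y) * expR ((t - s) * W n w)) by exact: bmfZ.
rewrite -(mopD (hE n) point b1 b2) -(mopD (hE n) point (bmfD b1 b2) b3).
apply: (mop_le (hE n) point) => [|| w]; [exact: bexp0 | exact/bmfD/b3/bmfD |].
set v := W n w.
have e1 : 0 <= expR (- (s * z)) * expR ((t + s) * v) by rewrite mulr_ge0// expR_ge0.
have e2 : 0 <= expR (s * y) * expR ((t - s) * v) by rewrite mulr_ge0// expR_ge0.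
have e3 : 0 <= expR (t * z) * \1_[set w | y <= W n w] w :> R.
  by rewrite mulr_ge0 ?expR_ge0// indicE ler0n.
have [vy|yv] := ltP v y.
  apply: (@le_trans _ _ (expR (s * y) * expR ((t - s) * v))); last by lra.
  rewrite -expRD ler_expR; have : s * v <= s * y by rewrite ler_wpM2l// ltW.
  lra.
have [zv|vz] := ltP z v.
  apply: (@le_trans _ _ (expR (- (s * z)) * expR ((t + s) * v))); last by lra.
  rewrite -expRD ler_expR; have : s * z <= s * v by rewrite ler_wpM2l// ltW.
  lra.
apply: (@le_trans _ _ (expR (t * z) * \1_[set w | y <= W n w] w)); last by lra.
rewrite indicE mem_set//= mulr1 ler_expR ler_wpM2l//.
Qed.

Lemma tail_upper x e : 0 < x < Lam t1 / t1 -> 0 < e ->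
  exists2 n0 : nat, (0 < n0)%N & forall n, (n0 <= n)%N ->
    fine (P n [set w | x * n%:R <= W n w]) <= expR (n%:R * (- legendre x + e)).
Proof.
move=> hx e0; have [t /andP[t0 tt1] [_ le _]] := legendre_interior hx.
have tI : 0 <= t <= t1 by rewrite !ltW.
have [n0 n00 h] := hlim tI e0; exists n0 => // n nn.
have /andP[_ h2] := h n nn.
have := le_trans (chernoff_upper n (x * n%:R) (ltW t0)) h2.
rewrite mulrC -ler_pdivlMr ?expR_gt0// -expRN -expRD => /le_trans; apply.
by rewrite ler_expR le; lra.
Qed.

(** At the maximiser t, Lam (t - s) >= Lam t - s x and Lam (t + s) >= Lam t + s x. Inserting either
    into the second-difference bound gives the opposite inequality for the other, up to A s^2. Hence
    Lam behaves near t as if it had slope x, and the two side terms of [chernoff_lower] are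
    negligible at the levels x + h and x - h. *)
Lemma tail_lower_shift x h : 0 < x < Lam t1 / t1 -> 0 < h -> h <= 1 ->
  exists2 n0 : nat, (0 < n0)%N & forall n, (n0 <= n)%N ->
    expR (n%:R * (- legendre x - (t1 + 2) * h))
      <= fine (P n [set w | (x - h) * n%:R <= W n w]).
Proof.
move=> hx h0 h1; have [t /andP[t0 tt1] [_ le hmax]] := legendre_interior hx.
have t1' := t10; have A0' := A0; have s00' := s00.
pose s := Num.min (Num.min s0 1) (Num.min (Num.min t (t1 - t)) (h / (2 * (A + 1)))).
have s_gt0 : 0 < s by rewrite !lt_min s00 ltr01 t0 subr_gt0 tt1/= divr_gt0//; lra.
have s_s0 : s <= s0 by rewrite !ge_min lexx.
have s_1 : s <= 1 by rewrite !ge_min lexx !orbT.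
have s_t : s <= t by rewrite !ge_min lexx !orbT.
have s_t1 : s <= t1 - t by rewrite !ge_min lexx !orbT.
have s_h : s * (2 * (A + 1)) <= h.
  by rewrite -ler_pdivlMr ?ge_min ?lexx ?orbT//; lra.
clearbody s.
have As : A * s ^+ 2 <= s * h / 2.
  have : s * (s * (2 * (A + 1))) <= s * h by rewrite ler_pM2l.
  have : 0 <= s ^+ 2 by exact: sqr_ge0.
  rewrite expr2; lra.
have Ip : 0 <= t + s <= t1 by apply/andP; split; lra.
have Im : 0 <= t - s <= t1 by apply/andP; split; lra.
have It : 0 <= t <= t1 by apply/andP; split; lra.
have sd : Lam (t + s) + Lam (t - s) - 2 * Lam t <= A * s ^+ 2 by apply: hsd; lra.
have hp := hmax _ Ip; have hm := hmax _ Im.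
have up : Lam (t + s) <= Lam t + s * x + s * h / 2 by lra.
have um : Lam (t - s) <= Lam t - s * x + s * h / 2 by lra.
(* The side terms have a margin s h / 2 = 4 dl in the exponent; two uses of the limit at accuracy dl
   leave 2 dl. *)
pose dl := s * h / 8.
have sh0 : 0 < s * h by rewrite mulr_gt0.
have dl0 : 0 < dl by rewrite divr_gt0.
have dlh : dl <= h.
  have : s * h <= 1 * h by rewrite ler_pM2r.
  by rewrite /dl; lra.
have [n1 n10 H1] := hlim It dl0; have [n2 _ H2] := hlim Ip dl0; have [n3 _ H3] := hlim Im dl0.
have [n4 n40 H4] := natr_ge_ex (3 / (2 * dl)).
have [n5 n50 H5] := natr_ge_ex (1 / h).
exists (n1 + n2 + n3 + n4 + n5)%N; first by rewrite addn_gt0 n50 orbT.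
move=> n hn.
have hn5 : (n5 <= n)%N by exact: leq_trans (leq_addl _ _) hn.
have {}hn := leq_trans (leq_addr _ _) hn.
have hn4 : (n4 <= n)%N by exact: leq_trans (leq_addl _ _) hn.
have {}hn := leq_trans (leq_addr _ _) hn.
have hn3 : (n3 <= n)%N by exact: leq_trans (leq_addl _ _) hn.
have {}hn := leq_trans (leq_addr _ _) hn.
have hn2 : (n2 <= n)%N by exact: leq_trans (leq_addl _ _) hn.
have hn1 := leq_trans (leq_addr _ _) hn.
have /andP[z1 _] := H1 n hn1; have /andP[_ z2] := H2 n hn2; have /andP[_ z3] := H3 n hn3.
have n4R : 3 <= n%:R * (2 * dl).
  by rewrite -ler_pdivrMr ?mulr_gt0// (le_trans H4)// ler_nat.
have n5R : 1 <= n%:R * h.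
  by rewrite -ler_pdivrMr// (le_trans H5)// ler_nat.
have := chernoff_lower n ((x - h) * n%:R) ((x + h) * n%:R) (ltW t0) (ltW s_gt0).
set p := fine _; set Zt := Rintegral _ _ _ in z1 *; set Zp := Rintegral _ _ _ in z2 *.
set Zm := Rintegral _ _ _ in z3 *; clearbody p Zt Zp Zm.
set E := expR (n%:R * (Lam t - dl)) in z1 *; have E0 : 0 < E by exact: expR_gt0.
have q4 : expR (- (n%:R * (2 * dl))) <= 1 / 4.
  have l3 : - (n%:R * (2 * dl)) < 1 by lra.
  apply: (le_trans (expR_le_inv l3)).
  by rewrite div1r lef_pV2 ?posrE; lra.
have b2 : expR (- (s * ((x + h) * n%:R))) * Zp <= E / 4.
  apply: (le_trans (ler_wpM2l (expR_ge0 _) z2)).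
  apply: (@le_trans _ _ (E * expR (- (n%:R * (2 * dl))))); last by rewrite -div1r; nra.
  rewrite /E -!expRD ler_expR.
  have : n%:R * Lam (t + s) <= n%:R * (Lam t + s * x + s * h / 2) by rewrite ler_wpM2l.
  by rewrite /dl; lra.
have b3 : expR (s * ((x - h) * n%:R)) * Zm <= E / 4.
  apply: (le_trans (ler_wpM2l (expR_ge0 _) z3)).
  apply: (@le_trans _ _ (E * expR (- (n%:R * (2 * dl))))); last by rewrite -div1r; nra.
  rewrite /E -!expRD ler_expR.
  have : n%:R * Lam (t - s) <= n%:R * (Lam t - s * x + s * h / 2) by rewrite ler_wpM2l.
  by rewrite /dl; lra.
move=> b1; have b4 : E / 2 <= expR (t * ((x + h) * n%:R)) * p by lra.
have q2 : expR (- (n%:R * h)) <= 1 / 2.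
  have l3 : - (n%:R * h) < 1 by lra.
  apply: (le_trans (expR_le_inv l3)).
  by rewrite div1r lef_pV2 ?posrE; lra.
have : E * expR (- (n%:R * h)) <= expR (t * ((x + h) * n%:R)) * p by nra.
rewrite -ler_pdivrMl ?expR_gt0// -expRN /E -!expRD => /(le_trans _); apply.
rewrite ler_expR le.
have e1 : n%:R * dl <= n%:R * h by rewrite ler_wpM2l.
have e2 : n%:R * h * t <= n%:R * h * t1.
  by apply: ler_wpM2l; lra.
lra.
Qed.

Lemma tail_lower x e : 0 < x < Lam t1 / t1 -> 0 < e ->
  exists2 n0 : nat, (0 < n0)%N & forall n, (n0 <= n)%N ->
    expR (n%:R * (- legendre x - e)) <= fine (P n [set w | x * n%:R <= W n w]).
Proof.
move=> /andP[x0 xl] e0; have t1' := t10.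
(* The estimate is applied at x + h to recover the threshold x. The loss is (t1 + 2) h, plus t1 h
   from the shift of the transform, in total (2 t1 + 2) h. *)
pose h := Num.min (Num.min 1 (e / (2 * t1 + 2))) ((Lam t1 / t1 - x) / 2).
have h0 : 0 < h.
  by rewrite !lt_min ltr01 divr_gt0 ?divr_gt0//; lra.
have h1 : h <= 1 by rewrite !ge_min lexx.
have h2 : h * (2 * t1 + 2) <= e.
  by rewrite -ler_pdivlMr ?ge_min ?lexx ?orbT//; lra.
have h3 : h <= (Lam t1 / t1 - x) / 2 by rewrite ge_min lexx orbT.
clearbody h.
have hx : 0 < x + h < Lam t1 / t1 by apply/andP; split; lra.
have [n0 n00 H] := tail_lower_shift hx h0 h1; exists n0 => // n nn.
have := H n nn; rewrite addrK; apply: le_trans; rewrite ler_expR ler_wpM2l//.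
have xh : x <= x + h by lra.
by have := legendre_shift xh; lra.
Qed.

Theorem gartner_ellis : exists (eps0 : R) (c : R -> R),
  [/\ 0 < eps0, forall eps, 0 < eps < eps0 -> 0 < c eps,
      @convex_function R R^o `]0, eps0[ c &
      forall eps, 0 < eps < eps0 ->
        ((n%:R^-1)%:E * lne (P n [set w | (eps * n%:R <= W n w)%R]))%E
          @[n --> \oo] --> (- c eps)%:E].
Proof.
exists (Lam t1 / t1), legendre; split.
- by rewrite divr_gt0.
- by move=> x /legendre_interior[t _ []].
- exact: legendre_convex.
move=> x hx; set p := fun n => fine (P n [set w | x * n%:R <= W n w]).
have Pp n : P n [set w | x * n%:R <= W n w] = (p n)%:E.
  by rewrite /p fineK// fin_num_measure//; exact: measurable_tail.
(* The lower bound makes the tail probability eventually positive, so that its extended logarithm is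
   a real number. *)
have [n1 n10 H1] := tail_lower hx ltr01.
have pos n : (n1 <= n)%N -> 0 < p n.
  by move=> nn; apply: lt_le_trans (H1 n nn); exact: expR_gt0.
have lp n : (n1 <= n)%N ->
    ((n%:R^-1)%:E * lne (P n [set w | (x * n%:R <= W n w)%R]))%E = (n%:R^-1 * ln (p n))%:E.
  by move=> nn; rewrite Pp lne_EFin ?pos// EFinM.
apply: cvg_EFin.
  by exists n1 => // n /= nn; rewrite lp.
apply/cvgrPdist_le => e e0.
have [n2 n20 H2] := tail_lower hx e0; have [n3 n30 H3] := tail_upper hx e0.
exists (n1 + n2 + n3)%N => // n /= nn.
have n3n : (n3 <= n)%N by exact: leq_trans (leq_addl _ _) nn.
have {}nn := leq_trans (leq_addr _ _) nn.
have n2n : (n2 <= n)%N by exact: leq_trans (leq_addl _ _) nn.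
have n1n := leq_trans (leq_addr _ _) nn.
rewrite /= lp//=; have nR : 0 < n%:R :> R by rewrite ltr0n (leq_trans n10).
have h1 : ln (p n) <= n%:R * (- legendre x + e).
  by rewrite -[leRHS]expRK ler_ln ?posrE ?expR_gt0 ?pos//; exact: H3.
have h2 : n%:R * (- legendre x - e) <= ln (p n).
  by rewrite -[leLHS]expRK ler_ln ?posrE ?expR_gt0 ?pos//; exact: H2.
rewrite -ler_pdivrMl// in h1; rewrite -ler_pdivlMl// in h2.
by rewrite ler_norml; apply/andP; split; lra.
Qed.

End gartner_ellis.

(** * Markov chains *)

Section past_sigma_algebra.
Context {R : realType} {dO} {Omega : measurableType dO}
  {P : probability Omega R} {d} {T : measurableType d}.
Variable X : nat -> {RV P >-> T}.

Let gen k : set (set Omega) :=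
  [set C | exists i B, [/\ (i <= k)%N, measurable B & C = X i @^-1` B] ].

Lemma past_measurable k C : past X k C -> measurable C.
Proof.
move: C; apply: smallest_sub; first exact: sigma_algebra_measurable.
by move=> _ [i [B [_ mB ->]]]; rewrite -[X in measurable X]setTI; exact: measurable_funPT.
Qed.

Lemma pastS k C : past X k C -> past X k.+1 C.
Proof.
move: C; apply: sub_smallest2r; first exact: smallest_sigma_algebra.
by move=> _ [i [B [ik mB ->]]]; exists i, B; split => //; exact: leqW.
Qed.

Lemma pastI k C D : past X k C -> past X k D -> past X k (C `&` D).
Proof. exact: (@measurableI _ (g_sigma_algebraType (gen k))). Qed.

Lemma past_preimage k i B : (i <= k)%N -> measurable B -> past X k (X i @^-1` B).
Proof. by move=> ik mB; apply: sub_gen_smallest; exists i, B. Qed.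

Lemma past_setT k : past X k setT.
Proof. exact: (@measurableT _ (g_sigma_algebraType (gen k))). Qed.

End past_sigma_algebra.

(** * Expectations of functions of a random variable against a weight *)

Section weights.
Context {d1} {S : measurableType d1} {d} {T : measurableType d} {R : realType}.
Variables (P : probability S R) (phi : S -> T).
Hypothesis mphi : measurable_fun setT phi.
Implicit Types (f : T -> R) (G : S -> R).

Local Notation E := (fun G : S -> R => \int[P]_w G w).

Lemma E_markov_op : markov_op (fun G (_ : S) => E G).
Proof. exact: expectation_markov_op (probability_setT P). Qed.

Lemma E_posfun : posfun E.
Proof. exact: (posfun_mop point E_markov_op). Qed.

Lemma bmf_comp f : bmf f -> bmf (f \o phi).
Proof.
by move=> [mf [M hM]]; split; [exact: measurableT_comp | exists M => w; exact: hM].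
Qed.

Lemma posfun_weight G : bmf G -> (forall w, 0 <= G w) ->
  posfun (fun f => E (fun w => f (phi w) * G w)).
Proof.
move=> hG G0; split => [a f g hf hg|f hf f0].
  have h1 : bmf (fun w => f (phi w) * G w) by apply: bmfM => //; exact: (bmf_comp hf).
  have h2 : bmf (fun w => g (phi w) * G w) by apply: bmfM => //; exact: (bmf_comp hg).
  rewrite -(pf_lin E_posfun a h1 h2); congr (Rintegral _ _ _).
  by apply/funext => w; ring.
apply: (pf_ge0 E_posfun) => [|w]; last by rewrite mulr_ge0.
by apply: bmfM => //; exact: (bmf_comp hf).
Qed.

Lemma posfun_weight_op (Q : (T -> R) -> T -> R) G : markov_op Q -> bmf G ->
  (forall w, 0 <= G w) -> posfun (fun f => E (fun w => Q f (phi w) * G w)).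
Proof.
move=> hQ hG G0; have hp := posfun_weight hG G0.
split => [a f g hf hg|f hf f0].
  have := pf_lin hp a (mop_bmf hQ hf) (mop_bmf hQ hg) => <-.
  congr (Rintegral _ _ _); apply/funext => w.
  by rewrite (mop_lin hQ).
by apply: (pf_ge0 hp) => [|y]; [exact: mop_bmf | exact: (mop_ge0 hQ)].
Qed.

(** The weights may change sign; adding the same constant to both makes them nonnegative, so that
    [posfun_ext] applies. *)
Lemma weight_ext G G' : bmf G -> bmf G' ->
  (forall A, measurable A ->
    E (fun w => \1_A (phi w) * G w) = E (fun w => \1_A (phi w) * G' w)) ->
  forall f, bmf f -> E (fun w => f (phi w) * G w) = E (fun w => f (phi w) * G' w).
Proof.
move=> hG hG' hA f hf; have [_ [M hM]] := hG; have [_ [M' hM']] := hG'.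
pose c := M + M'.
have M0 : 0 <= M by exact: le_trans (hM point).
have M'0 : 0 <= M' by exact: le_trans (hM' point).
have shift H k : bmf H -> bmf k -> E (fun w => k (phi w) * (H w + c)) =
    E (fun w => k (phi w) * H w) + c * E (fun w => k (phi w)).
  move=> hH hk.
  have h1 : bmf (fun w => k (phi w) * H w) by apply: bmfM => //; exact: (bmf_comp hk).
  have h2 : bmf (fun w => k (phi w)) by exact: (bmf_comp hk).
  rewrite -(pfZ c E_posfun h2) -(pfD E_posfun h1 (bmfZ c h2)).
  by congr (Rintegral _ _ _); apply/funext => w; ring.
have b1 : bmf (fun w => G w + c) by apply: bmfD => //; exact: bmf_cst.
have b2 : bmf (fun w => G' w + c) by apply: bmfD => //; exact: bmf_cst.
have p1 w : 0 <= G w + c.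
  by rewrite /c; have := hM w; rewrite ler_norml => /andP[]; lra.
have p2 w : 0 <= G' w + c.
  by rewrite /c; have := hM' w; rewrite ler_norml => /andP[]; lra.
have := posfun_ext (posfun_weight b1 p1) (posfun_weight b2 p2) _ hf.
rewrite !shift// => /(_ _)/addIr; apply.
by move=> A mA; rewrite !shift ?hA//; exact: bmf_indic.
Qed.

End weights.

Section markov_chain_expectation.
Context {R : realType} {dO} {Omega : measurableType dO}
  {P : probability Omega R} {d} {T : measurableType d}.
Variables (X : nat -> {RV P >-> T}) (N : nat) (mu : probability T R)
  (kappa : nat -> R.-pker T ~> T).
Hypothesis hX : markov_chain X N mu kappa.

Local Notation E := (fun G : Omega -> R => \int[P]_w G w).

Let mX i : measurable_fun setT (X i). Proof. exact: measurable_funPT. Qed.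
Let bX i (f : T -> R) : bmf f -> bmf (fun w => f (X i w)).
Proof. exact: (bmf_comp (mX i)). Qed.
Let bC k (C : set Omega) : past X k C -> bmf (\1_C : Omega -> R).
Proof. by move=> /past_measurable; exact: bmf_indic. Qed.

Lemma markov_initial (f : T -> R) : bmf f -> E (fun w => f (X 0%N w)) = \int[mu]_x f x.
Proof.
move=> hf.
have h1 := posfun_weight P (mX 0%N) (bmf_cst 1) (fun _ => ler01).
have h2 := posfun_mop point (expectation_markov_op (probability_setT mu)).
have := posfun_ext h1 h2 _ hf; under eq_Rintegral do rewrite mulr1.
apply => A mA; under eq_Rintegral do rewrite mulr1.
transitivity (fine (mu A)); last by rewrite Rintegral_indic.
rewrite -(hX.1 A mA) -Rintegral_indic//.
by rewrite -[X in measurable X]setTI; exact: mX.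
Qed.

Lemma markov_step k C (f : T -> R) : (k < N)%N -> past X k C -> bmf f ->
  E (fun w => f (X k.+1 w) * \1_C w) = E (fun w => kop (kappa k.+1) f (X k w) * \1_C w).
Proof.
move=> kN pC hf; have C0 w : 0 <= \1_C w :> R by rewrite indicE.
have hk := kop_markov_op (kappa k.+1).
have mC := past_measurable pC.
have h1 := posfun_weight P (mX k.+1) (bC pC) C0.
have h2 := posfun_weight_op P (mX k) hk (bC pC) C0.
apply: (posfun_ext h1 h2 _ hf) => A mA.
transitivity (fine (P (C `&` X k.+1 @^-1` A))).
  rewrite -Rintegral_indic; last first.
    by apply: measurableI => //; rewrite -[X in measurable X]setTI; exact: mX.
  by apply: eq_Rintegral => w _; rewrite indicI mulrC.
rewrite (hX.2 k kN C A pC mA).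
transitivity (\int[P]_(w in C) fine (kappa k.+1 (X k w) A)).
  congr fine; apply: eq_integral => w _.
  by rewrite fineK//; exact: prob_kernel_fin_num.
rewrite Rintegral_mkcond; apply: eq_Rintegral => w _.
by rewrite patchE indicE kop_indic//; case: (w \in C); rewrite ?mulr1 ?mulr0.
Qed.

Definition weighted (F : nat -> T -> R) (i : nat) (f : T -> R) : T -> R :=
  kop (kappa i) (fun y => F i y * f y).

Variable F : nat -> T -> R.
Hypothesis hF : forall i, (i <= N)%N -> bmf (F i).

Lemma weighted_bmf k j : (k + j <= N)%N -> bmf (chainop (weighted F) k j).
Proof.
elim: j k => [|j ih] k kN /=; first exact: bmf_cst.
apply: (mop_bmf (kop_markov_op _)); apply: bmfM; last by apply: ih; rewrite addSnnS.
by apply: hF; apply: leq_trans kN; rewrite -addSnnS leq_addr.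
Qed.

(** Induction on the number of factors. The induction hypothesis at time k+1, applied to the events
    C intersected with {X_(k+1) in A}, is extended from indicators to the factor F_(k+1) by
    [weight_ext]; [markov_step] then integrates out X_(k+1). *)
Lemma markov_product k j C : (k + j <= N)%N -> past X k C ->
  E (fun w => \prod_(k.+1 <= i < (k + j).+1) F i (X i w) * \1_C w) =
  E (fun w => chainop (weighted F) k j (X k w) * \1_C w).
Proof.
elim: j k C => [|j ih] k C kN pC.
  by apply: eq_Rintegral => w _; rewrite addn0 big_geq.
have kN' : (k.+1 + j <= N)%N by rewrite addSnnS.
have k1N : (k < N)%N by apply: leq_trans kN; rewrite -addSnnS leq_addr.
set V := chainop (weighted F) k.+1 j.
have bV : bmf V by exact: weighted_bmf.
pose G w := \prod_(k.+2 <= i < (k.+1 + j).+1) F i (X i w).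
have bprod a b : (b <= N.+1)%N -> bmf (fun w => \prod_(a <= i < b) F i (X i w)).
  elim: b => [|b ihb] bN.
    rewrite (_ : (fun w => _) = fun=> 1); first exact: bmf_cst.
    by apply/funext => w; rewrite big_geq.
  have [ab|ba] := leqP a b; last first.
    rewrite (_ : (fun w => _) = fun=> 1); first exact: bmf_cst.
    by apply/funext => w; rewrite big_geq.
  rewrite (_ : (fun w => _) = fun w => \prod_(a <= i < b) F i (X i w) * F b (X b w)).
    by apply: bmfM; [exact/ihb/ltnW | apply: bX; exact: hF].
  by apply/funext => w; rewrite big_nat_recr.
have bG : bmf G by apply: bprod.
have key := weight_ext (P := P) (mX k.+1) (bmfM bG (bC pC)) (bmfM (bX k.+1 bV) (bC pC)).
have hFk := hF k1N.
have {}key : E (fun w => F k.+1 (X k.+1 w) * (G w * \1_C w)) =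
    E (fun w => F k.+1 (X k.+1 w) * (V (X k.+1 w) * \1_C w)).
  apply: key => // A mA.
  have pD : past X k.+1 (C `&` X k.+1 @^-1` A).
    by apply: pastI; [exact: pastS | exact: past_preimage].
  have := ih k.+1 _ kN' pD; rewrite -/V.
  under eq_Rintegral do rewrite indicI.
  under [in RHS]eq_Rintegral do rewrite indicI.
  move=> e; transitivity (\int[P]_w (G w * (\1_C w * \1_(X k.+1 @^-1` A) w))).
    by apply: eq_Rintegral => w _; rewrite mulrC -mulrA.
  rewrite e; apply: eq_Rintegral => w _.
  by rewrite mulrA [RHS]mulrC.
transitivity (E (fun w => F k.+1 (X k.+1 w) * (G w * \1_C w))).
  apply: eq_Rintegral => w _; rewrite mulrA addnS -addSn /G big_ltn//.
  by rewrite addSn !ltnS leq_addr.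
rewrite key.
transitivity (E (fun w => (F k.+1 (X k.+1 w) * V (X k.+1 w)) * \1_C w)).
  by apply: eq_Rintegral => w _; rewrite mulrA.
exact: (markov_step (f := fun y => F k.+1 y * V y) k1N pC (bmfM hFk bV)).
Qed.

Lemma markov_product_expectation :
  E (fun w => \prod_(1 <= i < N.+1) F i (X i w)) =
  \int[mu]_x chainop (weighted F) 0 N x.
Proof.
have := markov_product (leqnn (0 + N)) (@past_setT _ _ _ P _ _ X 0%N); rewrite add0n indicT.
under eq_Rintegral do rewrite mulr1.
under [in RHS]eq_Rintegral do rewrite mulr1.
by move=> ->; apply: markov_initial; apply: weighted_bmf.
Qed.

End markov_chain_expectation.

Lemma sum_nat_rev {R : realType} (a : nat -> R) n :
  \sum_(1 <= j < n.+1) a (n.+1 - j)%N = \sum_(0 <= k < n) a k.+1.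
Proof.
rewrite big_add1 big_nat_rev/=; apply: eq_big_nat => k /andP[_ kn].
by congr a; rewrite add0n subSS subKn.
Qed.

(** * Stationary chains and the asymptotic variance *)

Section stationary_chain.
Context {R : realType} {dO} {Omega : measurableType dO}
  {P : probability Omega R} {d} {T : measurableType d}.
Variables (Y : nat -> {RV P >-> T}) (mu : probability T R) (k : R.-pker T ~> T).
Hypothesis hY : forall N, markov_chain Y N mu (fun _ => k).
Hypothesis hinv : invariant_measure k mu.

Local Notation E := (fun G : Omega -> R => \int[P]_w G w).
Local Notation Q := (kop k).
Local Notation Pi := (fun f : T -> R => \int[mu]_x f x).

Let mY i : measurable_fun setT (Y i). Proof. exact: measurable_funPT. Qed.
Let bY i (f : T -> R) : bmf f -> bmf (fun w => f (Y i w)).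
Proof. exact: (bmf_comp (mY i)). Qed.
Let hk := kop_markov_op k.
Let hE : posfun E := E_posfun P.

Lemma invariant_markov_op : markov_op (fun f (_ : T) => Pi f).
Proof. exact: expectation_markov_op (probability_setT mu). Qed.

Lemma invariant_kop f : bmf f -> Pi (Q f) = Pi f.
Proof.
move=> hf; have h2 := posfun_mop point invariant_markov_op.
apply: (posfun_ext (I := fun f => Pi (Q f)) (J := Pi)) hf => //.
- split => [a g h hg hh|g hg g0]; last first.
    by apply: (pf_ge0 h2) => [|y]; [exact: mop_bmf | exact: (mop_ge0 hk)].
  have := pf_lin h2 a (mop_bmf hk hg) (mop_bmf hk hh) => <-.
  by apply: eq_Rintegral => x _; rewrite (mop_lin hk).
- move=> A mA; transitivity (fine (mu A)); last by rewrite Rintegral_indic.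
  rewrite -(hinv mA); congr fine; apply: eq_integral => x _.
  by rewrite kop_indic// fineK// prob_kernel_fin_num.
Qed.

Lemma stationary_past i j C (f : T -> R) : past Y i C -> bmf f ->
  E (fun w => f (Y (i + j)%N w) * \1_C w) = E (fun w => iter j Q f (Y i w) * \1_C w).
Proof.
move=> pC hf; elim: j i C pC => [|j ih] i C pC; first by rewrite addn0.
rewrite addnS -addSn ih; last exact: pastS.
rewrite iterS; apply: (markov_step (hY i.+1)) => //; exact: mop_iter_bmf.
Qed.

Lemma stationary_law i (f : T -> R) : bmf f -> E (fun w => f (Y i w)) = Pi f.
Proof.
move=> hf; have := stationary_past i (@past_setT _ _ _ P _ _ Y 0%N) hf.
rewrite add0n indicT.
under eq_Rintegral do rewrite mulr1.
under [in RHS]eq_Rintegral do rewrite mulr1.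
move=> ->; rewrite (markov_initial (hY 0%N)); last exact: mop_iter_bmf.
exact: (invariant_iter hk (Pi := Pi) invariant_kop).
Qed.

(** For f an indicator of A, the event {Y_i in A} belongs to the past at time i; [weight_ext]
    extends this to bounded f. *)
Lemma two_point i j (f g : T -> R) : bmf f -> bmf g ->
  E (fun w => f (Y i w) * g (Y (i + j)%N w)) = Pi (fun x => f x * iter j Q g x).
Proof.
move=> hf hg; have bg := mop_iter_bmf hk j hg.
rewrite -(stationary_law i); last exact: bmfM.
apply: (weight_ext (P := P) (mY i) (bY (i + j) hg) (bY i bg)) => // A mA.
have pA := past_preimage (X := Y) (leqnn i) mA.
have := stationary_past j pA hg => e.
transitivity (\int[P]_w (g (Y (i + j)%N w) * \1_(Y i @^-1` A) w)).
  by apply: eq_Rintegral => w _; rewrite mulrC.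
by rewrite e; apply: eq_Rintegral => w _; rewrite mulrC.
Qed.

Lemma variance_bmf (Z : Omega -> R) : bmf Z ->
  fine 'V_P[Z] = E (fun w => (Z w - E Z) ^+ 2).
Proof.
by move=> hZ; rewrite /variance unlock unlock; apply: eq_Rintegral => w _; rewrite expr2.
Qed.

Variable g : T -> R.
Hypothesis hg : bmf g.

Let S n w := \sum_(1 <= j < n.+1) g (Y j w).
Let gc x := g x - Pi g.
Let Sc n w := \sum_(1 <= j < n.+1) gc (Y j w).

Let bgc : bmf gc. Proof. by apply: bmfB => //; exact: bmf_cst. Qed.

Let bS (f : T -> R) n : bmf f -> bmf (fun w => \sum_(1 <= j < n.+1) f (Y j w)).
Proof.
move=> hf; elim: n => [|n ih].
  rewrite (_ : (fun w => _) = fun=> 0); first exact: bmf_cst.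
  by apply/funext => w; rewrite big_geq.
rewrite (_ : (fun w => _) = fun w => \sum_(1 <= j < n.+1) f (Y j w) + f (Y n.+1 w)).
  by apply: bmfD => //; exact: bY.
by apply/funext => w; rewrite big_nat_recr.
Qed.

Let ES (f h : T -> R) n : bmf f -> bmf h ->
  E (fun w => (\sum_(1 <= j < n.+1) f (Y j w)) * h (Y n.+1 w)) =
  \sum_(1 <= j < n.+1) Pi (fun x => f x * iter (n.+1 - j) Q h x).
Proof.
move=> hf hh.
suff main m : (m <= n)%N -> E (fun w => (\sum_(1 <= j < m.+1) f (Y j w)) * h (Y n.+1 w)) =
    \sum_(1 <= j < m.+1) Pi (fun x => f x * iter (n.+1 - j) Q h x) by exact: main.
elim: m => [|m ih] mn.
  rewrite [RHS]big_geq// -[RHS](pf0 hE).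
  by apply: eq_Rintegral => w _; rewrite big_geq// mul0r.
rewrite [RHS]big_nat_recr//= -ih; last exact: ltnW.
have e : (m.+1 + (n.+1 - m.+1))%N = n.+1 by rewrite subnKC// ltnS ltnW.
have := two_point m.+1 (n.+1 - m.+1) hf hh; rewrite e => <-.
rewrite -(pfD hE).
- by apply: eq_Rintegral => w _; rewrite big_nat_recr//= mulrDl.
- by apply: bmfM; [exact: bS | exact: bY].
- by apply: bmfM; exact: bY.
Qed.

Let mean_S n : E (S n) = n%:R * Pi g.
Proof.
elim: n => [|n ih].
  rewrite mul0r -[RHS](pf0 hE); apply: eq_Rintegral => w _.
  by rewrite /S big_geq.
rewrite -natr1 mulrDl mul1r -ih -(stationary_law n.+1 hg) -(pfD hE).
- by apply: eq_Rintegral => w _; rewrite /S big_nat_recr.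
- exact: bS.
- exact: bY.
Qed.

Let var_S n : fine 'V_P[S n] = E (fun w => Sc n w ^+ 2).
Proof.
rewrite variance_bmf; last exact: bS.
apply: eq_Rintegral => w _; rewrite mean_S; congr (_ ^+ 2).
rewrite /Sc /gc sumrB; congr (_ - _).
by rewrite sumr_const_nat subSS subn0 mulr_natl.
Qed.

(** The increment of the variance is the variance of one term plus twice its covariances with the n
    earlier ones, which by stationarity are those at lags 1 to n. *)
Lemma variance_step n : fine 'V_P[S n.+1] - fine 'V_P[S n] =
  2 * half_variance Q g Pi n.
Proof.
rewrite !var_S.
have b1 : bmf (fun w => Sc n w ^+ 2) by apply: bmfM; exact: bS.
have b2 : bmf (fun w => Sc n w * gc (Y n.+1 w)) by apply: bmfM; [exact: bS | exact: bY].
have bgc2 : bmf (fun x => gc x ^+ 2) by exact: bmfM.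
have b3 : bmf (fun w => gc (Y n.+1 w) ^+ 2) by exact: (bY n.+1 bgc2).
have -> : E (fun w => Sc n.+1 w ^+ 2) = E (fun w => Sc n w ^+ 2) +
    (2 * E (fun w => Sc n w * gc (Y n.+1 w)) + E (fun w => gc (Y n.+1 w) ^+ 2)).
  rewrite -(pfZ 2 hE b2) -(pfD hE (bmfZ 2 b2) b3) -(pfD hE b1 (bmfD (bmfZ 2 b2) b3)).
  by apply: eq_Rintegral => w _; rewrite /Sc big_nat_recr//=; ring.
rewrite addrAC subrr add0r (stationary_law n.+1 bgc2) (ES n bgc bgc).
rewrite (sum_nat_rev (fun m => Pi (fun x => gc x * iter m Q gc x))).
have hPi := posfun_mop point invariant_markov_op.
have bq m : bmf (fun x => gc x * iter m.+1 Q gc x).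
  by apply: bmfM => //; exact: mop_iter_bmf.
have bp2 : bmf (fun x => gc x ^+ 2 / 2) by apply: bmfM => //; exact: bmf_cst.
have -> : half_variance Q g Pi n =
    Pi (fun x => gc x ^+ 2) / 2 + \sum_(0 <= m < n) Pi (fun x => gc x * iter m.+1 Q gc x).
  rewrite /half_variance -(pf_sum n hPi bq) mulrC -(pfZ _ hPi bgc2) -(pfD hPi).
  - apply: eq_Rintegral => x _; rewrite mulrC; congr (_ + _).
    rewrite /poisson big_distrr/=; apply: eq_bigr => m _.
    by rewrite -(mop_iterB hk m.+1 _ x hg).
  - exact: bmfZ.
  - exact: (bmf_sum n (F := fun m x => gc x * iter m.+1 Q gc x)).
by field.
Qed.

Lemma variance_half n : fine 'V_P[S n] = \sum_(0 <= m < n) 2 * half_variance Q g Pi m.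
Proof.
elim: n => [|n ih]; last by rewrite big_nat_recr//= -ih -variance_step; ring.
rewrite big_nil var_S -[RHS](pf0 hE); apply: eq_Rintegral => w _.
by rewrite /Sc big_geq// expr0n.
Qed.

Lemma asymptotic_variance_half (l : R) :
  half_variance Q g Pi n @[n --> \oo] --> l -> asymptotic_variance P g Y = 2 * l.
Proof.
move=> hl; rewrite /asymptotic_variance; apply/cvg_lim => //.
have h2 : (fun n => 2 * half_variance Q g Pi n) @ \oo --> 2 * l by exact: cvgMr.
(* The n-th Cesaro mean of the increments is the variance of the first n + 1 terms divided by n + 1,
   whence the shift. *)
have := cesaro h2 => hc; rewrite -cvg_shiftS.
apply: cvg_trans hc; apply: near_eq_cvg; apply: nearW => n.
by rewrite /arithmetic_mean /series/= -/(S n.+1) variance_half.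
Qed.

End stationary_chain.

(** * Integration over the parameter *)

Section expansion_limit.
Context {d} {T : measurableType d} {R : realType}.
Variables (Q : (T -> R) -> T -> R) (hQ : markov_op Q) (g : T -> R).
Hypothesis hg : bmf g.
Variables (N : (T -> R) -> R) (C th K : R).
Hypothesis hN : contraction_seminorm Q N C th.
Hypotheses (hC : 1 <= C) (hth0 : 0 <= th) (hth1 : th < 1).
Hypotheses (hK0 : 0 <= K) (hK : forall x, `|g x| <= K).
Variables (Pi : (T -> R) -> R) (hPi : markov_op (fun f (_ : T) => Pi f)).
Hypothesis hPiQ : forall f, bmf f -> Pi (Q f) = Pi f.

Local Notation hv := (half_variance Q g Pi).
Local Notation G := (expansion_scale C th K).

(** The difference is the autocovariance at lag n + 1, which decays geometrically. *)
Lemma half_variance_step n : `|hv n.+1 - hv n| <= 2 * K * (C * K) * th ^+ n.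
Proof.
have hP := posfun_mop point hPi.
have bc : bmf (fun x => g x - Pi g) by apply: bmfB => //; exact: bmf_cst.
have bn m : bmf (fun x => (g x - Pi g) ^+ 2 / 2 + (g x - Pi g) * poisson Q Pi m g x).
  apply: bmfD; last by apply: bmfM => //; exact: poisson_bmf.
  by apply: bmfM; [exact: bmfM | exact: bmf_cst].
rewrite -(mopB hPi point (bn n.+1) (bn n)); apply: (mop_bound hPi point) => [|x].
  exact: bmfB.
rewrite /poisson big_nat_recr//= (_ : _ - _ = (g x - Pi g) * (iter n.+1 Q g x - Pi g)); last first.
  by rewrite /=; ring.
have h1 : `|g x - Pi g| <= 2 * K.
  rewrite (le_trans (ler_normB _ _))//; have := hK x.
  by have := mop_bound hPi point hg hK; lra.
have h2 := mop_iter_conv hQ hN hth0 hPi hPiQ n.+1 x hg.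
have Ng : N g <= C * K by apply: (csn_le hN (c := 0)) => // y; rewrite subr0.
rewrite normrM -mulrA; apply: ler_pM => //; apply: (le_trans h2).
have CK0 : 0 <= C * K by rewrite mulr_ge0//; have := hC; lra.
have N0 : 0 <= N g by exact: (csn_ge0 hN hg).
have t1 : th ^+ n.+1 <= th ^+ n.
  by rewrite exprS ler_piMl// ?exprn_ge0//; have := hth1; lra.
by rewrite mulrC; apply: ler_pM => //; exact: exprn_ge0.
Qed.

Lemma half_variance_cvg : cvgn hv.
Proof.
rewrite (_ : hv = fun n => hv 0%N + series (telescope hv) n); last first.
  by apply/funext => n; exact: eq_sum_telescope.
apply: is_cvgD; first exact: is_cvg_cst.
apply: normed_cvg; apply: (@series_le_cvg _ _ (geometric (2 * K * (C * K)) th)).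
- by move=> n; exact: normr_ge0.
- move=> n; rewrite /geometric/= mulr_ge0// ?exprn_ge0// !mulr_ge0//; have := hC; lra.
- by move=> n; rewrite /telescope/=; exact: half_variance_step.
- by apply: is_cvg_geometric_series; rewrite ger0_norm.
Qed.

Lemma half_variance_bound n : `|hv n| <= G.
Proof.
have h1 := hC; have h2 := hth1; have h3 := hK0.
have bc : bmf (fun x => g x - Pi g) by apply: bmfB => //; exact: bmf_cst.
apply: (mop_bound hPi point) => [|x].
  apply: bmfD; last by apply: bmfM => //; exact: poisson_bmf.
  by apply: bmfM; [exact: bmfM | exact: bmf_cst].
have gK : `|g x - Pi g| <= 2 * K.
  rewrite (le_trans (ler_normB _ _))//; have := hK x.
  by have := mop_bound hPi point hg hK; lra.
have Ng : N g <= C * K by apply: (csn_le hN (c := 0)) => // y; rewrite subr0.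
set B := C * K / (1 - th).
have B0 : 0 <= B by rewrite divr_ge0 ?mulr_ge0//; lra.
have pB : `|poisson Q Pi n g x| <= B.
  apply: (le_trans (poisson_bound hQ hN hth0 hth1 hPi hPiQ n x hg)).
  by rewrite ler_pM2r// invr_gt0; lra.
have KB := mulr_ge0 h3 B0; have K2 := sqr_ge0 K.
set D := 2 * K ^+ 2 + 2 * K * B.
have D0 : 0 <= D by rewrite /D; lra.
have CD : 0 <= C * D by rewrite mulr_ge0//; lra.
have CK : 0 <= C * K by rewrite mulr_ge0//; lra.
have CDt : 0 <= C * D / (1 - th) by rewrite divr_ge0//; lra.
have -> : G = 1 + 2 * K + C * K + B + D + C * D + C * D / (1 - th) by [].
apply: (@le_trans _ _ D); last by lra.
rewrite (le_trans (ler_normD _ _))// normrM normrX [X in _ * X]ger0_norm ?invr_ge0//.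
rewrite normrM /D; apply: lerD; last exact: ler_pM.
have : `|g x - Pi g| ^+ 2 <= (2 * K) ^+ 2 by rewrite lerXn2r// nnegrE; lra.
rewrite exprMn; lra.
Qed.

Lemma half_variance_lim_bound : `|limn hv| <= G.
Proof.
have h := half_variance_cvg.
apply: (ler_cvg_to (cvg_norm h) (cvg_cst G)).
by apply: nearW => n; exact: half_variance_bound.
Qed.

(** The truncation level n tends to infinity with t fixed, which removes the term in th^n. *)
Lemma pressure_expansion_lim t : small_tilt C th K t -> `|t| * (32 * (32 * G ^+ 3)) <= 1 ->
  `|pressure Q g t - (Pi g * t + limn hv * t ^+ 2)| <= 84 * G ^+ 3 * `|t| ^+ 3.
Proof.
move=> ht tG.
have c1 : `|pressure Q g t - (Pi g * t + hv n * t ^+ 2)| @[n --> \oo] -->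
    `|pressure Q g t - (Pi g * t + limn hv * t ^+ 2)|.
  apply: cvg_norm; apply: cvgB; first exact: cvg_cst.
  apply: cvgD; first exact: cvg_cst.
  by apply: cvgMl; exact: half_variance_cvg.
have c2 : 84 * G ^+ 3 * (`|t| ^+ 3 + `|t| * th ^+ n) @[n --> \oo] -->
    84 * G ^+ 3 * `|t| ^+ 3.
  rewrite (_ : 84 * G ^+ 3 * `|t| ^+ 3 = 84 * G ^+ 3 * (`|t| ^+ 3 + `|t| * 0)); last first.
    by rewrite mulr0 addr0.
  apply: cvgMr; apply: cvgD; first exact: cvg_cst.
  by apply: cvgMr; apply: cvg_expr; rewrite ger0_norm.
apply: (ler_cvg_to c1 c2); apply: nearW => n.
exact: (pressure_expansion hQ hg hN hC hth0 hth1 hK0 hK hPi hPiQ).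
Qed.

End expansion_limit.

(** * Integrals over the unit interval *)

Section unit_interval_integral.
Context {R : realType}.
Local Notation mu := (@lebesgue_measure R).
Implicit Types f : R -> R.

Lemma unit_integrable_cst (c : R) : mu.-integrable `[0, 1] (EFin \o (fun=> c)).
Proof.
apply: continuous_compact_integrable; first exact: segment_compact.
by apply: continuous_subspaceT => x; exact: cvg_cst.
Qed.

Lemma unit_integral_cst (c : R) : \int[mu]_(u in `[0%R, 1%R]) c = c.
Proof.
rewrite Rintegral_cst//= lebesgue_measure_itv/= lte01 -EFinB/= subr0 mulr1//.
Qed.

Lemma unit_integrable_bounded f (M : R) : measurable_fun (`[0, 1]%classic : set R) f ->
  (forall u, 0 <= u <= 1 -> `|f u| <= M) -> mu.-integrable `[0, 1] (EFin \o f).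
Proof.
move=> mf hM; apply: measurable_bounded_integrable => //.
  by rewrite /= lebesgue_measure_itv/= lte01 -EFinB ltry.
exists M; split; first exact: num_real.
by move=> y My x /=; rewrite in_itv/= => /hM /le_trans; apply; exact: ltW.
Qed.

Lemma unit_integrableD f1 f2 : mu.-integrable `[0, 1] (EFin \o f1) ->
  mu.-integrable `[0, 1] (EFin \o f2) ->
  mu.-integrable `[0, 1] (EFin \o (fun u => f1 u + f2 u)).
Proof.
move=> h1 h2.
rewrite (_ : EFin \o _ = (EFin \o f1) \+ (EFin \o f2))%E; first exact: integrableD.
by apply/funext => u /=; rewrite EFinD.
Qed.

Lemma unit_integrableZ c f : mu.-integrable `[0, 1] (EFin \o f) ->
  mu.-integrable `[0, 1] (EFin \o (fun u => c * f u)).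
Proof.
move=> h; rewrite (_ : EFin \o _ = (fun u => c%:E * (EFin \o f) u))%E.
  exact: integrableZl.
by apply/funext => u /=; rewrite EFinM.
Qed.

Lemma unit_integral_le f1 f2 : mu.-integrable `[0, 1] (EFin \o f1) ->
  mu.-integrable `[0, 1] (EFin \o f2) -> (forall u, 0 <= u <= 1 -> f1 u <= f2 u) ->
  \int[mu]_(u in `[0%R, 1%R]) f1 u <= \int[mu]_(u in `[0%R, 1%R]) f2 u.
Proof.
move=> h1 h2 h; apply: le_Rintegral => // u /=; rewrite in_itv/=; exact: h.
Qed.

Lemma unit_integralD f1 f2 : mu.-integrable `[0, 1] (EFin \o f1) ->
  mu.-integrable `[0, 1] (EFin \o f2) -> 
  \int[mu]_(u in `[0%R, 1%R]) (f1 u + f2 u) =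
  \int[mu]_(u in `[0%R, 1%R]) f1 u + \int[mu]_(u in `[0%R, 1%R]) f2 u.
Proof. by move=> h1 h2; rewrite RintegralD. Qed.

Lemma unit_integralZ c f : mu.-integrable `[0, 1] (EFin \o f) ->
  \int[mu]_(u in `[0%R, 1%R]) (c * f u) = c * \int[mu]_(u in `[0%R, 1%R]) f u.
Proof. by move=> h; rewrite RintegralZl. Qed.

Lemma eq_unit_integral f1 f2 : (forall u, 0 <= u <= 1 -> f1 u = f2 u) -> 
  \int[mu]_(u in `[0%R, 1%R]) f1 u = \int[mu]_(u in `[0%R, 1%R]) f2 u.
Proof.
by move=> h; apply: eq_Rintegral => u; rewrite inE/= in_itv/=; exact: h.
Qed.

(* Coefficients of a uniform Taylor expansion are limits of measurable functions. *)
Lemma measurable_first_order (h : R -> R -> R) (b : R -> R) (t1 M : R) : 0 < t1 ->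
  (forall t, 0 <= t <= t1 -> measurable_fun (`[0, 1]%classic : set R) (h ^~ t)) ->
  (forall u t, 0 <= u <= 1 -> 0 <= t <= t1 -> `|h u t - b u * t| <= M * t ^+ 2) ->
  measurable_fun (`[0, 1]%classic : set R) b.
Proof.
move=> t10 mh hb; pose tau n := t1 * n.+1%:R^-1.
have tau0 n : 0 < tau n by rewrite mulr_gt0.
have tau1 n : 0 <= tau n <= t1.
  by rewrite ltW//= ler_piMr ?(ltW t10)// invf_le1// ler1n.
apply: (measurable_fun_cvg (h := fun n u => (tau n)^-1 * h u (tau n))).
  by move=> n; apply: measurable_funM => //; exact: mh.
move=> u /=; rewrite in_itv/= => uI; apply/cvgrPdist_le => e e0.
have [n0 n00 hn0] := natr_ge_ex (`|M| * t1 / e); exists n0 => // n /= nn.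
have h1 := hb u _ uI (tau1 n).
have -> : b u - (tau n)^-1 * h u (tau n) = - ((tau n)^-1 * (h u (tau n) - b u * tau n)).
  by rewrite mulrBr [b u * _]mulrC mulKf ?gt_eqF//; ring.
have ti : 0 <= (tau n)^-1 by rewrite invr_ge0 ltW.
rewrite normrN normrM [`|(tau n)^-1|]ger0_norm// ler_pdivrMl//.
apply: (le_trans h1); rewrite expr2 mulrCA ler_pM2l//.
rewrite (@le_trans _ _ (`|M| * tau n))//; first by rewrite ler_wpM2r ?ler_norm// ltW.
rewrite /tau mulrA ler_pdivrMr// [e * _]mulrC -ler_pdivrMr//.
by rewrite (le_trans hn0)// ler_nat (leq_trans nn).
Qed.

End unit_interval_integral.

(** * Properties of the averaged pressure *)

Section averaged_pressure.
Context {d} {T : measurableType d} {R : realType}.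
Variables (Q : R -> (T -> R) -> T -> R) (g : R -> T -> R).
Variables (N : R -> (T -> R) -> R) (C th K L Cg : R).
Hypothesis hQ : forall u : R, 0 <= u <= 1 -> markov_op (Q u).
Hypothesis hg : forall u : R, 0 <= u <= 1 -> bmf (g u).
Hypothesis hN : forall u : R, 0 <= u <= 1 -> contraction_seminorm (Q u) (N u) C th.
Hypotheses (hC : 1 <= C) (hth0 : 0 <= th) (hth1 : th < 1) (hK0 : 0 <= K).
Hypothesis hK : forall (u : R) x, 0 <= u <= 1 -> `|g u x| <= K.
Hypotheses (hL0 : 0 <= L) (hCg0 : 0 <= Cg).
Hypothesis hL : forall (u v : R) f D x, 0 <= u <= 1 -> 0 <= v <= 1 -> bmf f ->
  (forall y, `|f y| <= D) -> `|Q u f x - Q v f x| <= L * `|u - v| * D.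
Hypothesis hCg : forall (u v : R) x, 0 <= u <= 1 -> 0 <= v <= 1 ->
  `|g u x - g v x| <= Cg * `|u - v|.
Variable Pi : R -> (T -> R) -> R.
Hypothesis hPi : forall u : R, 0 <= u <= 1 -> markov_op (fun f (_ : T) => Pi u f).
Hypothesis hPiQ : forall u : R, 0 <= u <= 1 -> forall f, bmf f -> Pi u (Q u f) = Pi u f.

Local Notation mu := (@lebesgue_measure R).
Local Notation lam := (fun u t => pressure (Q u) (g u) t).
Local Notation G := (expansion_scale C th K).
Local Notation b := (fun u => Pi u (g u)).
Local Notation l := (fun u => limn (half_variance (Q u) (g u) (Pi u))).

Let hKu (u : R) : 0 <= u <= 1 -> forall x, `|g u x| <= K.
Proof. by move=> hu x; exact: hK. Qed.

Let G1 : 1 <= G.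
Proof. exact: expansion_scale_ge1. Qed.

Lemma pressure_integrable t : small_tilt C th K t ->
  mu.-integrable `[0, 1] (EFin \o (lam ^~ t)).
Proof.
move=> ht; apply: modulus_integrable => e e0.
exact: (pressure_family_modulus hQ hg hN hC hth0 hth1 hK hL0 hCg0 hL hCg ht e0).
Qed.

Definition averaged_pressure t :=
  \int[mu]_(u in `[0%R, 1%R]) lam u t - (\int[mu]_(u in `[0%R, 1%R]) b u) * t.

Section admissible.
Variable t1 : R.
Hypotheses (t10 : 0 < t1) (t1K : 2 * (t1 * K) <= weight_radius C th).
Hypothesis t1G : t1 * (32 * (32 * G ^+ 3)) <= 1.

Lemma small_tiltW t : 0 <= t <= t1 -> small_tilt C th K t.
Proof.
move=> /andP[t0 tt]; rewrite /small_tilt ger0_norm//; apply: le_trans t1K.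
by rewrite ler_pM2l// ler_wpM2r.
Qed.

Lemma family_expansion (u t : R) : 0 <= u <= 1 -> 0 <= t <= t1 ->
  `|lam u t - (b u * t + l u * t ^+ 2)| <= 84 * G ^+ 3 * t ^+ 3.
Proof.
move=> hu ht; have /andP[t0 tt] := ht.
have [G3 G0] : 0 <= G ^+ 3 /\ 0 <= G by split; rewrite ?exprn_ge0 ?(le_trans ler01 G1).
have := @pressure_expansion_lim _ _ _ _ (hQ hu) _ (hg hu) _ _ _ _ (hN hu) hC hth0 hth1 hK0
  (hKu hu) _ (hPi hu) (hPiQ hu) t (small_tiltW ht).
rewrite ger0_norm//; apply; apply: le_trans t1G; apply: ler_wpM2r => //.
by rewrite !mulr_ge0.
Qed.

Lemma half_variance_lim_le u : 0 <= u <= 1 -> `|l u| <= G.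
Proof.
move=> hu; exact: (half_variance_lim_bound (hQ hu) (hg hu) (hN hu) hC hth0 hth1 hK0
  (hKu hu) (hPi hu) (hPiQ hu)).
Qed.

Lemma cubic_le_square t : 0 <= t <= t1 -> 84 * G ^+ 3 * t ^+ 3 <= t ^+ 2.
Proof.
move=> /andP[t0 tt].
have G3 : 0 <= G ^+ 3 by rewrite exprn_ge0 ?(le_trans ler01 G1).
have h : G ^+ 3 * t <= G ^+ 3 * t1 by rewrite ler_wpM2l.
have -> : 84 * G ^+ 3 * t ^+ 3 = (84 * (G ^+ 3 * t)) * t ^+ 2 by ring.
have k0 : 0 <= G ^+ 3 * t by rewrite mulr_ge0.
have := t1G; have k2 := sqr_ge0 t => k1.
have k3 : 84 * (G ^+ 3 * t) <= 1 by lra.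
by rewrite ler_piMl.
Qed.

Lemma pressure_measurable t : 0 <= t <= t1 ->
  measurable_fun (`[0, 1]%classic : set R) (lam ^~ t).
Proof.
move=> ht; have /integrableP[mf _] := pressure_integrable (small_tiltW ht).
exact/measurable_EFinP.
Qed.

(** Measurability of u -> pi_u(g_u) is read off from the pressure, of which it is the first-order
    coefficient at t = 0; the cubic remainder is absorbed into the quadratic one. *)
Lemma mean_integrable : mu.-integrable `[0, 1] (EFin \o b).
Proof.
apply: (@unit_integrable_bounded _ _ K) => [|u hu].
  apply: (@measurable_first_order _ (fun u t => lam u t) _ t1 (G + 1)) => // [|u t hu ht].
    exact: pressure_measurable.
  have h1 := family_expansion hu ht; have h2 := cubic_le_square ht.
  have h3 : `|l u * t ^+ 2| <= G * t ^+ 2.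
    by rewrite normrM [`|t ^+ 2|]ger0_norm ?sqr_ge0// ler_wpM2r ?sqr_ge0// half_variance_lim_le.
  have -> : lam u t - b u * t = (lam u t - (b u * t + l u * t ^+ 2)) + l u * t ^+ 2 by ring.
  by rewrite (le_trans (ler_normD _ _))// mulrDl mul1r addrC lerD// (le_trans h1).
exact: (mop_bound (hPi hu) point (hg hu) (hKu hu)).
Qed.

(** The same argument applied to the quotient (lam u t - t b u) / t, once b is known to be
    measurable. *)
Lemma half_variance_lim_integrable : mu.-integrable `[0, 1] (EFin \o l).
Proof.
apply: (@unit_integrable_bounded _ _ G) => [|u hu]; last exact: half_variance_lim_le.
apply: (@measurable_first_order _ (fun u t => (lam u t - t * b u) * t^-1) _ t1 (84 * G ^+ 3)) => //.
  move=> t ht; apply: measurable_funM => //; apply: measurable_funB; first exact: pressure_measurable.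
  apply: measurable_funM => //; have /integrableP[mf _] := mean_integrable.
  exact/measurable_EFinP.
move=> u t hu ht; have h1 := family_expansion hu ht; have /andP[t0 _] := ht.
(* At t = 0 the quotient is 0, since the inverse of 0 is 0. *)
have [->|tn0] := eqVneq t 0; first by rewrite invr0 !mulr0 subr0 normr0 expr2 !mulr0.
have tp : 0 < t by rewrite lt_neqAle eq_sym tn0.
have -> : (lam u t - t * b u) * t^-1 - l u * t =
    (lam u t - (b u * t + l u * t ^+ 2)) / t by field.
rewrite normrM [`|t^-1|]ger0_norm ?invr_ge0// ler_pdivrMr//.
by rewrite [leRHS](_ : _ = 84 * G ^+ 3 * t ^+ 3)//; ring.
Qed.

Lemma averaged_expansion t : 0 <= t <= t1 ->
  `|averaged_pressure t - (\int[mu]_(u in `[0%R, 1%R]) l u) * t ^+ 2| <= 84 * G ^+ 3 * t ^+ 3.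
Proof.
move=> ht; have ip := pressure_integrable (small_tiltW ht).
have ib := unit_integrableZ t mean_integrable.
have il := unit_integrableZ (t ^+ 2) half_variance_lim_integrable.
have ic := unit_integrable_cst (84 * G ^+ 3 * t ^+ 3).
have ibl := unit_integrableD ib il.
have h u (hu : 0 <= u <= 1) : - (84 * G ^+ 3 * t ^+ 3) <=
  lam u t - (t * b u + t ^+ 2 * l u) <= 84 * G ^+ 3 * t ^+ 3.
  by rewrite -ler_norml mulrC [t ^+ 2 * _]mulrC; exact: family_expansion.
have h1 : \int[mu]_(u in `[0%R, 1%R]) lam u t <=
    \int[mu]_(u in `[0%R, 1%R]) (t * b u + t ^+ 2 * l u + 84 * G ^+ 3 * t ^+ 3).
  apply: unit_integral_le => //; first exact: unit_integrableD.
  by move=> u /h; lra.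
have h2 : \int[mu]_(u in `[0%R, 1%R]) (t * b u + t ^+ 2 * l u) <=
    \int[mu]_(u in `[0%R, 1%R]) (lam u t + 84 * G ^+ 3 * t ^+ 3).
  apply: unit_integral_le => //; first exact: unit_integrableD.
  by move=> u /h; lra.
move: h1 h2; rewrite (unit_integralD ibl ic) (unit_integralD ip ic) (unit_integralD ib il).
rewrite unit_integral_cst (unit_integralZ t mean_integrable).
rewrite (unit_integralZ (t ^+ 2) half_variance_lim_integrable) /averaged_pressure => h1 h2.
rewrite ler_norml; apply/andP; split; lra.
Qed.

Lemma averaged_pressure_lip s t : 0 <= s <= t1 -> 0 <= t <= t1 ->
  `|averaged_pressure s - averaged_pressure t| <=
  (K + `|\int[mu]_(u in `[0%R, 1%R]) b u|) * `|s - t|.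
Proof.
move=> hs ht; have is1 := pressure_integrable (small_tiltW hs).
have it := pressure_integrable (small_tiltW ht).
have ic := unit_integrable_cst (K * `|s - t|).
have h u (hu : 0 <= u <= 1) : - (K * `|s - t|) <= lam u s - lam u t <= K * `|s - t|.
  by rewrite -ler_norml; exact: (pressure_lip (hQ hu) (hg hu) (hN hu) hC hth0 hth1
    (hKu hu) (small_tiltW ht) (small_tiltW hs)).
have h1 : \int[mu]_(u in `[0%R, 1%R]) lam u s <=
    \int[mu]_(u in `[0%R, 1%R]) (lam u t + K * `|s - t|).
  apply: unit_integral_le => //; first exact: unit_integrableD.
  by move=> u /h; lra.
have h2 : \int[mu]_(u in `[0%R, 1%R]) lam u t <=
    \int[mu]_(u in `[0%R, 1%R]) (lam u s + K * `|s - t|).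
  apply: unit_integral_le => //; first exact: unit_integrableD.
  by move=> u /h; lra.
move: h1 h2; rewrite !(unit_integralD, unit_integral_cst)// => h1 h2.
rewrite /averaged_pressure mulrDl -normrM.
set B := \int[mu]_(u in _) b u.
have -> : \int[mu]_(u in `[0%R, 1%R]) lam u s - B * s -
    (\int[mu]_(u in `[0%R, 1%R]) lam u t - B * t) =
    (\int[mu]_(u in `[0%R, 1%R]) lam u s - \int[mu]_(u in `[0%R, 1%R]) lam u t) - B * (s - t).
  by ring.
rewrite (le_trans (ler_normB _ _))// lerD2r ler_norml; apply/andP; split; lra.
Qed.

Lemma averaged_second_difference t s : 0 <= t - s -> t + s <= t1 -> 0 <= s ->
  s * corrector_bound C th K <= 1 / 2 ->
  averaged_pressure (t + s) + averaged_pressure (t - s) - 2 * averaged_pressure t <=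
  2 * second_difference_bound C th K * s ^+ 2.
Proof.
move=> ts0 ts1 s0 sB.
have hp : 0 <= t + s <= t1 by apply/andP; split; lra.
have hm : 0 <= t - s <= t1 by apply/andP; split; lra.
have h0 : 0 <= t <= t1 by apply/andP; split; lra.
have ip := pressure_integrable (small_tiltW hp).
have im := pressure_integrable (small_tiltW hm).
have i0 := pressure_integrable (small_tiltW h0).
have i02 := unit_integrableZ 2 i0.
set D := 2 * second_difference_bound C th K * s ^+ 2.
have iD := unit_integrable_cst D.
have : \int[mu]_(u in `[0%R, 1%R]) (lam u (t + s) + lam u (t - s)) <=
    \int[mu]_(u in `[0%R, 1%R]) (2 * lam u t + D).
  apply: unit_integral_le => //; [exact: unit_integrableD|exact: unit_integrableD|].
  move=> u hu; rewrite -lerBlDl /D -mulrA.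
  apply: (pressure_second_difference (hQ hu) (hg hu) (hN hu) hC hth0 hth1 hK0
    (hKu hu) (small_tiltW h0) (small_tiltW hp) (small_tiltW hm)).
  by rewrite ger0_norm.
rewrite !(unit_integralD, unit_integralZ, unit_integral_cst)// /averaged_pressure.
lra.
Qed.

Lemma averaged_pressure0 : averaged_pressure 0 = 0.
Proof.
have h1 : 0 <= (0 : R) <= t1 by rewrite lexx ltW.
rewrite /averaged_pressure mulr0 subr0 (@eq_unit_integral _ _ (fun=> 0)) ?unit_integral_cst//.
by move=> u hu; exact: (pressure0 (hQ hu) (hg hu) (hN hu) hC hth0 hth1 (hKu hu) (small_tiltW h1)).
Qed.

Lemma half_variance_integral_le : \int[mu]_(u in `[0%R, 1%R]) l u <= G.
Proof.
rewrite -[leRHS](@unit_integral_cst R); apply: unit_integral_le.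
- exact: half_variance_lim_integrable.
- exact: unit_integrable_cst.
- by move=> u /half_variance_lim_le; rewrite ler_norml => /andP[].
Qed.

End admissible.

End averaged_pressure.

(** * From the assumptions on kernels to operator estimates *)

Section kernel_estimates.
Context {R : realType} {d} {T : measurableType d}.

Lemma ereal_sup_image_le {I : Type} (A : set I) (F : I -> \bar R) c i :
  (ereal_sup [set F i | i in A] <= c)%E -> A i -> (F i <= c)%E.
Proof. by move=> h Ai; apply: le_trans h; apply: ereal_sup_ubound; exists i. Qed.

Lemma supnorm_le (f : T -> R) c x : (supnorm f <= c%:E)%E -> `|f x| <= c.
Proof. by move=> h; rewrite -lee_fin; exact: (ereal_sup_image_le h). Qed.

Lemma section_bmf (g : R -> T -> R) (u K : R) :
  measurable_fun (`[(0 : R), (1 : R)] `*` [set: T]) (fun z : R * T => g z.1 z.2) ->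
  0 <= u <= 1 -> (forall x, `|g u x| <= K) -> bmf (g u).
Proof.
move=> mg hu hK; split; last by exists K.
apply: (measurable_comp (F := `[(0 : R), (1 : R)] `*` [set: T]) _ _ mg (pair1_measurable u)).
- by apply: measurableX.
- by move=> _ [x _ <-] /=; split => //=; rewrite in_itv.
Qed.

Lemma kop_lipschitz (k1 k2 : R.-pker T ~> T) c f D x :
  (ereal_sup [set tv (k1 x) (k2 x) | x in [set: T]] <= c%:E)%E ->
  bmf f -> (forall y, `|f y| <= D) -> `|kop k1 f x - kop k2 f x| <= c * D.
Proof.
move=> h; apply: tv_le; [exact: pker_setT|exact: pker_setT|exact: (ereal_sup_image_le h)].
Qed.

Lemma kop_iter_contraction (k : R.-pker T ~> T) m r f D x y :
  (ereal_sup [set tv (kiter k m z.1) (kiter k m z.2) | z in [set: T * T]] <= r%:E)%E ->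
  bmf f -> (forall z, `|f z| <= D) -> iter m (kop k) f x - iter m (kop k) f y <= r * D.
Proof.
move=> h hf hD; rewrite (le_trans (ler_norm _))// -!Rintegral_kiter//.
apply: tv_le => //; [exact: kiter_setT|exact: kiter_setT|].
exact: (ereal_sup_image_le (i := (x, y)) h).
Qed.

Lemma rowsum_bmf {dO} {Omega : measurableType dO} {P : probability Omega R}
    (X : nat -> {RV P >-> T}) (g : R -> T -> R) n :
  (forall u : R, 0 <= u <= 1 -> bmf (g u)) -> bmf (rowsum g n X).
Proof.
(* [bmf_sum] asks for every index i, whereas g is controlled only for parameters in [0, 1]; the test
   i < n guards the others. *)
move=> hg; rewrite (_ : rowsum g n X = fun w => \sum_(0 <= i < n)
    (if (i < n)%N then g (i.+1%:R / n%:R) (X i.+1 w) else 0)); last first.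
  by apply/funext => w; rewrite /rowsum big_add1/=; apply: eq_big_nat => i /andP[_ ->].
apply: bmf_sum => i; case: (ltnP i n) => iN; last exact: bmf_cst.
apply: (bmf_comp (measurable_funPT (X i.+1))); apply: hg.
by apply: natr_div_unit => //; exact: leq_trans iN.
Qed.

Lemma rowsum_laplace {dO} {Omega : measurableType dO} {P : probability Omega R}
    (X : nat -> {RV P >-> T}) (Q : R -> R.-pker T ~> T) (mu : probability T R)
    (g : R -> T -> R) n t :
  (0 < n)%N -> (forall u : R, 0 <= u <= 1 -> bmf (g u)) ->
  markov_chain X n mu (fun k => Q (k%:R / n%:R)) ->
  \int[P]_w expR (t * rowsum g n X w) =
  \int[mu]_x chainop (fun k => laplace (kop (Q (k%:R / n%:R))) (g (k%:R / n%:R)) t) 0 n x.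
Proof.
move=> n0 hg hX.
have hF i : (i <= n)%N -> bmf (fun x => expR (t * g (i%:R / n%:R) x)).
  by move=> iN; apply: bmf_expR; apply: bmfZ; apply: hg; exact: natr_div_unit.
have <- := markov_product_expectation hX hF.
apply: eq_Rintegral => w _; rewrite /rowsum mulr_sumr.
exact: (big_morph expR (@expRD R) (@expR0 R)).
Qed.

End kernel_estimates.

(** * Verification of the hypotheses of the Gaertner-Ellis theorem *)

Theorem theorem9 (R : realType) (E : pmetricType R)
  (Q : R -> R.-pker (borel E) ~> (borel E))
  (pi : R -> probability (borel E) R)
  (g : R -> borel E -> R)
  (* triangular array *)
  (dX : nat -> measure_display)
  (OX : forall n : nat, measurableType (dX n))
  (PX : forall n : nat, probability (OX n) R)
  (X : forall n : nat, nat -> {RV (PX n) >-> borel E})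
  (* stationary chains *)
  (dY : R -> measure_display)
  (OY : forall u : R, measurableType (dY u))
  (PY : forall u : R, probability (OY u) R)
  (Y : forall u : R, nat -> {RV (PY u) >-> borel E})
  (L : R) (m : nat) (r K Cg a : R)
  (hpi : forall u : R, u \in `[0, 1] -> invariant_measure (Q u) (pi u))
  (hX : forall n, (1 <= n)%N ->
     markov_chain (X n) n (pi 0) (fun k => Q (k%:R / n%:R)))
  (hY : forall u : R, u \in `[0, 1] ->
     forall N, markov_chain (Y u) N (pi u) (fun _ => Q u))
  (hg : measurable_fun (`[(0 : R), (1 : R)] `*` [set: borel E])
     (fun z : R * borel E => g z.1 z.2))
  (* (i) *)
  (hL : 0 < L)
  (hQ : forall u v : R, u \in `[0, 1] -> v \in `[0, 1] ->
     (ereal_sup [set tv (Q u x) (Q v x) | x in [set: borel E]]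
        <= (L * `|u - v|)%:E)%E)
  (* (ii) *)
  (hm : (1 <= m)%N) (hr0 : 0 < r) (hr1 : r < 1)
  (hQm : (ereal_sup [set ereal_sup
            [set tv (kiter (Q u) m z.1) (kiter (Q u) m z.2)
              | z in [set: borel E * borel E]]
            | u in `[0%R, 1%R]] <= r%:E)%E)
  (* (iii) *)
  (hK : (ereal_sup [set supnorm (g u) | u in `[0%R, 1%R]] <= K%:E)%E)
  (* (iv) *)
  (hCg : 0 <= Cg)
  (hgL : forall (u v : R) x, u \in `[0, 1] -> v \in `[0, 1] ->
     `|g u x - g v x| <= Cg * `|u - v|)
  (ha : 0 < a)
  (ha2 : a ^+ 2 = \int[lebesgue_measure]_(u in `[0%R, 1%R])
     asymptotic_variance (PY u) (g u) (Y u)) :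
  exists (eps0 : R) (c : R -> R),
    [/\ 0 < eps0,
        forall eps, 0 < eps < eps0 -> 0 < c eps,
        @convex_function R R^o `]0, eps0[ c &
        forall eps, 0 < eps < eps0 ->
          ((n%:R^-1)%:E *
             lne (PX n [set w | (rowsum g n (X n) w - mean_drift g pi * n%:R
                                 >= eps * n%:R)%R]))%E
            @[n --> \oo] --> (- c eps)%:E].

Proof.
pose C := dobrushin_const m r; pose th := dobrushin_rate m r.
pose G := expansion_scale C th K.
pose Qo (u : R) := kop (Q u).
pose N (u : R) := dobrushin_seminorm (Qo u) m r.
pose Pi (u : R) := fun f : borel E -> R => \int[pi u]_x f x.
have uI (u : R) : 0 <= u <= 1 -> u \in `[0, 1] by rewrite in_itv.
have gK (u : R) x : 0 <= u <= 1 -> `|g u x| <= K.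
  move=> hu; apply: supnorm_le; apply: (ereal_sup_image_le (i := u) hK).
  by rewrite /= in_itv.
have I0 : 0 <= (0 : R) <= 1 by rewrite lexx ler01.
have K0 : 0 <= K := le_trans (normr_ge0 _) (gK 0 point I0).
have gb (u : R) : 0 <= u <= 1 -> bmf (g u).
  by move=> hu; apply: (section_bmf (K := K) hg hu) => x; exact: gK.
have Qop (u : R) : 0 <= u <= 1 -> markov_op (Qo u) by move=> _; exact: kop_markov_op.
have NC (u : R) : 0 <= u <= 1 -> contraction_seminorm (Qo u) (N u) C th.
  move=> hu; apply: dobrushin_contraction => //; first exact: Qop.
  move=> f D x y hf hD; apply: kop_iter_contraction hf hD.
  by apply: (ereal_sup_image_le (i := u) hQm); rewrite /= in_itv.
have C1 : 1 <= C by exact: dobrushin_const_ge1.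
have th0 : 0 <= th by apply: ltW; exact: dobrushin_rate_gt0.
have th1 : th < 1 by exact: dobrushin_rate_lt1.
have Qlip (u v : R) f D x : 0 <= u <= 1 -> 0 <= v <= 1 -> bmf f ->
    (forall y, `|f y| <= D) -> `|Qo u f x - Qo v f x| <= L * `|u - v| * D.
  by move=> hu hv; apply: kop_lipschitz; apply: hQ; exact: uI.
have glip (u v : R) x : 0 <= u <= 1 -> 0 <= v <= 1 -> `|g u x - g v x| <= Cg * `|u - v|.
  by move=> hu hv; apply: hgL; exact: uI.
have Piop (u : R) : 0 <= u <= 1 -> markov_op (fun f (_ : borel E) => Pi u f).
  by move=> _; exact: invariant_markov_op.
have PiQ (u : R) : 0 <= u <= 1 -> forall f, bmf f -> Pi u (Qo u f) = Pi u f.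
  by move=> hu f hf; apply: (invariant_kop (hpi _ (uI _ hu)) hf).
pose l (u : R) := limn (half_variance (Qo u) (g u) (Pi u)).
pose v : R := \int[lebesgue_measure]_(u in `[0%R, 1%R]) l u.
have L0 := ltW hL.
have G1 : 1 <= G by exact: expansion_scale_ge1.
have G30 : 0 < G ^+ 3 by rewrite exprn_gt0// (lt_le_trans ltr01 G1).
have wr0 : 0 < weight_radius C th by exact: weight_radius_gt0.
have half_int := half_variance_lim_integrable Qop gb NC C1 th0 th1 K0 gK L0 hCg Qlip glip Piop PiQ.
have small (p q : R) : 0 < p -> 0 <= q -> exists2 t : R, 0 < t & t * q <= p.
  move=> p0 q0; exists (p / (q + 1)); first by rewrite divr_gt0// ltr_wpDl.
  by rewrite mulrAC ler_pdivrMr ?ltr_wpDl// ler_pM2l// lerDl.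
have tt (p q t s : R) : 0 < p -> t <= s -> 0 <= q -> s * q <= p -> t * q <= p.
  by move=> p0 ts q0; apply: le_trans; rewrite ler_wpM2r.
have [ta ta0 taK] := small (weight_radius C th) (2 * K) wr0 ltac:(lra).
have [tb tb0 tbG] := small 1 (32 * (32 * G ^+ 3)) ltr01 ltac:(lra).
have v0 : 0 < v.
  (* Integrability of l requires an admissible interval of tilts. Since t1 below is chosen in terms
     of v, a preliminary interval is used to show v > 0; there a^2 = 2 v brings in the assumption a
     > 0. *)
  pose tc := Num.min ta tb.
  have tc0 : 0 < tc by rewrite lt_min ta0.
  have tcK : 2 * (tc * K) <= weight_radius C th.
    by rewrite mulrCA; apply: (tt _ _ _ ta) => //; [rewrite ge_min lexx | lra].
  have tcG : tc * (32 * (32 * G ^+ 3)) <= 1.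
    by apply: (tt _ _ _ tb) => //; [rewrite ge_min lexx orbT | lra].
  have e : a ^+ 2 = 2 * v.
    rewrite ha2 /v -(unit_integralZ 2 (half_int _ tc0 tcK tcG)).
    apply: eq_unit_integral => u hu.
    apply: (asymptotic_variance_half (hY _ (uI _ hu)) (hpi _ (uI _ hu)) (gb _ hu)).
    exact: (half_variance_cvg (Qop u hu) (gb u hu) (NC u hu) C1 th0 th1 K0 (fun x => gK u x hu)
      (Piop u hu) (PiQ u hu)).
  by have := exprn_gt0 2 ha; lra.
(* The remainder at t1 is 84 G^3 t1^3; with 85 instead of 84 the quadratic term v t1^2 strictly
   exceeds it, so Lam t1 > 0. *)
have [td td0 tdv] := small v (85 * G ^+ 3) v0 ltac:(lra).
pose t1 := Num.min td (Num.min ta tb).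
have t10 : 0 < t1 by rewrite !lt_min td0 ta0.
have t1K : 2 * (t1 * K) <= weight_radius C th.
  by rewrite mulrCA; apply: (tt _ _ _ ta) => //; [rewrite !ge_min lexx orbT | lra].
have t1G : t1 * (32 * (32 * G ^+ 3)) <= 1.
  by apply: (tt _ _ _ tb) => //; [rewrite !ge_min lexx !orbT | lra].
have t1v : t1 * (85 * G ^+ 3) <= v.
  by apply: (tt _ _ _ td) => //; [rewrite ge_min lexx | lra].
pose Lam := averaged_pressure Qo g Pi.
have expan := averaged_expansion Qop gb NC C1 th0 th1 K0 gK L0 hCg Qlip glip Piop PiQ t10 t1K t1G.
have B0 : 0 <= corrector_bound C th K by exact: corrector_bound_ge0.
have D0 : 0 <= second_difference_bound C th K.
  have b1 := mulr_ge0 K0 B0; have b2 := mulr_ge0 B0 (addr_ge0 K0 B0).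
  by apply: mulr_ge0 => //; have := sqr_ge0 K; lra.
have [s0 s00 s0B] := small (1 / 2) (corrector_bound C th K) ltac:(lra) B0.
pose W n w := rowsum g n (X n) w - mean_drift g pi * n%:R.
have hW n : bmf (W n).
  apply: bmfB; last exact: bmf_cst.
  exact: (rowsum_bmf (X n)).
have vG : v <= G.
  exact: (half_variance_integral_le Qop gb NC C1 th0 th1 K0 gK L0 hCg Qlip glip Piop PiQ t10 t1K t1G).
(* The constant A serves two purposes: its first summand bounds second differences, and G + 1 bounds
   Lam t / t^2, because v <= G and the cubic remainder is at most t^2. *)
apply: (gartner_ellis hW (Lam := Lam) (A := 2 * second_difference_bound C th K + G + 1)
  t10 _ s00).
- by lra.
- move=> t e ht e0.
  have tst := small_tiltW K0 t1K ht.
  have [n0 n00 hn] := chainop_limit Qop gb NC C1 th0 th1 gK L0 hCg Qlip glip tst e0.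
  exists n0 => // n nn; have nP : (0 < n)%N by exact: leq_trans nn.
  have eW w : expR (t * W n w) = expR (- (t * mean_drift g pi * n%:R)) * expR (t * rowsum g n (X n) w).
    by rewrite -expRD; congr expR; rewrite /W; ring.
  have -> : \int[PX n]_w expR (t * W n w) =
      expR (- (t * mean_drift g pi * n%:R)) * \int[PX n]_w expR (t * rowsum g n (X n) w).
    under eq_Rintegral do rewrite eW.
    apply: (mopZ (expectation_markov_op (probability_setT (PX n))) _ point).
    by apply: bmf_expR; apply: bmfZ; exact: (rowsum_bmf (X n)).
  rewrite (rowsum_laplace t nP gb (hX n nP)).
  set Z := chainop _ 0 n.
  have bZ : bmf Z by exact: (chainop_bmf Qop gb t nP (add0n n)).
  (* The bounds are uniform in the starting point, so they pass through integration against the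
     initial law. *)
  have ZL := mop_geC (Piop 0 I0) point bZ (fun x => (andP (hn n x nn)).1).
  have ZU := mop_leC (Piop 0 I0) point bZ (fun x => (andP (hn n x nn)).2).
  have shift (c : R) : expR (n%:R * (Lam t + c)) = expR (- (t * mean_drift g pi * n%:R)) *
     expR (n%:R * (\int[lebesgue_measure]_(u in `[0%R, 1%R]) pressure (Qo u) (g u) t + c)).
    by rewrite -expRD; congr expR; rewrite /Lam /averaged_pressure /mean_drift /Pi; ring.
  by rewrite !shift !ler_pM2l ?expR_gt0// ZL.
- move=> s t hs ht.
  exact: (averaged_pressure_lip Qop gb NC C1 th0 th1 K0 gK L0 hCg Qlip glip Pi t1K hs ht).
- move=> t s h1 h2 h3 h4.
  apply: (le_trans (averaged_second_difference Qop gb NC C1 th0 th1 K0 gK L0 hCg Qlip glip Pi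
    t1K h1 h2 h3 _)).
    by apply: (tt _ _ _ s0) => //; lra.
  by rewrite ler_wpM2r ?sqr_ge0//; lra.
- exact: (averaged_pressure0 Qop gb NC C1 th0 th1 K0 gK Pi t10 t1K).
- move=> t ht; have := expan t ht.
  have c2 := cubic_le_square C1 th1 K0 t1G ht.
  rewrite ler_norml => /andP[_ h].
  have k1 : v * t ^+ 2 <= G * t ^+ 2 by rewrite ler_wpM2r ?sqr_ge0.
  have k2 : 0 <= second_difference_bound C th K * t ^+ 2 by rewrite mulr_ge0// sqr_ge0.
  rewrite /Lam; move: h; rewrite -/l -/v; lra.
- have t1I : 0 <= t1 <= t1 by rewrite lexx andbT ltW.
  have := expan t1 t1I; rewrite ler_norml => /andP[h _].
  have k1 : t1 * (85 * G ^+ 3) * t1 ^+ 2 <= v * t1 ^+ 2 by rewrite ler_wpM2r ?sqr_ge0.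
  have k2 : 0 < G ^+ 3 * t1 ^+ 3 by rewrite mulr_gt0// exprn_gt0.
  have k3 : t1 * (85 * G ^+ 3) * t1 ^+ 2 = 85 * (G ^+ 3 * t1 ^+ 3) by ring.
  by move: h k1; rewrite k3 -/l -/v -/G -/Lam; lra.
Qed.
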